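(* Let $\Sigma$ be a root system of rank $n$ with Weyl group $W$. There is $p_0$ such that for every algebraically closed field $\mathbb{F}$ of characteristic $p>p_0$, the skew field of fractions of $A_n(\mathbb{F})^W$ is isomorphic to $\mathbb{D}_{m,l}(\mathbb{F})$ for some $m,l\ge0$ (i.e. to a Weyl field over a purely transcendental extension of $\mathbb{F}$).
   Context: For a field $K$, $A_n(K)$ is the $K$-algebra generated by $x_1,\dots,x_n,y_1,\dots,y_n$ with relations $[x_i,x_j]=[y_i,y_j]=0$, $[y_i,x_j]=\delta_{ij}$; $A_n(\mathbb{Z})$ is the $\mathbb{Z}$-algebra with the same presentation; $\mathbb{D}_{m,l}(K)$ is the skew field of fractions of $A_m(K(t_1,\dots,t_l))$. The Weyl group $W$ acts on the root lattice $\mathbb{Z}\Delta\cong\mathbb{Z}^n$, hence linearly on $\mathbb{Z}[x_1,\dots,x_n]$, and on $A_n(\mathbb{Z})$ (the differential operators on $\mathbb{Z}[x_1,\dots,x_n]$) by conjugation $g\cdot D=g\circ D\circ g^{-1}$; reducing modulo $p$ if necessary, this gives an action on $A_n(\mathbb{F})$ for any field $\mathbb{F}$, with invariant subalgebra $A_n(\mathbb{F})^W$. *)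

(* Defs.v *)
From HB Require Import structures.
From mathcomp Require Import all_boot all_order all_algebra.
From mathcomp Require Import reals.
Set Implicit Arguments. Unset Strict Implicit. Unset Printing Implicit Defensive.
Import Order.TTheory GRing.Theory Num.Theory.
Local Open Scope ring_scope.

Definition edot (R : realType) (n : nat) (u v : 'rV[R]_n) : R := (u *m v^T) 0 0.

Definition cartan (R : realType) (n : nat) (b a : 'rV[R]_n) : R :=
  2 * edot b a / edot a a.

Definition refl (R : realType) (n : nat) (a v : 'rV[R]_n) : 'rV[R]_n :=
  v - cartan v a *: a.

Definition is_root_system (R : realType) (n : nat) (Phi : seq 'rV[R]_n) : Prop :=
  uniq Phi /\ (0 : 'rV[R]_n) \notin Phi /\
  [/\
      (forall v : 'rV[R]_n, exists c : 'I_(size Phi) -> R,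
          v = \sum_(k < size Phi) c k *: Phi`_k),
      (forall a b, a \in Phi -> b \in Phi -> refl a b \in Phi),
      (forall a b, a \in Phi -> b \in Phi -> exists z : int, cartan b a = z%:~R)
    & (forall a (c : R), a \in Phi -> c *: a \in Phi -> c = 1 \/ c = -1)].

Definition is_root_lattice_basis (R : realType) (n : nat) (Phi : seq 'rV[R]_n)
    (b : 'I_n -> 'rV[R]_n) : Prop :=
  [/\ (forall i, exists c : 'I_(size Phi) -> int, b i = \sum_(k < size Phi) Phi`_k *~ c k),
      (forall a, a \in Phi -> exists c : 'I_n -> int, a = \sum_(i < n) b i *~ c i)
    & (forall c : 'I_n -> int, \sum_(i < n) b i *~ c i = 0 -> forall i, c i = 0)].

(* Elements of the Weyl group W are products of reflections s_a, a in Phi;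
   a word ws (a list of roots) acts on R^n by the composite of reflections. *)
Definition weyl_act (R : realType) (n : nat) (ws : seq 'rV[R]_n) (v : 'rV[R]_n) :
  'rV[R]_n := foldr (@refl R n) v ws.

Definition weyl_matrix (R : realType) (n : nat) (b : 'I_n -> 'rV[R]_n)
    (ws : seq 'rV[R]_n) (C : 'M[int]_n) : Prop :=
  forall j, weyl_act ws (b j) = \sum_(i < n) b i *~ C i j.

Definition is_alg_hom (K : fieldType) (A B : algType K) (f : A -> B) : Prop :=
  [/\ (forall u v, f (u + v) = f u + f v),
      (forall u v, f (u * v) = f u * f v),
      f 1 = 1
    & (forall (k : K) u, f (k *: u) = k *: f u)].

Definition weyl_relations (K : fieldType) (n : nat) (B : algType K)
    (x y : 'I_n -> B) : Prop :=
  [/\ (forall i j, x i * x j = x j * x i),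
      (forall i j, y i * y j = y j * y i)
    & (forall i j, y i * x j - x j * y i = (i == j)%:R)].

Definition is_weyl_algebra (K : fieldType) (n : nat) (A : algType K)
    (x y : 'I_n -> A) : Prop :=
  weyl_relations x y /\
  forall (B : algType K) (x' y' : 'I_n -> B), weyl_relations x' y' ->
    (exists f : A -> B, is_alg_hom f /\ (forall i, f (x i) = x' i /\ f (y i) = y' i)) /\
    (forall f g : A -> B, is_alg_hom f -> is_alg_hom g ->
       (forall i, f (x i) = g (x i) /\ f (y i) = g (y i)) -> forall u, f u = g u).

(* sigma is the automorphism of A_n(F) induced by the linear change of
   variables g : x_j |-> sum_i C i j x_i, i.e. g.D = g o D o g^-1;
   this sends y_j to sum_k Cinv j k y_k where Cinv = C^-1 (integer entries
   reduced into F). *)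
Definition weyl_alg_action (K : fieldType) (n : nat) (A : algType K)
    (x y : 'I_n -> A) (C Cinv : 'M[int]_n) (sigma : A -> A) : Prop :=
  is_alg_hom sigma /\
  forall j, sigma (x j) = \sum_(i < n) (C i j)%:~R * x i /\
            sigma (y j) = \sum_(k < n) (Cinv j k)%:~R * y k.

Definition weyl_invariant (R : realType) (n : nat) (Phi : seq 'rV[R]_n)
    (b : 'I_n -> 'rV[R]_n) (K : fieldType) (A : algType K) (x y : 'I_n -> A)
    (u : A) : Prop :=
  forall (ws : seq 'rV[R]_n) (C Cinv : 'M[int]_n) (sigma : A -> A),
    all (fun a => a \in Phi) ws -> weyl_matrix b ws C -> Cinv *m C = 1%:M ->
    weyl_alg_action x y C Cinv sigma -> sigma u = u.

Definition is_division_ring (D : unitRingType) : Prop :=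
  (1 : D) != 0 /\ forall d : D, d != 0 -> d \is a GRing.unit.

(* (D, iota) is the (classical) skew field of fractions of the subring
   S (a predicate on the ring A, closed under ring operations):
   iota is an injective ring embedding of S into the division ring D and
   every element of D is iota(a) iota(s)^-1 with a, s in S. *)
Definition is_skew_fraction_field (A : nzRingType) (S : A -> Prop)
    (D : unitRingType) (iota : A -> D) : Prop :=
  is_division_ring D /\
  [/\ (forall u v, S u -> S v -> iota (u + v) = iota u + iota v),
      (forall u v, S u -> S v -> iota (u * v) = iota u * iota v),
      iota 1 = 1,
      (forall u v, S u -> S v -> iota u = iota v -> u = v)
    & (forall d : D, exists u s, [/\ S u, S s, s != 0 & d = iota u * (iota s)^-1])].

Fixpoint ratfun (F : fieldType) (l : nat) : fieldType :=
  match l with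
  | 0 => F
  | l'.+1 => {fraction {poly ratfun F l'}}
  end.

Fixpoint ratfun_const (F : fieldType) (l : nat) : F -> ratfun F l :=
  match l return F -> ratfun F l with
  | 0 => fun k => k
  | l'.+1 => fun k => FracField.tofrac ((ratfun_const l' k)%:P)
  end.

(* Main.v *)
(* Write [S = F[x_1, ..., x_n]]. In characteristic [p > |W|], Chevalley's argument
   applies to the reduction of [W] modulo [p]: [S^W = F[f_1, ..., f_n]] with a nonzero
   Jacobian determinant. (Noether's bound keeps the degrees of the [f_i] below [p], so
   that Euler's identity can be used.) Let [theta_j] be the derivation [d/df_j], viewed
   as a first-order operator with coefficients in the fraction field of [S]; it lies in
   the skew field [D] of fractions of [A_n(F)]. The [f_i] and [theta_j] are fixed by [W]
   and satisfy the Weyl relations, whence a homomorphism [j : A_n(F) -> D^W], and we show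
   that [D^W] is the skew field of fractions of its image: the result holds with [m = n]
   and [l = 0].
   - [j] is injective: its kernel is stable under the translations [y_i |-> y_i + c_i],
     so it meets [F[x]], on which [j] is injective because the [f_i] are algebraically
     independent.
   - Averaging over [W] the products of elements of [S] and of [A_n(F)] gives fractions
     of elements of the image of [j], by induction along the [y_k], which are
     combinations of the [theta_i] with coefficients in [S].
   Since [x_i^p] and [y_i^p] are central, [A_n(F)] is a finite module over its center and
   its fractions have central denominators. *)

Require Import Defs.
From HB Require Import structures.
From mathcomp Require Import all_boot all_order all_algebra.
From mathcomp Require Import reals boolp generic_quotient.
From mathcomp Require Import mpoly ring.
Set Implicit Arguments. Unset Strict Implicit. Unset Printing Implicit Defensive.
Import Order.TTheory GRing.Theory Num.Theory.
Local Open Scope ring_scope.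

(** * Homogeneous components and derivatives of polynomials *)

Section MpolyComplements.
Context (n : nat) (R : comNzRingType).
Implicit Types (p q g h : {mpoly R[n]}).

(** Reduction modulo [p] may identify elements of [W] or trivialize a reflection, so
    [reflection_group] only asks for factors [1 + u *m r], and divided differences must tolerate a
    zero linear form. The equality of the number [r] of basic invariants with [n] comes from the
    rank of their Jacobian matrix. Its rows are independent by Chevalley's syzygy lemma and Euler's
    identity; its columns are independent because a derivation killing the invariants kills every
    [x_j], a simple root of a polynomial with invariant coefficients. Algebraic independence is
    delicate in characteristic [p], since a relation may have zero partial derivatives; over the
    perfect field [F] it is then a [p]-th power, and its root is a relation of lower degree. The
    Weyl algebra is given by its universal property alone: its induction principle, its basis of
    ordered monomials and the absence of zero divisors all have to be derived from it. Finally, one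
    ring [D^W] serves both as the fractions of the invariants and, through [j], as those of
    [A_n(F)], so that the required isomorphism is the identity. *)

Lemma mpoly_ringind (Q : {mpoly R[n]} -> Prop) :
  (forall c, Q c%:MP) -> (forall i, Q 'X_i) ->
  (forall p q, Q p -> Q q -> Q (p + q)) ->
  (forall p q, Q p -> Q q -> Q (p * q)) -> forall p, Q p.
Proof.
move=> QC QX QD QM p; rewrite [p]mpolyE.
apply: big_ind => [||m _]; [by rewrite -mpolyC0; apply: (QC _) | exact: QD |].
rewrite -mul_mpolyC; apply: (QM _ _); first exact: (QC _).
rewrite mpolyXE_id; apply: big_ind => [||i _]; first exact: (QC 1).
  exact: QM.
elim: (m i) => [|k IHk]; first by rewrite expr0; exact: (QC 1).
by rewrite exprS; apply: (QM _ _).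
Qed.

Lemma Xs2m (s : seq 'I_n) : 'X_[R, s2m s] = \prod_(i <- s) 'X_i.
Proof.
rewrite mprodXE; congr mpolyX; apply/mnmP => i.
rewrite mnmE mnm_sumE; elim: s => [|j s IH]; first by rewrite big_nil.
by rewrite big_cons /= IH mnm1E.
Qed.

Lemma mcoeff_pihomog d p m :
  (pihomog mdeg d p)@_m = if mdeg m == d then p@_m else 0.
Proof.
elim/mpolyind: p => [|c k p _ _ IH]; first by rewrite pihomog0 mcoeff0 if_same.
rewrite pihomogD linearZ /= pihomogX !mcoeffD IH !mcoeffZ (fun_if (mcoeff m)).
rewrite mcoeffX mcoeff0; have [->|_] := eqVneq k m.
  by case: ifP; rewrite ?mulr0 ?add0r.
by rewrite if_same mulr0 !add0r.
Qed.

(* Guards against truncated subtraction when [d < e]. *)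
Definition hcomp d e p := if (e <= d)%N then pihomog mdeg (d - e) p else 0.

Lemma hcompD d e : {morph hcomp d e : p q / p + q}.
Proof. by move=> p q; rewrite /hcomp; case: ifP => _; rewrite ?linearD ?addr0. Qed.

Lemma hcompZ d e c p : hcomp d e (c *: p) = c *: hcomp d e p.
Proof. by rewrite /hcomp; case: ifP => _; rewrite ?linearZ ?scaler0. Qed.

Lemma hcomp0 d e : hcomp d e 0 = 0.
Proof. by rewrite /hcomp pihomog0 if_same. Qed.

Lemma hcomp_homog d e p : hcomp d e p \is (d - e).-homog.
Proof. by rewrite /hcomp; case: ifP => _; rewrite ?pihomogP ?rpred0. Qed.

Lemma hcomp_diag d p : hcomp d d p = (p@_0%MM)%:MP.
Proof.
rewrite /hcomp leqnn subnn; apply/mpolyP => m.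
rewrite mcoeff_pihomog mcoeffC mdeg_eq0.
by case: eqP => [->|_]; rewrite ?mulr1 ?mulr0.
Qed.

(** Multiplication by a homogeneous [h] shifts degrees by [e]. This is how a single degree is
    extracted from relations whose coefficients are not homogeneous. *)
Lemma pihomogMr d e g h : h \is e.-homog ->
  pihomog mdeg d (g * h) = hcomp d e g * h.
Proof.
move=> he; elim/mpolyind: g => [|c m g _ _ IH].
  by rewrite mul0r pihomog0 hcomp0 mul0r.
rewrite mulrDl pihomogD IH hcompD mulrDl; congr (_ + _).
rewrite hcompZ -!scalerAl linearZ /=; congr (_ *: _).
have hom : 'X_[R, m] * h \is (mdeg m + e).-homog.
  by apply: dhomogM => //; rewrite dhomogX.
(* For [d < e] the product has degree at least [e], so both sides are zero. *)
rewrite /hcomp; case: leqP => led; last first.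
  rewrite mul0r (@pihomog_ne0 _ _ _ _ d _ _ hom) //.
  by rewrite gtn_eqF // (leq_trans led) // leq_addl.
rewrite pihomogX; have [<-|ne] := eqVneq (mdeg m + e)%N d.
  by rewrite addnK eqxx pihomog_dE.
rewrite (pihomog_ne0 ne hom); case: eqP => [e1|]; last by rewrite mul0r.
by rewrite e1 subnK ?eqxx in ne.
Qed.

Lemma homog_const0 d p : (0 < d)%N -> p \is d.-homog -> p@_0%MM = 0.
Proof.
move=> d0 hp; have ne : mdeg (0%MM : 'X_{1..n}) != d by rewrite mdeg0 neq_ltn d0.
exact: (dhomog_nemf_coeff hp ne).
Qed.

Lemma mderivXU i j : ('X_j : {mpoly R[n]})^`M(i) = (i == j)%:R.
Proof.
rewrite mderivX mnm1E eq_sym; case: eqP => [->|_]; last by rewrite scale0r.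
have -> : (U_(j) - U_(j) = 0 :> 'X_{1..n})%MM.
  by apply/mnmP => k; rewrite mnmBE subnn mnm0E.
by rewrite scale1r mpolyX0.
Qed.

Lemma mderiv_homog d p i : p \is d.-homog -> p^`M(i) \is d.-1.-homog.
Proof.
move=> hp; apply/dhomogP => m; rewrite mcoeff_msupp mcoeff_mderiv => nz.
have : p@_(m + U_(i)) != 0 by apply: contraNneq nz => ->; rewrite mul0rn.
rewrite -mcoeff_msupp => /(dhomogP _ _ _ hp) /= <-.
by rewrite mdegD mdeg1 addn1.
Qed.

Lemma Euler_homog d p : p \is d.-homog -> \sum_i 'X_i * p^`M(i) = d%:R *: p.
Proof.
move=> hp; rewrite {2}(mpolyE p) scaler_sumr.
rewrite (eq_bigr (fun i : 'I_n => \sum_(m <- msupp p)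
    (p@_m * (m i)%:R) *: 'X_[m])); last first.
  move=> i _; rewrite {1}(mpolyE p) raddf_sum mulr_sumr /=.
  apply: eq_bigr => m _; rewrite linearZ /= mderivX scalerA -scalerAr.
  (* If [m i = 0] the coefficient already vanishes, so the truncated [m - U_(i)] is harmless. *)
  have [m0|m0] := posnP (m i); first by rewrite m0 mulr0 !scale0r.
  rewrite -mpolyXD addmC submK // lep1mP; exact: lt0n_neq0.
rewrite exchange_big /=; apply: eq_big_seq => m /(dhomogP _ _ _ hp) /= <-.
rewrite -scaler_suml scalerA; congr (_ *: _).
by rewrite -mulr_sumr mulrC -natr_sum mdegE.
Qed.

Lemma mderiv_comp_mpoly k (t : n.-tuple {mpoly R[k]}) p i :
  (p \mPo t)^`M(i) = \sum_j (p^`M(j) \mPo t) * (tnth t j)^`M(i).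
Proof.
elim/mpoly_ringind: p => [c|j|p q IHp IHq|p q IHp IHq].
- rewrite comp_mpolyC mderivC big1 // => j _.
  by rewrite mderivC comp_mpoly0 mul0r.
- rewrite comp_mpolyXU -tnth_nth (bigD1 j) //= big1 => [|l lj].
    by rewrite mderivXU eqxx comp_mpoly1 mul1r addr0.
  by rewrite mderivXU (negPf lj) comp_mpoly0 mul0r.
- rewrite comp_mpolyD mderivD IHp IHq -big_split; apply: eq_bigr => j _ /=.
  by rewrite mderivD comp_mpolyD mulrDl.
- rewrite rmorphM /= mderivM IHp IHq mulr_suml mulr_sumr -big_split.
  apply: eq_bigr => j _ /=; rewrite mderivM comp_mpolyD !rmorphM /=.
  by rewrite mulrDl mulrAC mulrA.
Qed.

End MpolyComplements.

(** * Linear substitutions and divided differences *)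

Section Action.
Context (F : fieldType) (n : nat).
Implicit Types (p q g h : {mpoly F[n]}) (w v : 'M[F]_n).

Definition linform (u : 'I_n -> F) : {mpoly F[n]} := \sum_i u i *: 'X_i.

(** Column [j] of [w] holds the coefficients of the image of ['X_j], as in [weyl_matrix]; with this
    convention products of matrices act in their own order. *)
Definition act w p := p \mPo [tuple linform (fun i => w i j) | j < n].

Lemma act_is_zmod w : zmod_morphism (act w).
Proof. by move=> p q; rewrite /act comp_mpolyB. Qed.
Lemma act_is_monoid w : monoid_morphism (act w).
Proof. by split=> [|p q]; rewrite /act ?comp_mpoly1 ?rmorphM. Qed.
Lemma act_is_scalable w : scalable (act w).
Proof. by move=> c p; rewrite /act comp_mpolyZ. Qed.
HB.instance Definition _ w :=
  GRing.isZmodMorphism.Build {mpoly F[n]} {mpoly F[n]} (act w) (act_is_zmod w).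
HB.instance Definition _ w :=
  GRing.isMonoidMorphism.Build {mpoly F[n]} {mpoly F[n]} (act w) (act_is_monoid w).
HB.instance Definition _ w :=
  GRing.isScalable.Build F {mpoly F[n]} {mpoly F[n]} *:%R (act w) (act_is_scalable w).

Lemma actC w c : act w c%:MP = c%:MP.
Proof. exact: comp_mpolyC. Qed.

Lemma actX w j : act w 'X_j = linform (fun i => w i j).
Proof. by rewrite /act comp_mpolyXU -tnth_nth tnth_mktuple. Qed.

Lemma act1 p : act 1%:M p = p.
Proof.
elim/mpoly_ringind: p => [c|j|p q IHp IHq|p q IHp IHq].
- exact: actC.
- rewrite actX /linform (bigD1 j) //= mxE eqxx scale1r big1 ?addr0 // => i ij.
  by rewrite mxE (negPf ij) scale0r.
- by rewrite raddfD /= IHp IHq.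
- by rewrite rmorphM /= IHp IHq.
Qed.

Lemma actM w v p : act (w *m v) p = act w (act v p).
Proof.
elim/mpoly_ringind: p => [c|j|p q IHp IHq|p q IHp IHq].
- by rewrite !actC.
- rewrite !actX /linform raddf_sum /=.
  under [RHS]eq_bigr => i _.
    rewrite linearZ /= actX /linform scaler_sumr.
    under eq_bigr => k _ do rewrite scalerA mulrC.
    over.
  rewrite exchange_big; apply: eq_bigr => i _.
  by rewrite mxE scaler_suml.
- by rewrite !raddfD /= IHp IHq.
- by rewrite !rmorphM /= IHp IHq.
Qed.

Lemma linform_homog u : linform u \is 1.-homog.
Proof. by apply: rpred_sum => i _; apply: rpredZ; rewrite dhomogX /= mdeg1. Qed.

Lemma prod_homog (I : Type) (r : seq I) (f : I -> {mpoly F[n]}) (d : I -> nat) :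
  (forall i, f i \is (d i).-homog) ->
  \prod_(i <- r) f i \is (\sum_(i <- r) d i).-homog.
Proof.
move=> hf; elim: r => [|i r IH]; first by rewrite !big_nil dhomog1.
by rewrite !big_cons; apply: dhomogM.
Qed.

Lemma actX_homog w m : act w 'X_[m] \is (mdeg m).-homog.
Proof.
rewrite /act comp_mpolyX mdegE; apply: prod_homog => i.
by rewrite -{2}[m i]mul1n; apply: dhomogMn; rewrite tnth_mktuple linform_homog.
Qed.

Lemma pihomog_act w d p : pihomog mdeg d (act w p) = act w (pihomog mdeg d p).
Proof.
elim/mpolyind: p => [|c m p _ _ IH]; first by rewrite !(rmorph0, pihomog0).
rewrite !linearD /= !linearZ /= IH pihomogX; congr (_ *: _ + _).
have [<-|ne] := eqVneq (mdeg m) d; first by rewrite pihomog_dE ?actX_homog.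
by rewrite (pihomog_ne0 ne (actX_homog w m)) rmorph0.
Qed.

Lemma act_homog w d p : p \is d.-homog -> act w p \is d.-homog.
Proof. by move=> /pihomog_dE <-; rewrite -pihomog_act pihomogP. Qed.

Lemma hcomp_act w d e p : hcomp d e (act w p) = act w (hcomp d e p).
Proof. by rewrite /hcomp; case: ifP => _; rewrite ?pihomog_act ?rmorph0. Qed.

Lemma act_const w p : (act w p)@_0%MM = p@_0%MM.
Proof. by apply: (can_inj (@mpolyCK n F)); rewrite -!(hcomp_diag 0) hcomp_act hcomp_diag actC. Qed.

(** A linear substitution commutes with taking homogeneous components, so no component of higher
    degree can appear. A singular [w] may lower the degree. *)
Lemma msize_act w p : (msize (act w p) <= msize p)%N.
Proof.
apply/bigmax_leqP_seq => m ma _ /=; rewrite ltnNge; apply/negP => le.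
move: ma; rewrite mcoeff_msupp.
have -> : (act w p)@_m = (pihomog mdeg (mdeg m) (act w p))@_m.
  by rewrite mcoeff_pihomog eqxx.
rewrite pihomog_act.
suff -> : pihomog mdeg (mdeg m) p = 0 by rewrite rmorph0 mcoeff0 eqxx.
apply/mpolyP => k; rewrite mcoeff_pihomog mcoeff0; case: eqP => // e.
by apply: memN_msupp_eq0; apply: msize_mdeg_ge; rewrite e.
Qed.

(** Modulo the linear form of [u], the matrix [1 + u *m r] fixes every variable, hence every
    polynomial. The quotient [h] is the divided difference; the form itself may be zero. *)
Lemma act_refl_dvd (u : 'cV[F]_n) (r : 'rV[F]_n) p :
  exists h, act (1%:M + u *m r) p - p = linform (fun i => u i 0) * h.
Proof.
set w := 1%:M + _; set l := linform _.
elim/mpoly_ringind: p => [c|j|p q [h hp] [k kq]|p q [h hp] [k kq]].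
- by exists 0; rewrite actC subrr mulr0.
- exists (r 0 j)%:MP; rewrite actX mulrC mul_mpolyC /l /linform scaler_sumr.
  apply/eqP; rewrite subr_eq; apply/eqP.
  rewrite -[in RHS](act1 'X_j) actX /linform -big_split; apply: eq_bigr => i _ /=.
  by rewrite !mxE big_ord1 scalerA addrC scalerDl mulrC.
- by exists (h + k); rewrite raddfD /= opprD addrACA hp kq mulrDr.
(* Twisted Leibniz rule: [w(pq) - pq = (wp - p) wq + p (wq - q)]. *)
- exists (h * act w q + p * k); rewrite rmorphM /= mulrDr mulrA -hp.
  by rewrite [l * _]mulrCA -kq mulrBl mulrBr addrA subrK.
Qed.

Lemma act_refl_div (u : 'cV[F]_n) (r : 'rV[F]_n) p :
  linform (fun i => u i 0) != 0 ->
  exists2 h, act (1%:M + u *m r) p - p = linform (fun i => u i 0) * h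
           & (msize h <= (msize p).-1)%N.
Proof.
move=> l0; have [h hE] := act_refl_dvd u r p; exists h => //.
have [->|h0] := eqVneq h 0; first by rewrite msize0.
(* [msize] is the degree plus one, hence 2 for a nonzero linear form. *)
have sl : msize (linform (fun i => u i 0)) = 2%N.
  by rewrite -(mlead_deg l0); have /= -> := dhomog_mf (linform_homog _) (mlead_supp l0).
have := msizeM l0 h0; rewrite -hE sl /= add1n => e; rewrite -ltnS -e.
apply: leq_trans (msizeD_le _ _) _; rewrite msizeN geq_max leqSpred andbT.
exact: leq_trans (msize_act _ _) (leqSpred _).
Qed.

End Action.

Section Ideal.
Context (R : comNzRingType).

(** The family stays fixed and only the index set [J] varies, which makes it easy to remove one
    generator. *)
Definition ideal (I : finType) (f : I -> R) (J : {set I}) (g : R) :=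
  exists c : I -> R, g = \sum_(i in J) c i * f i.

Context (I : finType) (f : I -> R) (J : {set I}).

Lemma ideal0 : ideal f J 0.
Proof. by exists (fun _ => 0); rewrite big1 // => i _; rewrite mul0r. Qed.

Lemma idealD g h : ideal f J g -> ideal f J h -> ideal f J (g + h).
Proof.
move=> [c ->] [d ->]; exists (fun i => c i + d i).
by rewrite -big_split; apply: eq_bigr => i _; rewrite /= mulrDl.
Qed.

Lemma idealM r g : ideal f J g -> ideal f J (r * g).
Proof.
move=> [c ->]; exists (fun i => r * c i).
by rewrite mulr_sumr; apply: eq_bigr => i _; rewrite mulrA.
Qed.

Lemma idealN g : ideal f J g -> ideal f J (- g).
Proof. by rewrite -mulN1r; apply: idealM. Qed.

Lemma idealB g h : ideal f J g -> ideal f J h -> ideal f J (g - h).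
Proof. by move=> ig /idealN; apply: idealD. Qed.

Lemma ideal_gen i : i \in J -> ideal f J (f i).
Proof.
move=> iJ; exists (fun k => (k == i)%:R).
rewrite (bigD1 i) //= eqxx mul1r big1 ?addr0 // => k /andP[_ /negPf ->].
by rewrite mul0r.
Qed.

Lemma ideal_sum (T : Type) (r : seq T) (P : pred T) (h : T -> R) :
  (forall t, P t -> ideal f J (h t)) -> ideal f J (\sum_(t <- r | P t) h t).
Proof. by move=> hP; apply: big_ind => //; [exact: ideal0 | exact: idealD]. Qed.

Lemma ideal_trans (I' : finType) (f' : I' -> R) (J' : {set I'}) g :
  (forall i, i \in J -> ideal f' J' (f i)) -> ideal f J g -> ideal f' J' g.
Proof.
move=> sub [c ->]; apply: big_ind => [||i iJ].
- by exists (fun _ => 0); rewrite big1 // => i _; rewrite mul0r.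
- move=> _ _ [a ->] [b ->]; exists (fun i => a i + b i).
  by rewrite -big_split; apply: eq_bigr => i _; rewrite /= mulrDl.
- have [d ->] := sub i iJ; exists (fun k => c i * d k).
  by rewrite mulr_sumr; apply: eq_bigr => k _; rewrite mulrA.
Qed.

(** Take a generating subfamily of least cardinality: a member lying in the ideal of the others
    could be dropped. *)
Lemma ideal_minimal : exists J' : {set I},
  [/\ J' \subset J, forall i, i \in J -> ideal f J' (f i)
    & forall i, i \in J' -> ~ ideal f (J' :\ i) (f i)].
Proof.
pose P (K : {set I}) := `[< K \subset J /\ forall i, i \in J -> ideal f K (f i) >].
have PJ : P J by apply/asboolP; split=> // i; apply: ideal_gen.
case: (arg_minnP (fun K : {set I} => #|K|) PJ) => K /asboolP[KJ Kgen] Kmin.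
exists K; split=> // i iK fi.
suff /Kmin : P (K :\ i) by rewrite leqNgt proper_card // properD1.
apply/asboolP; split; first by rewrite (subset_trans (subD1set _ _)).
move=> j /Kgen [c ->]; rewrite (bigD1 i) //=.
have [d ->] := fi; exists (fun k => c i * d k + c k).
under [RHS]eq_bigr => k _ do rewrite mulrDl.
rewrite big_split /= mulr_sumr; congr (_ + _); first by apply: eq_bigr => k _; rewrite mulrA.
by apply: eq_bigl => k; rewrite !inE andbC.
Qed.

End Ideal.

(** * Invariants of a finite reflection group *)

(* A reflection is any matrix [1 + u *m v] of rank at most one away from the
   identity; over a field of positive characteristic it may well be trivial. *)
Record reflection_group (F : fieldType) (n : nat) (G : seq 'M[F]_n) : Prop := {
  rg_uniq : uniq G;
  rg1 : 1%:M \in G;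
  rgM : {in G &, forall u v, u *m v \in G};
  rgV : {in G, forall w, exists2 v, v \in G & w *m v = 1%:M};
  rg_nat : forall d, (0 < d <= size G)%N -> d%:R != 0 :> F;
  rg_refl : {in G, forall w, exists2 ss : seq 'M[F]_n,
     w = foldr mulmx 1%:M ss &
     {in ss, forall s, s \in G /\
       exists (u : 'cV[F]_n) (r : 'rV[F]_n), s = 1%:M + u *m r}} }.

Lemma sumr_const_seq (V : nmodType) (I : Type) (r : seq I) (x : V) :
  \sum_(i <- r) x = x *+ size r.
Proof. by rewrite big_const_seq count_predT iter_addr_0. Qed.

Section Invariants.
Context (F : fieldType) (n : nat) (G : seq 'M[F]_n) (HG : reflection_group G).
Implicit Types (p q g : {mpoly F[n]}) (w v h : 'M[F]_n).
Local Notation S := {mpoly F[n]}.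

Definition ginv : {pred S} := fun p => all (fun w => act w p == p) G.

Lemma ginvP p : reflect {in G, forall w, act w p = p} (p \in ginv).
Proof.
by apply: (iffP allP) => H w wG; [exact/eqP/(H w wG) | apply/eqP; exact: H].
Qed.

Lemma ginv_subalg : subalg_closed ginv.
Proof.
split=> [|c p q /ginvP Hp /ginvP Hq|p q /ginvP Hp /ginvP Hq]; apply/ginvP => w wG.
- exact: rmorph1.
- by rewrite linearP /= Hp ?Hq.
- by rewrite rmorphM /= Hp ?Hq.
Qed.
HB.instance Definition _ := GRing.isSubalgClosed.Build F S ginv ginv_subalg.

Definition avg p := \sum_(w <- G) act w p.

Lemma avg_is_linear : linear avg.
Proof.
move=> c p q; rewrite /avg scaler_sumr -big_split /=.
by apply: eq_bigr => w _; rewrite linearP.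
Qed.
HB.instance Definition _ := GRing.isLinear.Build F S S _ avg avg_is_linear.

Lemma perm_mulG w : w \in G -> perm_eq [seq w *m v | v <- G] G.
Proof.
move=> wG; have [v vG wv] := rgV HG wG; have vw := mulmx1C wv.
apply: uniq_perm; rewrite ?map_inj_uniq ?(rg_uniq HG) //.
  by move=> a b /(congr1 (mulmx v)); rewrite !mulmxA vw !mul1mx.
move=> a; apply/mapP/idP => [[b bG ->]|aG]; first exact: (rgM HG).
by exists (v *m a); [exact: (rgM HG) | rewrite mulmxA wv mul1mx].
Qed.

Lemma big_mulG (T : Type) (idx : T) (op : Monoid.com_law idx) (f : 'M[F]_n -> T) w :
  w \in G -> \big[op/idx]_(v <- G) f (w *m v) = \big[op/idx]_(v <- G) f v.
Proof. by move=> wG; rewrite -[RHS](perm_big _ (perm_mulG wG)) big_map. Qed.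

Lemma avg_inv p : avg p \in ginv.
Proof.
apply/ginvP => w wG; rewrite /avg raddf_sum /= -[RHS](big_mulG _ _ wG).
by apply: eq_bigr => v _; rewrite actM.
Qed.

Lemma avgMl g p : g \in ginv -> avg (p * g) = avg p * g.
Proof.
move=> /ginvP gG; rewrite /avg mulr_suml; apply: eq_big_seq => w wG.
by rewrite rmorphM /= gG.
Qed.

Lemma avg_id p : p \in ginv -> avg p = (size G)%:R *: p.
Proof.
move=> /ginvP pG; rewrite scaler_nat -sumr_const_seq /avg.
by apply: eq_big_seq => w /pG.
Qed.

Lemma sizeG_gt0 : (0 < size G)%N.
Proof. by case: G (rg1 HG). Qed.

Lemma sizeG_neq0 : (size G)%:R != 0 :> F.
Proof. by apply: (rg_nat HG); rewrite sizeG_gt0 leqnn. Qed.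

Lemma hcomp_inv d e p : p \in ginv -> hcomp d e p \in ginv.
Proof. by move=> /ginvP H; apply/ginvP => w wG; rewrite -hcomp_act H. Qed.

Lemma avg_homog d p : p \is d.-homog -> avg p \is d.-homog.
Proof. by move=> hp; apply: rpred_sum => w _; apply: act_homog. Qed.

Local Notation N := (size G).
Local Notation T := 'X_{1..n < N.+1}.

(** [T] is the finite type of monomials of degree at most [|G|], and [posX] leaves out the monomial
    1. Noether's bound says that these averages generate the ideal of all invariants without
    constant term. *)
Definition avgX (m : T) := avg 'X_[m].
Definition posX : {set T} := [set m : T | (0 < mdeg m)%N].

Lemma ideal_avg d p : (0 < d <= N)%N -> p \is d.-homog -> ideal avgX posX (avg p).
Proof.
move=> /andP[d0 dN] hp; rewrite [p]mpolyE raddf_sum big_seq; apply: ideal_sum => m mp.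
have dm : mdeg m = d := dhomog_mf hp mp.
rewrite /= linearZ /= -mul_mpolyC; apply: idealM.
have mT : (mdeg m < N.+1)%N by rewrite dm ltnS.
by apply: (@ideal_gen _ _ avgX posX (BMultinom mT)); rewrite inE /= dm.
Qed.

(* For each [h], the factor of index [w = h] below vanishes; summing over [h]
   and expanding, the term without any [act h] is the product itself. *)
Lemma Noether_prod (k : 'I_N -> 'I_n) : ideal avgX posX (\prod_i 'X_(k i)).
Proof.
pose V (i : 'I_N) : 'M[F]_n := invmx G`_i.
have VP (i : 'I_N) : G`_i *m V i = 1%:M.
  have [v _ /mulmx1_unit[u _]] := rgV HG (mem_nth 0 (ltn_ord i)).
  exact: mulmxV.
have z (h : 'M[F]_n) : h \in G -> \prod_i (act h (act (V i) 'X_(k i)) + - 'X_(k i)) = 0.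
  move=> hG; have hi : (index h G < N)%N by rewrite index_mem.
  rewrite (bigD1 (Ordinal hi)) //= -actM.
  have := VP (Ordinal hi); rewrite /= nth_index // => ->.
  by rewrite act1 subrr mul0r.
have : \sum_(h <- G) \prod_i (act h (act (V i) 'X_(k i)) + - 'X_(k i)) = 0.
  by rewrite big_seq big1.
have D (h : 'M[F]_n) : \prod_i (act h (act (V i) 'X_(k i)) + - 'X_(k i)) =
    \sum_(A : {set 'I_N}) \prod_i
      (if i \in A then act h (act (V i) 'X_(k i)) else - 'X_(k i)).
  have := @bigA_distr S 0 1 *%R +%R _
    (fun i => act h (act (V i) 'X_(k i))) (fun i => - 'X_(k i)).
  by move=> ->; apply: eq_bigl.
rewrite (eq_bigr _ (fun h _ => D h)).
rewrite exchange_big /= (bigD1 set0) //= => /eqP; rewrite addr_eq0 => /eqP e.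
suff : ideal avgX posX (\sum_(h <- G) \prod_i
    (if i \in set0 then act h (act (V i) 'X_(k i)) else - 'X_(k i))).
  (* The empty set contributes the product itself, [N] times and up to sign; [N] is invertible in
     [F]. *)
  have -> : \sum_(h <- G) \prod_i (if i \in set0 then
        act h (act (V i) 'X_(k i)) else - 'X_(k i)) =
      (N%:R * (-1) ^+ N)%:MP * \prod_i 'X_(k i).
    rewrite (eq_bigr (fun=> (-1)^+N * \prod_i 'X_(k i))); last first.
      by move=> h _; under eq_bigr => i _ do rewrite inE; rewrite prodrN card_ord.
    rewrite sumr_const_seq mpolyCM mpolyC_nat -mulrA mulr_natl.
    by rewrite rmorphXn /= rmorphN rmorph1.
  move/(idealM ((N%:R * (-1) ^+ N)^-1)%:MP); rewrite mulrA -mpolyCM mulVf ?mul1r //.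
  by rewrite mulf_neq0 ?sizeG_neq0 ?signr_eq0.
(* For nonempty [A] the factors outside [A] do not depend on [h], and the sum over [h] of the others
   is the average of a product of [#|A|] linear forms, with [0 < #|A| <= N]. *)
rewrite e; apply: idealN; apply: ideal_sum => A A0.
rewrite (eq_bigr (fun h => (\prod_(i in ~: A) - 'X_(k i)) *
   act h (\prod_(i in A) act (V i) 'X_(k i)))); last first.
  move=> h _; rewrite (bigID (mem A)) /= mulrC; congr (_ * _).
    by apply: eq_big => i; rewrite ?inE // => /negPf ->.
  by rewrite rmorph_prod; apply: eq_bigr => i ->.
rewrite -mulr_sumr; apply: idealM; apply: (@ideal_avg #|A|).
  by rewrite card_gt0 A0 /= -[X in (_ <= X)%N]card_ord max_card.
rewrite -big_enum -sum1_card -big_enum /=.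
apply: prod_homog => i; apply: act_homog; by rewrite dhomogX /= mdeg1.
Qed.

Lemma Noether_mnm m : (N <= mdeg m)%N -> ideal avgX posX 'X_[m].
Proof.
move=> le; have e := s2mK m; rewrite -e.
have sz : size (m2s m) = mdeg m by exact: size_m2s.
rewrite Xs2m -(cat_take_drop N (m2s m)) big_cat /= mulrC; apply: idealM.
have st : size (take N (m2s m)) = N by rewrite size_takel // sz.
have [i0 _] : exists i0 : 'I_n, true.
  have : (0 < size (m2s m))%N by rewrite sz (leq_trans sizeG_gt0).
  by case: (m2s m) => // i _ _; exists i.
rewrite (big_nth i0) st big_mkord; exact: Noether_prod.
Qed.

Lemma ideal_act w g : w \in G -> ideal avgX posX g -> ideal avgX posX (act w g).
Proof.
move=> wG [c ->]; exists (fun i => act w (c i)); rewrite raddf_sum.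
apply: eq_bigr => i _; rewrite /= rmorphM /=; congr (_ * _).
exact: (ginvP _ (avg_inv _)).
Qed.

(** Since [g] is its own average up to the factor [N], it suffices to average its monomials. Those
    of degree below [N] give generators; the others lie in the ideal by [Noether_mnm], and the ideal
    is stable under [G] because its generators are invariant. *)
Lemma ideal_inv g : g \in ginv -> g@_0%MM = 0 -> ideal avgX posX g.
Proof.
move=> gG g0.
have -> : g = (N%:R^-1)%:MP * avg g.
  by rewrite avg_id // mul_mpolyC scalerA mulVf ?scale1r ?sizeG_neq0.
apply: idealM; rewrite [g]mpolyE raddf_sum big_seq; apply: ideal_sum => m mg.
rewrite /= linearZ /= -mul_mpolyC; apply: idealM.
have m0 : (0 < mdeg m)%N.
  by rewrite lt0n mdeg_eq0; apply: contraTneq mg => ->; rewrite mcoeff_msupp g0 eqxx.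
have [le|lt] := leqP N (mdeg m).
  rewrite /avg big_seq; apply: ideal_sum => w wG; apply: ideal_act => //.
  exact: Noether_mnm.
by apply: (@ideal_avg (mdeg m)); rewrite ?m0 ?(ltnW lt) // dhomogX.
Qed.

End Invariants.

(** * Chevalley's theorem *)

Section Chevalley.
Context (F : fieldType) (n : nat) (G : seq 'M[F]_n) (HG : reflection_group G).
Local Notation S := {mpoly F[n]}.
Local Notation N := (size G).
Local Notation ginv := (ginv G).
Local Notation avg := (avg G).

(** A minimal homogeneous generating family of the ideal of invariants without constant term. Its
    size [r] is compared with [n] only in [Chevalley]. *)
Record basic_invariants (r : nat) (f : 'I_r -> S) (d : 'I_r -> nat) : Prop := {
  bi_inv : forall i, f i \in ginv;
  bi_deg : forall i, (0 < d i <= N)%N;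
  bi_homog : forall i, f i \is (d i).-homog;
  bi_ideal : forall g, g \in ginv -> g@_0%MM = 0 -> ideal f setT g;
  bi_min : forall i, ~ ideal f (setT :\ i) (f i) }.

Lemma basic_invariants_exist : exists r f d, @basic_invariants r f d.
Proof.
have [J [Jpos Jgen Jmin]] := ideal_minimal (@avgX F n G) (@posX F n G).
pose ev (i : 'I_#|J|) : 'X_{1..n < N.+1} := enum_val i.
exists #|J|, (fun i => avgX (ev i)), (fun i => mdeg (ev i)); split.
- by move=> i; apply: avg_inv.
- move=> i; have := subsetP Jpos _ (enum_valP i); rewrite inE => -> /=.
  by have := bmdeg (ev i); rewrite ltnS.
- by move=> i; apply: avg_homog; rewrite dhomogX.
- move=> g gG g0; have /(ideal_trans Jgen)[c ->] := ideal_inv HG gG g0.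
  exists (fun i => c (enum_val i)); rewrite big_enum_val /=.
  by apply: eq_bigl => i; rewrite inE.
- move=> i /ideal_trans H; apply: (Jmin _ (enum_valP i)); apply: H => j.
  rewrite !inE andbT => ji; apply: ideal_gen; rewrite !inE enum_valP andbT.
  by apply: contra ji => /eqP /enum_val_inj ->.
Qed.

Context (r : nat) (f : 'I_r -> S) (d : 'I_r -> nat) (Hf : basic_invariants f d).

Lemma basic_ideal_act w g : w \in G -> ideal f setT g -> ideal f setT (act w g).
Proof.
move=> wG [c ->]; exists (fun i => act w (c i)); rewrite raddf_sum.
apply: eq_bigr => i _; rewrite /= rmorphM /=; congr (_ * _).
exact: (ginvP _ _ (bi_inv Hf i)).
Qed.

(* Chevalley's lemma: the divided differences of a syzygy of invariants along a
   reflection form a syzygy of smaller degree. *)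
Lemma syzygy_ideal (I : finType) (h : I -> S) (e : I -> nat) (J : {set I}) i1 :
  (forall i, h i \in ginv) -> (forall i, h i \is (e i).-homog) -> i1 \in J ->
  ~ ideal h (J :\ i1) (h i1) ->
  forall g : I -> S, \sum_(i in J) g i * h i = 0 -> ideal f setT (g i1).
Proof.
move=> hG hh i1J hmin g; have [k] := ubnP (msize (g i1)).
elim: k g => // k IH g; rewrite ltnS => gk gsum.
have refl_step s (u : 'cV[F]_n) (t : 'rV[F]_n) : s \in G -> s = 1%:M + u *m t ->
    ideal f setT (act s (g i1) - g i1).
  (* A zero linear form means that the reflection has become trivial over [F]. *)
  move=> sG sE; have [l0|l0] := eqVneq (linform (fun i => u i 0)) 0.
    have [q] := act_refl_dvd u t (g i1); rewrite -sE l0 mul0r => ->.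
    exact: ideal0.
  have /choice[q qP] : forall i, exists q, act s (g i) - g i =
      linform (fun i => u i 0) * q /\ (msize q <= (msize (g i)).-1)%N.
    by move=> i; have [q] := act_refl_div t (g i) l0; rewrite -sE; exists q.
  rewrite (qP i1).1; apply: idealM.
  have [->|q0] := eqVneq (q i1) 0; first exact: ideal0.
  apply: IH.
    have := (qP i1).2; rewrite -ltnS => /leq_trans; apply.
    rewrite prednK // lt0n msize_poly_eq0; apply: contra q0 => /eqP g0.
    have := (qP i1).1; rewrite g0 rmorph0 subr0 => /esym/eqP.
    by rewrite mulf_eq0 (negPf l0).
  apply: (mulfI l0); rewrite mulr0 mulr_sumr.
  transitivity (act s (\sum_(i in J) g i * h i) - \sum_(i in J) g i * h i); last first.
    by rewrite gsum rmorph0 subrr.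
  rewrite raddf_sum -sumrB; apply: eq_bigr => i _.
  by rewrite mulrA -(qP i).1 mulrBl /= rmorphM /= (ginvP _ _ (hG i)).
have act_step w : w \in G -> ideal f setT (act w (g i1) - g i1).
  move=> wG; have [ss -> ssP] := rg_refl HG wG.
  elim: ss ssP => [|s ss IHs] ssP /=; first by rewrite act1 subrr; exact: ideal0.
  have [sG [u [t sE]]] := ssP s (mem_head _ _).
  rewrite actM -[X in ideal _ _ (X - _)](subrK (act s (g i1))) -addrA -raddfB /=.
  apply: idealD; last exact: refl_step sE.
  apply: basic_ideal_act => //; apply: IHs => v vs; apply: ssP.
  by rewrite inE vs orbT.
(* With a nonzero constant term in [g i1], the part of degree [e i1] of the syzygy would express
   [h i1] through the other [h i]. *)
have c0 : (g i1)@_0%MM = 0.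
  apply/eqP/negP => /negP c0; apply: hmin.
  have : pihomog mdeg (e i1) (\sum_(i in J) g i * h i) = 0 by rewrite gsum pihomog0.
  rewrite raddf_sum (bigD1 i1) //= (pihomogMr _ _ (hh i1)) hcomp_diag => /eqP.
  rewrite addr_eq0 => /eqP E.
  have -> : h i1 = ((g i1)@_0%MM)^-1%:MP * (((g i1)@_0%MM)%:MP * h i1).
    by rewrite mulrA -mpolyCM mulVf // mul1r.
  rewrite E; apply: idealM; apply: idealN.
  exists (fun i => hcomp (e i1) (e i) (g i)).
  apply: eq_big => [i|i _]; first by rewrite !inE andbC.
  exact: pihomogMr (hh i).
(* The average is an invariant without constant term, and each difference lies in the ideal by
   [act_step]. *)
have -> : g i1 = (N%:R^-1)%:MP *
    (avg (g i1) - \sum_(w <- G) (act w (g i1) - g i1)).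
  rewrite sumrB opprB addrC subrK sumr_const_seq -scaler_nat mul_mpolyC scalerA.
  by rewrite mulVf ?scale1r ?(sizeG_neq0 HG).
apply: idealM; apply: idealB.
  apply: (bi_ideal Hf); first exact: (avg_inv HG).
  by rewrite raddf_sum big1 // => w _; rewrite /= act_const.
by rewrite big_seq; apply: ideal_sum => w; apply: act_step.
Qed.

(** Induction on the degree: a homogeneous invariant of positive degree is a combination of the
    [f i]. Averaging makes its coefficients invariant, and their degrees are smaller because
    [d i > 0]. *)
Lemma inv_comp g : g \in ginv -> exists q : {mpoly F[r]}, g = q \mPo [tuple f i | i < r].
Proof.
suff hom k : forall p, p \in ginv -> p \is k.-homog ->
    exists q : {mpoly F[r]}, p = q \mPo [tuple f i | i < r].
  move=> gG; rewrite (@pihomog_partitionE _ _ mdeg _ g (leqnn _)).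
  apply: (big_ind (fun p => exists q : {mpoly F[r]}, p = q \mPo [tuple f i | i < r])).
  - by exists 0; rewrite rmorph0.
  - by move=> _ _ [p ->] [q ->]; exists (p + q); rewrite raddfD.
  - move=> i _; apply: (hom i); last exact: pihomogP.
    by have := hcomp_inv i 0 gG; rewrite /hcomp leq0n subn0.
have [b] := ubnP k; elim: b k => // b IH k; rewrite ltnS => kb p pG hp.
have [k0|k0] := posnP k.
  exists (p@_0%MM)%:MP; rewrite comp_mpolyC.
  apply/mpolyP => m; rewrite mcoeffC; case: eqP => [->|/eqP m0]; rewrite ?mulr1 //.
  by rewrite mulr0; apply: (dhomog_nemf_coeff hp); rewrite k0 /= mdeg_eq0.
have [c cE] := bi_ideal Hf pG (homog_const0 k0 hp).
pose c' i := avg (hcomp k (d i) (c i)).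
have pE : p = \sum_i ((N%:R^-1)%:MP * c' i) * f i.
  transitivity ((N%:R^-1)%:MP * avg p).
    by rewrite avg_id // mul_mpolyC scalerA mulVf ?scale1r ?(sizeG_neq0 HG).
  have pE : p = \sum_i hcomp k (d i) (c i) * f i.
    rewrite -[LHS](pihomog_dE hp) [in LHS]cE raddf_sum.
    apply: eq_big => [i|i _]; first by rewrite inE.
    exact: pihomogMr (bi_homog Hf i).
  rewrite {1}pE raddf_sum mulr_sumr; apply: eq_bigr => i _.
  by rewrite /= avgMl ?(bi_inv Hf) // mulrA.
have /choice[q qP] : forall i, exists q : {mpoly F[r]}, c' i = q \mPo [tuple f i | i < r].
  move=> i; have [lt|le] := ltnP k (d i).
    by exists 0; rewrite rmorph0 /c' /hcomp leqNgt lt raddf0.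
  apply: (IH (k - d i)%N).
  - apply: leq_trans kb; rewrite ltn_subrL k0 andbT.
    by have /andP[] := bi_deg Hf i.
  - exact: (avg_inv HG).
  - exact/avg_homog/hcomp_homog.
exists (\sum_i (N%:R^-1)%:MP * q i * 'X_i); rewrite {1}pE rmorph_sum.
apply: eq_bigr => i _; rewrite !rmorphM /= comp_mpolyC -qP comp_mpolyXU.
by rewrite -tnth_nth tnth_mktuple.
Qed.

(** Otherwise some [h i1] is irredundant among the [h i]. The relations are then syzygies of the
    [h i], so Chevalley's lemma puts a combination of derivatives containing that of [f i1] into the
    ideal of the [f l]; Euler's identity integrates this to a redundancy of [f i1], against
    [bi_min]. *)
Lemma jacobian_lker_homog (h : 'I_r -> S) (e : 'I_r -> nat) :
  (forall i, h i \in ginv) -> (forall i, h i \is (e i).-homog) ->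
  (forall k, \sum_i h i * (f i)^`M(k) = 0) -> forall i, h i = 0.
Proof.
move=> hG hh hsum; have [J [_ Jgen Jmin]] := ideal_minimal h setT.
have [J0|[i1 i1J]] := set_0Vmem J.
  by move=> i; have [c ->] := Jgen i (in_setT i); rewrite J0 big_set0.
have /choice[c cP] i : exists c : 'I_r -> S, h i = \sum_(j in J) c j * h j.
  by have [c] := Jgen i (in_setT i); exists c.
(* Each [h j] with [j] outside [J] is rewritten through the members of [J]; [g k i] is the resulting
   coefficient of [h i] in the [k]-th relation. *)
pose g k i := (f i)^`M(k) + \sum_(j in ~: J) c j i * (f j)^`M(k).
have gI k : ideal f setT (g k i1).
  apply: (syzygy_ideal hG hh i1J (Jmin _ i1J) (g := g k)).
  rewrite -[RHS](hsum k) [RHS](bigID (mem J)) /=.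
  under eq_bigr => i _ do rewrite mulrDl.
  rewrite big_split /=; congr (_ + _); first by apply: eq_bigr => i _; rewrite mulrC.
  under eq_bigr => i _ do rewrite mulr_suml.
  rewrite exchange_big /=; apply: eq_big => [j|j _]; first by rewrite inE.
  rewrite cP mulr_suml; apply: eq_bigr => i _.
  by rewrite mulrAC.
have /choice[a aP] k := gI k.
(* The [k]-th membership is multiplied by ['X_k] and summed over [k], so that Euler's identity
   applies to the left-hand side. *)
pose b l := \sum_k 'X_k * a k l.
have E : (d i1)%:R *: f i1 + \sum_(j in ~: J) ((d j)%:R *: c j i1) * f j =
    \sum_l b l * f l.
  transitivity (\sum_k 'X_k * g k i1).
    rewrite -(Euler_homog (bi_homog Hf i1)) /g.
    under [RHS]eq_bigr => k _ do rewrite mulrDr.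
    rewrite big_split /=; congr (_ + _).
    under [RHS]eq_bigr => k _ do rewrite mulr_sumr.
    rewrite exchange_big; apply: eq_bigr => j _ /=.
    rewrite -scalerAl scalerAr -(Euler_homog (bi_homog Hf j)) mulr_sumr.
    by apply: eq_bigr => k _; rewrite mulrCA.
  under eq_bigr => k _ do rewrite aP mulr_sumr.
  rewrite exchange_big /=; apply: eq_big => [l|l _]; first by rewrite inE.
  by rewrite /b mulr_suml; apply: eq_bigr => k _; rewrite mulrA.
case: (bi_min Hf (i := i1)).
have d1 : (d i1)%:R != 0 :> F by apply: (rg_nat HG); apply: (bi_deg Hf).
have -> : f i1 = ((d i1)%:R^-1)%:MP * ((d i1)%:R *: f i1).
  by rewrite mul_mpolyC scalerA mulVf ?scale1r.
apply: idealM.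
have homi1 : (d i1)%:R *: f i1 \is (d i1).-homog by rewrite rpredZ ?(bi_homog Hf).
have := congr1 (pihomog mdeg (d i1)) E.
rewrite [LHS]raddfD [_ (_ *: _)](pihomog_dE homi1) => /eqP.
rewrite -subr_eq0 -addrA addr_eq0 => /eqP ->.
apply: idealN; apply: idealB.
  rewrite raddf_sum; apply: ideal_sum => j jJ.
  rewrite [X in ideal _ _ X](pihomogMr _ _ (bi_homog Hf j)).
  apply: idealM; apply: ideal_gen; rewrite !inE andbT.
  by apply: contraTneq jJ => ->; rewrite inE i1J.
rewrite raddf_sum; apply: ideal_sum => l _.
rewrite [X in ideal _ _ X](pihomogMr _ _ (bi_homog Hf l)).
have [->|li] := eqVneq l i1; last by apply: idealM; apply: ideal_gen; rewrite !inE li.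
(* In degree [d i1], the coefficient of [f i1] is the constant term of [b i1], and every term of
   [b i1] is divisible by some variable. *)
rewrite hcomp_diag raddf_sum big1 ?mul0r; first exact: ideal0.
move=> k _ /=; rewrite (rmorphM (mcoeff 0%MM)) /= mcoeffX.
by rewrite mnm1_eq0 mul0r.
Qed.

Lemma jacobian_lker_inv (h : 'I_r -> S) : (forall i, h i \in ginv) ->
  (forall k, \sum_i h i * (f i)^`M(k) = 0) -> forall i, h i = 0.
Proof.
move=> hG hsum i; rewrite (@pihomog_partitionE _ _ mdeg _ (h i) (leqnn _)).
rewrite big1 // => D _.
(* The derivatives of [f i] have degree [d i - 1]: in degree [E] of the relation, [h i] contributes
   exactly its component of degree [D]. *)
pose E := (D + (d i).-1)%N.
have := @jacobian_lker_homog (fun j => hcomp E (d j).-1 (h j))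
  (fun j => (E - (d j).-1)%N) _ _ _ i.
rewrite /hcomp leq_addl addnK; apply.
- by move=> j; exact: hcomp_inv.
- by move=> j; exact: hcomp_homog.
- move=> k; transitivity (pihomog mdeg E (\sum_j h j * (f j)^`M(k))); last first.
    by rewrite hsum pihomog0.
  rewrite [RHS]raddf_sum.
  apply: eq_bigr => j _; symmetry; apply: pihomogMr.
  exact/mderiv_homog/(bi_homog Hf).
Qed.

Lemma mderiv_act (w : 'M[F]_n) (p : S) k :
  (act w p)^`M(k) = \sum_l w k l *: act w (p^`M(l)).
Proof.
rewrite /act mderiv_comp_mpoly; apply: eq_bigr => l _.
rewrite mulrC -mul_mpolyC; congr (_ * _); rewrite tnth_mktuple /linform raddf_sum.
rewrite (bigD1 k) //= linearZ /= mderivXU eqxx alg_mpolyC big1 ?addr0 // => i ik.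
by rewrite linearZ /= mderivXU eq_sym (negPf ik) scaler0.
Qed.

(** Reduction to invariant coefficients: multiplying the relations by [M] turns the coefficient
    [h i0] into a norm, and averaging preserves the relations, since by [mderiv_act] the group mixes
    them linearly. The average of the norm is then zero, although it is [N] times a nonzero
    polynomial. *)
Lemma jacobian_lker (h : 'I_r -> S) :
  (forall k, \sum_i h i * (f i)^`M(k) = 0) -> forall i, h i = 0.
Proof.
move=> hsum i0; apply/eqP/negP => /negP h0.
pose M := \prod_(w <- G | w != 1%:M) act w (h i0).
pose nrm := \prod_(w <- G) act w (h i0).
have nrmE : M * h i0 = nrm.
  by rewrite /nrm (bigD1_seq 1%:M) ?(rg1 HG) ?(rg_uniq HG) //= act1 mulrC.
have nrmG : nrm \in ginv.
  apply/ginvP => w wG; rewrite /nrm rmorph_prod /= -[RHS](big_mulG HG _ _ wG).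
  by apply: eq_bigr => v _; rewrite actM.
have act_inj w : w \in G -> injective (act w).
  move=> wG; have [v _ /mulmx1C vw] := rgV HG wG.
  by apply: (can_inj (g := act v)) => p; rewrite -actM vw act1.
have nrm0 : nrm != 0.
  rewrite prodf_seq_neq0; apply/allP => w wG /=; apply: contra h0 => /eqP E.
  by apply/eqP; apply: (act_inj w wG); rewrite E rmorph0.
suff : avg nrm = 0.
  rewrite avg_id // -mul_mpolyC => /eqP.
  by rewrite mulf_eq0 (negPf nrm0) orbF mpolyC_eq0 (negPf (sizeG_neq0 HG)).
rewrite -nrmE; apply: (@jacobian_lker_inv (fun i => avg (M * h i))) => [i|k].
  exact: (avg_inv HG).
under eq_bigr => i _ do rewrite mulr_suml.
rewrite exchange_big big_seq big1 // => w wG.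
transitivity (\sum_i \sum_l w k l *: act w (M * (h i * (f i)^`M(l)))).
  apply: eq_bigr => i _; rewrite -{1}(ginvP _ _ (bi_inv Hf i) w wG) mderiv_act.
  by rewrite mulr_sumr; apply: eq_bigr => l _; rewrite mulrA !rmorphM /= scalerAr.
rewrite exchange_big big1 // => l _; rewrite -scaler_sumr -raddf_sum -mulr_sumr.
by rewrite hsum mulr0 raddf0 scaler0.
Qed.

End Chevalley.

(** * Clearing denominators in a field of fractions *)

Section Fractions.
Context (R : idomainType).
Local Notation "x %:F" := (@FracField.tofrac R x).

Lemma frac_denom (x : {fraction R}) : exists2 s : R, s != 0 & exists a, s%:F * x = a%:F.
Proof.
elim/quotW: x => x; exists \d_x; first exact: denom_ratioP.
exists \n_x; rewrite !piE; apply/eqmodP => /=.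
by rewrite FracField.equivfE !numden_Ratio ?mulr1 ?mul1r ?oner_eq0 ?denom_ratioP.
Qed.

Lemma frac_common_denom (I : finType) (x : I -> {fraction R}) :
  exists2 s : R, s != 0 & exists a : I -> R, forall i, s%:F * x i = (a i)%:F.
Proof.
have /choice[s sP] i : exists s : R, s != 0 /\ exists a, s%:F * x i = a%:F.
  by have [s s0 sa] := frac_denom (x i); exists s.
have /choice[a aP] i := (sP i).2.
exists (\prod_i s i).
  by rewrite prodf_seq_neq0; apply/allP => i _; rewrite (sP i).1.
exists (fun i => (\prod_(j | j != i) s j) * a i) => i.
by rewrite (bigD1 i) //= [s i * _]mulrC !tofracM -aP mulrA.
Qed.

End Fractions.

(** * The Jacobian matrix of the basic invariants *)

Section Jacobian.
Context (F : fieldType) (n : nat) (G : seq 'M[F]_n) (HG : reflection_group G).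
Local Notation S := {mpoly F[n]}.
Local Notation ginv := (ginv G).

Section Derivation.
Context (v : 'I_n -> S).
Let X (p : S) := \sum_k v k * p^`M(k).

Let X_is_linear : linear X.
Proof.
move=> c p q; rewrite /X scaler_sumr -big_split; apply: eq_bigr => k _ /=.
by rewrite linearP mulrDr scalerAr.
Qed.
HB.instance Definition _ := GRing.isLinear.Build F S S _ X X_is_linear.

Let XM p q : X (p * q) = X p * q + p * X q.
Proof.
rewrite /X mulr_suml mulr_sumr -big_split; apply: eq_bigr => k _ /=.
by rewrite mderivM mulrDr; congr (_ + _); [rewrite mulrA | rewrite mulrCA].
Qed.

Let X_horner (phi : {poly S}) (u : S) :
  X phi.[u] = (map_poly X phi).[u] + phi^`().[u] * X u.
Proof.
elim/poly_ind: phi => [|phi c IH].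
  by rewrite deriv0 map_poly0 !hornerE raddf0.
rewrite !hornerE derivMXaddC raddfD /= XM IH (raddfD (map_poly X)) /= map_polyC /=.
have -> : map_poly X (phi * 'X) = map_poly X phi * 'X.
  by apply/polyP => i; rewrite coefMX !coef_map /= coefMX; case: ifP; rewrite ?raddf0.
rewrite !hornerE /=; ring.
Qed.

(* [x_j] is a simple root of its orbit polynomial, whose coefficients are
   invariant and hence killed by the derivation. *)
Lemma derivation_inv_eq0 :
  (forall g, g \in ginv -> \sum_k v k * g^`M(k) = 0) -> forall j, v j = 0.
Proof.
(* Keeping one copy of each conjugate makes ['X_j] a simple root of [phi]. *)
move=> Xinv j; pose O := undup [seq act w 'X_j | w <- G].
pose phi : {poly S} := \prod_(u <- O) ('X - u%:P).
have XjO : 'X_j \in O.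
  by rewrite mem_undup; apply/mapP; exists 1%:M; rewrite ?(rg1 HG) ?act1.
have act_O w : w \in G -> perm_eq (map (act w) O) O.
  move=> wG; have [w' w'G ww'] := rgV HG wG; have w'w := mulmx1C ww'.
  apply: uniq_perm; rewrite ?undup_uniq //.
    rewrite map_inj_uniq ?undup_uniq //; apply: (can_inj (g := act w')) => p.
    by rewrite -actM w'w act1.
  move=> p; apply/mapP/idP => [[q]|]; rewrite ?mem_undup => /mapP[u uG ->].
    move=> ->; apply/mapP; exists (w *m u); rewrite ?actM //.
    exact: (rgM HG).
  exists (act w' (act u 'X_j)); last by rewrite -actM ww' act1.
  rewrite mem_undup; apply/mapP; exists (w' *m u); rewrite ?actM //.
  exact: (rgM HG).
have phi_inv i : phi`_i \in ginv.
  apply/ginvP => w wG; rewrite -coef_map /=.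
  suff -> : map_poly (act w) phi = phi by [].
  rewrite /phi rmorph_prod -[RHS](perm_big _ (act_O w wG)) /= big_map.
  by apply: eq_bigr => u _; rewrite rmorphB /= map_polyX map_polyC.
have phiE : phi = ('X - ('X_j)%:P) * \prod_(u <- O | u != 'X_j) ('X - u%:P).
  by rewrite /phi (bigD1_seq 'X_j) ?undup_uniq.
have X0 : map_poly X phi = 0.
  by apply/polyP => i; rewrite coef_map coef0; apply: Xinv.
(* Applying the derivation to [phi('X_j) = 0] leaves the derivative of [phi] at ['X_j] times
   [v j]. *)
have := X_horner phi 'X_j; rewrite X0 horner0 add0r {1}phiE hornerM hornerXsubC subrr mul0r.
rewrite raddf0 phiE derivM derivXsubC hornerD !hornerM hornerXsubC subrr mul0r addr0.
rewrite hornerE mul1r => /esym/eqP; rewrite mulf_eq0 horner_prod => /orP[|].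
  rewrite prodf_seq_eq0 => /hasP[u _ /andP[uj]].
  by rewrite hornerXsubC subr_eq0 eq_sym (negPf uj).
rewrite /X (bigD1 j) //= mderivXU eqxx mulr1 big1 ?addr0 => [/eqP //|k kj].
by rewrite mderivXU (negPf kj) mulr0.
Qed.

End Derivation.

Definition jacobian r (f : 'I_r -> S) : 'M[S]_(r, n) := \matrix_(i, k) (f i)^`M(k).

(** Clearing denominators turns a row vector killed by [J] over the fraction field into one over
    [S]. *)
Lemma rker_eq0_rank m1 m2 (J : 'M[S]_(m1, m2)) :
  (forall h : 'I_m1 -> S, (forall k, \sum_i h i * J i k = 0) -> forall i, h i = 0) ->
  \rank (map_mx (@FracField.tofrac S) J) = m1.
Proof.
move=> H; apply/eqP; rewrite -/(row_free _) -kermx_eq0; apply/eqP/row_matrixP => a.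
rewrite row0; set u := row a _.
have uJ : u *m map_mx (@FracField.tofrac S) J = 0.
  by rewrite /u -row_mul mulmx_ker row0.
have [s s0 [h hP]] := frac_common_denom (u 0).
have h0 : forall i, h i = 0.
  apply: H => k; apply/eqP; rewrite -tofrac_eq0 raddf_sum /=; apply/eqP.
  transitivity (FracField.tofrac s * (u *m map_mx (@FracField.tofrac S) J) 0 k); last first.
    by rewrite uJ mxE mulr0.
  rewrite mxE mulr_sumr; apply: eq_bigr => i _.
  by rewrite tofracM -hP !mxE mulrA.
apply/rowP => i; rewrite [RHS]mxE; apply/eqP; have /eqP := hP i.
by rewrite h0 tofrac0 mulf_eq0 tofrac_eq0 (negPf s0).
Qed.

Lemma jacobian_derivation_inv r (f : 'I_r -> S) (v : 'I_n -> S) :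
  (forall g, g \in ginv -> exists q : {mpoly F[r]}, g = q \mPo [tuple f i | i < r]) ->
  (forall i, \sum_k v k * (f i)^`M(k) = 0) ->
  forall g, g \in ginv -> \sum_k v k * g^`M(k) = 0.
Proof.
move=> gen vf g /gen[q ->].
under eq_bigr => k _ do rewrite mderiv_comp_mpoly mulr_sumr.
rewrite exchange_big big1 // => i _ /=.
under eq_bigr => k _ do rewrite tnth_mktuple mulrCA.
by rewrite -mulr_sumr vf mulr0.
Qed.

(** The Jacobian matrix has rank [r] by [jacobian_lker] and rank [n] by [derivation_inv_eq0]: it is
    square, with nonzero determinant. *)
Lemma Chevalley : exists f : 'I_n -> S,
  [/\ forall i, f i \in ginv,
      forall g, g \in ginv -> exists q : {mpoly F[n]}, g = q \mPo [tuple f i | i < n]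
    & \det (jacobian f) != 0].
Proof.
have [r [f [d Hf]]] := basic_invariants_exist HG.
have gen := inv_comp HG Hf.
have rkr : \rank (map_mx (@FracField.tofrac S) (jacobian f)) = r.
  apply: rker_eq0_rank => h hJ; apply: (jacobian_lker HG Hf) => k.
  by rewrite -[RHS](hJ k); apply: eq_bigr => i _; rewrite mxE.
have rkn : \rank (map_mx (@FracField.tofrac S) (jacobian f)^T) = n.
  apply: rker_eq0_rank => v vJ; apply: derivation_inv_eq0.
  apply: (jacobian_derivation_inv gen) => i.
  by rewrite -[RHS](vJ i); apply: eq_bigr => k _; rewrite !mxE.
have rn : r = n by apply: etrans (esym rkr) (etrans _ rkn); rewrite -map_trmx mxrank_tr.
move: f d Hf gen rkr rkn; rewrite {}rn => f d Hf gen rkn _.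
exists f; split=> //; first exact: (bi_inv Hf).
have : map_mx (@FracField.tofrac S) (jacobian f) \in unitmx.
  by rewrite -row_free_unit /row_free; apply/eqP.
by rewrite unitmxE unitfE det_map_mx tofrac_eq0.
Qed.

End Jacobian.

Lemma msize_mderiv n (R : comNzRingType) (q : {mpoly R[n]}) i :
  (msize q^`M(i) <= (msize q).-1)%N.
Proof.
apply/bigmax_leqP_seq => m mq _ /=.
have : (m + U_(i))%MM \in msupp q.
  rewrite mcoeff_msupp; apply: contraTneq mq => E.
  by rewrite mcoeff_msupp mcoeff_mderiv E mul0rn eqxx.
by move/msize_mdeg_lt; rewrite mdegD mdeg1 addn1; case: (msize q).
Qed.

Lemma closed_field_uniq_seq (F : closedFieldType) k :
  exists2 s : seq F, size s = k & uniq s.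
Proof.
elim: k => [|k [s sk us]]; first by exists [::].
have [c c0] : exists c, root (\prod_(a <- s) ('X - a%:P) * 'X + 1) c.
  apply/closed_rootP; rewrite -[1]/(1%:P) size_MXaddC oner_eq0 andbF /=.
  by rewrite size_prod_XsubC.
exists (c :: s); rewrite /= ?sk // us andbT; apply/negP => cs.
move: c0; rewrite /root !hornerE; have /eqP -> : (\prod_(a <- s) ('X - a%:P)).[c] == 0.
  by rewrite -/(root _ _) root_prod_XsubC.
by rewrite mul0r add0r oner_eq0.
Qed.

(** * The Jacobian criterion in positive characteristic *)

Section AlgebraicIndependence.
Context (F : closedFieldType) (p : nat) (pF : p \in [pchar F]) (n : nat).
Local Notation S := {mpoly F[n]}.

Let p_prime : prime p := pcharf_prime pF.

Lemma pth_root (a : F) : exists b, b ^+ p = a.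
Proof.
have [b] := solve_monicpoly (fun i => if i == 0 then a else 0) (prime_gt0 p_prime).
move=> bE; exists b; rewrite bE; case: p (prime_gt0 p_prime) => // q _.
by rewrite big_ord_recl big1 ?expr0 ?mulr1 ?addr0 // => i _; rewrite mul0r.
Qed.

Lemma pchar_mpoly m : p \in [pchar {mpoly F[m]}].
Proof. by rewrite inE p_prime -mpolyC_nat (pcharf0 pF) mpolyC0 /=. Qed.

(** All exponents of [q] are divisible by [p], its coefficients have [p]-th roots, and the Frobenius
    map is additive. *)
Lemma mderiv_eq0_pth_power (q : S) :
  (forall i, q^`M(i) = 0) -> exists r : S, q = r ^+ p.
Proof.
move=> q0; have dv (m : 'X_{1..n}) : m \in msupp q -> forall i, (p %| m i)%N.
  move=> mq i; have [->|mi] := posnP (m i); first exact: dvdn0.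
  have := congr1 (mcoeff (m - U_(i))) (q0 i).
  rewrite mcoeff_mderiv mcoeff0 submK ?lep1mP -?lt0n // => /eqP.
  rewrite mnmBE mnm1E eqxx subn1 prednK // -mulr_natr mulf_eq0.
  move: mq; rewrite mcoeff_msupp => /negPf -> /=.
  by rewrite -(dvdn_pcharf pF).
have /choice[b bP] (m : 'X_{1..n}) := pth_root q@_m.
exists (\sum_(m <- msupp q) b m *: 'X_[[multinom (m i %/ p)%N | i < n]]).
have := rmorph_sum (pFrobenius_aut (pchar_mpoly n)).
move=> /(_ _ (msupp q) predT (fun m => b m *: 'X_[[multinom (m i %/ p)%N | i < n]])).
rewrite /= pFrobenius_autE => ->; rewrite {1}[q]mpolyE; apply: eq_big_seq => m mq.
rewrite pFrobenius_autE exprZn bP mpolyXn; congr (_ *: 'X_[_]).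
by apply/mnmP => i; rewrite mulmnE mnmE divnK ?dv.
Qed.

(** Induction on the degree of a relation. By the chain rule and the nonzero determinant, its
    partial derivatives are relations too, hence zero; so it is a [p]-th power, whose root is again
    a relation. *)
Lemma jacobian_alg_indep (f : 'I_n -> S) : \det (jacobian f) != 0 ->
  forall q : {mpoly F[n]}, q \mPo [tuple f i | i < n] = 0 -> q = 0.
Proof.
move=> J0 q; have [k] := ubnP (msize q); elim: k q => // k IH q.
rewrite ltnS => qk qf; have [//|q0] := eqVneq q 0.
have q1 : (0 < msize q)%N by rewrite lt0n msize_poly_eq0.
have dq i : q^`M(i) = 0.
  apply: IH.
    by apply: leq_ltn_trans (msize_mderiv _ _) _; rewrite prednK.
  pose u : 'rV[S]_n := \row_i (q^`M(i) \mPo [tuple f i | i < n]).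
  have uJ : u *m jacobian f = 0.
    apply/rowP => l; rewrite !mxE.
    transitivity ((q \mPo [tuple f i | i < n])^`M(l)); last by rewrite qf mderiv0.
    rewrite mderiv_comp_mpoly; apply: eq_bigr => j _.
    by rewrite !mxE tnth_mktuple.
  have : \det (jacobian f) *: u = 0.
    by rewrite -mul_mx_scalar -mul_mx_adj mulmxA uJ mul0mx.
  move/rowP/(_ i)/eqP; rewrite !mxE mulf_eq0 (negPf J0) /=.
  by move/eqP.
have [r rE] := mderiv_eq0_pth_power dq.
have r0 : r != 0 by apply: contraNneq q0 => r0; rewrite rE r0 expr0n gtn_eqF ?prime_gt0.
have rf : r \mPo [tuple f i | i < n] = 0.
  apply/eqP; have := qf; rewrite rE rmorphXn => /eqP.
  by rewrite expf_eq0 prime_gt0.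
(* Passing to the root lowers the degree only when [q] is not constant; a constant relation is zero
   at once. *)
have [q_le|q_gt] := leqP (msize q) 1.
  by have := qf; rewrite (msize1_polyC q_le) comp_mpolyC => ->.
have : r = 0; last by move/eqP; rewrite (negPf r0).
apply: IH => //; apply: leq_trans qk.
rewrite -(mlead_deg r0) -(mlead_deg q0) rE mleadX // mdegMn ltnS.
have [d0|d0] := posnP (mdeg (mlead r)).
  by move: q_gt; rewrite -(mlead_deg q0) rE mleadX // mdegMn d0 mul0n.
by rewrite -[X in (X < _)%N]muln1 ltn_pmul2l // prime_gt1.
Qed.

End AlgebraicIndependence.

(** * The Weyl algebra and its normally ordered symbols *)

Section LinearEndomorphisms.
Context (F : fieldType) (m : nat).
Local Notation P := {mpoly F[m]}.

(** The representation of the Weyl algebra in [symbol_exists] needs an [algType] as target.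
    Linearity is stored as a boolean, so that equality of endomorphisms is pointwise. *)
Record lend := Lend { lend_fun :> P -> P; _ : `[< linear lend_fun >] }.

HB.instance Definition _ := [isSub for lend_fun].
HB.instance Definition _ := gen_eqMixin lend.
HB.instance Definition _ := gen_choiceMixin lend.

Lemma lendP (f : lend) : linear f.
Proof. by case: f => f /= /asboolP. Qed.

Lemma lend_ext (f g : lend) : f =1 g -> f = g.
Proof. by move=> fg; apply/val_inj/funext. Qed.

Definition mklend (f : P -> P) (H : linear f) : lend := Lend (introT (asboolP _) H).

Lemma lend0_lin : linear (fun _ : P => 0 : P).
Proof. by move=> c u v; rewrite scaler0 addr0. Qed.
Lemma lendD_lin (f g : lend) : linear (fun u => f u + g u).
Proof. by move=> c u v; rewrite !lendP scalerDr addrACA. Qed.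
Lemma lendN_lin (f : lend) : linear (fun u => - f u).
Proof. by move=> c u v; rewrite lendP opprD scalerN. Qed.
Lemma lendZ_lin c (f : lend) : linear (fun u => c *: f u).
Proof. by move=> d u v; rewrite lendP scalerDr !scalerA mulrC. Qed.
Lemma lend1_lin : linear (fun u : P => u).
Proof. by []. Qed.
Lemma lendM_lin (f g : lend) : linear (fun u => f (g u)).
Proof. by move=> c u v; rewrite !lendP. Qed.

Definition lend0 := mklend lend0_lin.
Definition lendD f g := mklend (lendD_lin f g).
Definition lendN f := mklend (lendN_lin f).
Definition lendZ c f := mklend (lendZ_lin c f).
Definition lend1 := mklend lend1_lin.
Definition lendM f g := mklend (lendM_lin f g).

Lemma lendDA : associative lendD.
Proof. by move=> f g h; apply: lend_ext => u /=; rewrite addrA. Qed.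
Lemma lendDC : commutative lendD.
Proof. by move=> f g; apply: lend_ext => u /=; rewrite addrC. Qed.
Lemma lend0D : left_id lend0 lendD.
Proof. by move=> f; apply: lend_ext => u /=; rewrite add0r. Qed.
Lemma lendND : left_inverse lend0 lendN lendD.
Proof. by move=> f; apply: lend_ext => u /=; rewrite addNr. Qed.
HB.instance Definition _ := GRing.isZmodule.Build lend lendDA lendDC lend0D lendND.

Lemma lendMA : associative lendM.
Proof. by move=> f g h; apply: lend_ext. Qed.
Lemma lend1M : left_id lend1 lendM.
Proof. by move=> f; apply: lend_ext. Qed.
Lemma lendM1 : right_id lend1 lendM.
Proof. by move=> f; apply: lend_ext. Qed.
Lemma lendMDl : left_distributive lendM lendD.
Proof. by move=> f g h; apply: lend_ext. Qed.
Lemma lendMDr : right_distributive lendM lendD.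
Proof.
move=> f g h; apply: lend_ext => u /=.
by have := lendP f 1 (g u) (h u); rewrite !scale1r.
Qed.
Lemma lend1_neq0 : lend1 != lend0.
Proof.
apply/eqP => /(congr1 (fun f : lend => f 1)) /= /eqP.
by rewrite oner_eq0.
Qed.
HB.instance Definition _ := GRing.Zmodule_isNzRing.Build lend
  lendMA lend1M lendM1 lendMDl lendMDr lend1_neq0.

Lemma lendZA c d f : lendZ c (lendZ d f) = lendZ (c * d) f.
Proof. by apply: lend_ext => u /=; rewrite scalerA. Qed.
Lemma lend1Z : left_id 1 lendZ.
Proof. by move=> f; apply: lend_ext => u /=; rewrite scale1r. Qed.
Lemma lendZDr : right_distributive lendZ +%R.
Proof. by move=> c f g; apply: lend_ext => u /=; rewrite scalerDr. Qed.
Lemma lendZDl f : {morph lendZ^~ f : c d / c + d}.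
Proof. by move=> c d; apply: lend_ext => u /=; rewrite scalerDl. Qed.
HB.instance Definition _ := GRing.Zmodule_isLmodule.Build F lend
  lendZA lend1Z lendZDr lendZDl.

Lemma lendZAl (c : F) (f g : lend) : c *: (f * g) = c *: f * g.
Proof. exact: lend_ext. Qed.
HB.instance Definition _ := GRing.Lmodule_isLalgebra.Build F lend lendZAl.

Lemma lendZAr (c : F) (f g : lend) : c *: (f * g) = f * (c *: g).
Proof.
apply: lend_ext => u /=; have := lendP f c (g u) 0; rewrite addr0 => ->.
have -> : f 0 = 0; last by rewrite addr0.
by have := lendP f (-1) 0 0; rewrite scaler0 addr0 scaleN1r addNr.
Qed.
HB.instance Definition _ := GRing.Lalgebra_isAlgebra.Build F lend lendZAr.

End LinearEndomorphisms.

Section WeylInduction.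
Context (F : fieldType) (n : nat) (A : algType F) (x y : 'I_n -> A).
Context (HA : is_weyl_algebra x y).

Section StableSubalgebra.
Context (Q : A -> Prop).
Hypotheses (QD : forall a b, Q a -> Q b -> Q (a + b))
  (QZ : forall (c : F) a, Q a -> Q (c *: a)).

(** Unlike [Q] itself, the multipliers that preserve [Q] are closed under products: they form a
    subalgebra, to which the universal property can be applied. *)
Definition stab : {pred A} := fun a => `[< forall u, Q u -> Q (a * u) >].

Lemma stab_subalg : subalg_closed stab.
Proof.
split=> [|c a b /asboolP Ha /asboolP Hb|a b /asboolP Ha /asboolP Hb];
  apply/asboolP => u Qu.
- by rewrite mul1r.
- by rewrite mulrDl -scalerAl; apply: QD; [apply: QZ; apply: Ha | apply: Hb].
- by rewrite -mulrA; apply: Ha; apply: Hb.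
Qed.
HB.instance Definition _ := GRing.isSubalgClosed.Build F A stab stab_subalg.

Record stabT := StabT { stab_val :> A; _ : stab_val \in stab }.
HB.instance Definition _ := [isSub for stab_val].
HB.instance Definition _ := [Choice of stabT by <:].
HB.instance Definition _ := [SubChoice_isSubAlgebra of stabT by <:].

(** The universal property maps [A] into the subalgebra; followed by the inclusion, this map is the
    identity by uniqueness. *)
Lemma stab_all : (forall i, x i \in stab) -> (forall i, y i \in stab) ->
  forall a, a \in stab.
Proof.
move=> xs ys; have [[xx yy yx] univ] := HA.
pose x' i := StabT (xs i); pose y' i := StabT (ys i).
have rel : @weyl_relations F n stabT x' y'.
  split=> i j; apply: val_inj.
  - by rewrite [LHS]rmorphM [RHS]rmorphM; exact: xx.
  - by rewrite [LHS]rmorphM [RHS]rmorphM; exact: yy.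
  - by rewrite [LHS]rmorphB [RHS]rmorph_nat -(yx i j); congr (_ - _); exact: rmorphM.
have [[f [[fD fM f1 fZ] fxy]] _] := univ _ x' y' rel.
have [_ uniq] := univ A x y (And3 xx yy yx).
move=> a; have <- : val (f a) = a; last exact: valP.
apply: (uniq (fun a => val (f a)) id) => [||i].
- split=> [u v|u v||c u].
  + by rewrite fD raddfD.
  + by rewrite fM rmorphM.
  + by rewrite f1 rmorph1.
  + by rewrite fZ linearZ.
- by split.
- by have [-> ->] := fxy i.
Qed.

End StableSubalgebra.

Lemma weyl_ind (Q : A -> Prop) :
  (forall a b, Q a -> Q b -> Q (a + b)) -> (forall (c : F) a, Q a -> Q (c *: a)) ->
  Q 1 -> (forall i a, Q a -> Q (x i * a)) -> (forall i a, Q a -> Q (y i * a)) ->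
  forall a, Q a.
Proof.
move=> QD QZ Q1 Qx Qy a.
have /asboolP H : a \in stab Q.
  by apply: (stab_all QD QZ) => i; apply/asboolP => u; [apply: Qx | apply: Qy].
by rewrite -[a]mulr1; apply: H.
Qed.

End WeylInduction.

Lemma mpoly_genind n (R : comNzRingType) (Q : {mpoly R[n]} -> Prop) :
  (forall p q, Q p -> Q q -> Q (p + q)) -> (forall c p, Q p -> Q (c *: p)) ->
  Q 1 -> (forall i p, Q p -> Q ('X_i * p)) -> forall p, Q p.
Proof.
move=> QD QZ Q1 QX p.
have Qm (m : 'X_{1..n}) q : Q q -> Q ('X_[m] * q).
  move: q; rewrite mpolyXE_id; apply: (big_ind (fun u => forall q, Q q -> Q (u * q))).
  - by move=> q; rewrite mul1r.
  - by move=> u v Hu Hv q Qq; rewrite -mulrA; apply: Hu; apply: Hv.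
  - move=> i _; elim: (m i) => [|k IH] q Qq; first by rewrite expr0 mul1r.
    by rewrite exprS -mulrA; apply: QX; apply: IH.
elim/mpolyind: p => [|c m p _ _ IH].
  by rewrite -(scale0r 1); apply: QZ.
by apply: QD => //; apply: QZ; rewrite -[X in Q X]mulr1; apply: Qm.
Qed.

Section CommutingFamily.
Context (F : fieldType) (n : nat) (A : algType F) (z : 'I_n -> A).
Hypothesis zz : forall i j, z i * z j = z j * z i.

Lemma comm_mmap1M (m1 m2 : 'X_{1..n}) :
  mmap1 z (m1 + m2) = mmap1 z m1 * mmap1 z m2.
Proof.
have comm (r : seq 'I_n) (m : 'I_n -> nat) k l :
    GRing.comm (z k ^+ l) (\prod_(i <- r) z i ^+ m i).
  by apply: commr_prod => i _; apply/commr_sym/commrX/commr_sym/commrX/zz.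
rewrite /mmap1; elim: (index_enum _) => [|i r IH]; first by rewrite !big_nil mulr1.
rewrite !big_cons IH mnmDE exprD -!mulrA; congr (_ * _).
by rewrite !mulrA comm.
Qed.

Definition kappa (q : {mpoly F[n]}) : A := mmap (in_alg A) z q.

Lemma kappa_is_linear : linear kappa.
Proof. by move=> c p q; rewrite /kappa mmapD mmapZ /= mulr_algl. Qed.
HB.instance Definition _ := GRing.isLinear.Build F {mpoly F[n]} A _ kappa kappa_is_linear.

Lemma kappa1 : kappa 1 = 1.
Proof. by rewrite /kappa -mpolyC1 mmapC /= scale1r. Qed.

Lemma kappaC c : kappa c%:MP = c%:A.
Proof. by rewrite /kappa mmapC. Qed.

Lemma kappaX i : kappa 'X_i = z i.
Proof. by rewrite /kappa mmapX mmap1U. Qed.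

Lemma kappaM p q : kappa (p * q) = kappa p * kappa q.
Proof.
have XM (m : 'X_{1..n}) r : kappa ('X_[m] * r) = kappa 'X_[m] * kappa r.
  elim/mpolyind: r => [|c k r _ _ IH]; first by rewrite mulr0 !raddf0 mulr0.
  rewrite mulrDr !raddfD /= mulrDr IH -scalerAr -mpolyXD !linearZ /= -scalerAr.
  by congr (_ *: _ + _); rewrite /kappa !mmapX comm_mmap1M.
elim/mpolyind: p => [|c k p _ _ IH]; first by rewrite mul0r !raddf0 mul0r.
by rewrite mulrDl !raddfD /= mulrDl IH -scalerAl !linearZ /= XM scalerAl.
Qed.

End CommutingFamily.

(** * Symbols, normal ordering and the absence of zero divisors *)

Section Symbol.
Context (F : fieldType) (n : nat) (A : algType F) (x y : 'I_n -> A).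
Context (HA : is_weyl_algebra x y).
Local Notation P := {mpoly F[n + n]}.
Local Notation Xl i := ('X_(lshift n i) : P).
Local Notation Xr i := ('X_(rshift n i) : P).

Let xx i j : x i * x j = x j * x i. Proof. by have [[]] := HA. Qed.
Let yy i j : y i * y j = y j * y i. Proof. by have [[]] := HA. Qed.
Lemma weyl_yx i j : y i * x j = x j * y i + (i == j)%:R.
Proof. by have [[_ _ yx] _] := HA; rewrite -(yx i j) addrC subrK. Qed.

Lemma mderiv_lr i j : (Xr j)^`M(lshift n i) = 0.
Proof. by rewrite mderivXU eq_lrshift. Qed.

Lemma mderiv_ll i j : (Xl j)^`M(lshift n i) = (i == j)%:R.
Proof. by rewrite mderivXU eq_lshift. Qed.

(* The representation on [F[x, t]] where [x_i] is a multiplication and [y_i] is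
   [d/dx_i + t_i]: it is faithful, since [x^a y^b] maps [1] to [x^a t^b]. *)
Lemma symbol_exists : exists s : A -> P,
  [/\ linear s, s 1 = 1, forall i a, s (x i * a) = Xl i * s a
    & forall i a, s (y i * a) = (s a)^`M(lshift n i) + Xr i * s a].
Proof.
have [_ univ] := HA.
have xlin i : linear (fun q => Xl i * q).
  by move=> c u v; rewrite mulrDr scalerAr.
have ylin i : linear (fun q => q^`M(lshift n i) + Xr i * q).
  by move=> c u v; rewrite linearP /= mulrDr -scalerAr scalerDr addrACA.
pose x' i := mklend (xlin i); pose y' i := mklend (ylin i).
have rel : weyl_relations x' y'.
  split=> i j; apply: lend_ext => q /=.
  - by rewrite mulrCA.
  - rewrite !mderivD !mderivM !mderiv_lr !mul0r !add0r.
    rewrite mderiv_comm !mulrDr !addrA; congr (_ + _); last by rewrite mulrCA.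
    by rewrite addrAC.
  - have -> : ((i == j)%:R : lend F (n + n)) q = (i == j)%:R * q.
      by case: (i == j) => /=; rewrite ?mul1r ?mul0r.
    rewrite mderivM mderiv_ll; ring.
have [[rho [[rD rM r1 rZ] rxy]] _] := univ _ x' y' rel.
exists (fun a => (rho a : lend _ _) 1); split=> [c a b||i a|i a].
- by rewrite rD rZ.
- by rewrite r1.
- by rewrite rM (rxy i).1.
- by rewrite rM (rxy i).2.
Qed.

Definition wgen (k : 'I_(n + n)) : A :=
  match split k with inl i => x i | inr i => y i end.

Lemma wgenl i : wgen (lshift n i) = x i.
Proof. by rewrite /wgen -[lshift n i]/(unsplit (inl i)) unsplitK. Qed.

Lemma wgenr i : wgen (rshift n i) = y i.
Proof. by rewrite /wgen -[rshift n i]/(unsplit (inr i)) unsplitK. Qed.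

(** Normal ordering: the products of [mmap] follow the order of the indices, which puts the [x_i] to
    the left of the [y_i]. *)
Definition nord (q : P) : A := mmap (in_alg A) wgen q.

Lemma nord_is_linear : linear nord.
Proof. by move=> c p q; rewrite /nord mmapD mmapZ /= mulr_algl. Qed.
HB.instance Definition _ := GRing.isLinear.Build F P A _ nord nord_is_linear.

Lemma nord1 : nord 1 = 1.
Proof. by rewrite /nord -mpolyC1 mmapC /= scale1r. Qed.

Let lpart (m : 'X_{1..(n + n)}) : 'X_{1..n} := [multinom m (lshift n i) | i < n].
Let rpart (m : 'X_{1..(n + n)}) : 'X_{1..n} := [multinom m (rshift n i) | i < n].

Let nordX m : nord 'X_[m] = mmap1 x (lpart m) * mmap1 y (rpart m).
Proof.
rewrite /nord mmapX /mmap1 big_split_ord /=; congr (_ * _); apply: eq_bigr => i _.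
  by rewrite wgenl mnmE.
by rewrite wgenr mnmE.
Qed.

Lemma nordXl i q : nord (Xl i * q) = x i * nord q.
Proof.
elim/mpolyind: q => [|c m q _ _ IH]; first by rewrite mulr0 !raddf0 mulr0.
rewrite mulrDr !raddfD /= mulrDr IH -scalerAr !linearZ /= -scalerAr -mpolyXD.
congr (_ *: _ + _); rewrite !nordX mulrA -(mmap1U x i) -(comm_mmap1M xx).
congr (mmap1 x _ * mmap1 y _); apply/mnmP => j; rewrite !(mnmDE, mnmE).
  by rewrite eq_lshift.
by rewrite eq_lrshift.
Qed.

Lemma nordXr i q : nord (Xr i * q) = nord q * y i.
Proof.
elim/mpolyind: q => [|c m q _ _ IH]; first by rewrite mulr0 !raddf0 mul0r.
rewrite mulrDr !raddfD /= mulrDl IH -scalerAr !linearZ /= -scalerAl -mpolyXD.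
congr (_ *: _ + _); rewrite !nordX -mulrA -(mmap1U y i) -(comm_mmap1M yy) addmC.
congr (mmap1 x _ * mmap1 y _); apply/mnmP => j; rewrite !(mnmDE, mnmE).
  by rewrite eq_rlshift addn0.
by rewrite eq_rshift.
Qed.

Lemma XlrP (k : 'I_(n + n)) :
  (exists i, k = lshift n i) \/ (exists i, k = rshift n i).
Proof. by case: (splitP k) => i ki; [left|right]; exists i; apply: val_inj. Qed.

Lemma nord_ydiff i q : y i * nord q = nord q * y i + nord q^`M(lshift n i).
Proof.
elim/mpoly_genind: q => [p q Hp Hq|c p Hp||k p Hp].
- by rewrite !raddfD /= mulrDr mulrDl Hp Hq addrACA.
- by rewrite !linearZ /= -scalerAr -scalerAl Hp scalerDr.
- by rewrite nord1 mul1r mulr1 -mpolyC1 mderivC raddf0 addr0.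
- have [[j ->]|[j ->]] := XlrP k.
    rewrite mderivM mderiv_ll raddfD /= !nordXl mulrA weyl_yx mulrDl -mulrA Hp.
    rewrite mulrDr !mulrA -!addrA; congr (_ + _); rewrite addrC; congr (_ + _).
    by case: eqP => _; rewrite ?mul1r ?mul0r ?raddf0.
  rewrite mderivM mderiv_lr mul0r add0r !nordXr mulrA Hp mulrDl -!mulrA.
  by rewrite yy.
Qed.

Definition symb : A -> P := sval (cid symbol_exists).
Let symbP : [/\ linear symb, symb 1 = 1, forall i a, symb (x i * a) = Xl i * symb a
    & forall i a, symb (y i * a) = (symb a)^`M(lshift n i) + Xr i * symb a].
Proof. by rewrite /symb; case: cid. Qed.

Lemma symb_is_linear : linear symb. Proof. by case: symbP. Qed.
HB.instance Definition _ := GRing.isLinear.Build F A P _ symb symb_is_linear.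

Lemma symb1 : symb 1 = 1. Proof. by case: symbP. Qed.
Lemma symb_xl i a : symb (x i * a) = Xl i * symb a. Proof. by case: symbP. Qed.
Lemma symb_yl i a : symb (y i * a) = (symb a)^`M(lshift n i) + Xr i * symb a.
Proof. by case: symbP. Qed.

Lemma symb_yr i a : symb (a * y i) = Xr i * symb a.
Proof.
elim/(weyl_ind HA): a => [a b Ha Hb|c a Ha||j a Ha|j a Ha].
- by rewrite mulrDl !raddfD /= Ha Hb mulrDr.
- by rewrite -scalerAl !linearZ /= Ha scalerAr.
- by rewrite mul1r -[y i]mulr1 symb_yl symb1 -mpolyC1 mderivC add0r.
- by rewrite -mulrA !symb_xl Ha mulrCA.
- by rewrite -mulrA !symb_yl Ha mderivM mderiv_lr mul0r add0r mulrDr [in RHS]mulrCA.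
Qed.

(** The ordered monomials span [A]. Together with their independence, which is [nordK], this is the
    Poincare-Birkhoff-Witt basis. *)
Lemma symbK : cancel symb nord.
Proof.
apply: (weyl_ind HA) => [a b Ha Hb|c a Ha||j a Ha|j a Ha].
- by rewrite !raddfD /= Ha Hb.
- by rewrite !linearZ /= Ha.
- by rewrite symb1 nord1.
- by rewrite symb_xl nordXl Ha.
- by rewrite symb_yl raddfD /= nordXr -{3}Ha nord_ydiff addrC Ha.
Qed.

Lemma nordK : cancel nord symb.
Proof.
move=> q; elim/mpoly_genind: q => [p q Hp Hq|c p Hp||k p Hp].
- by rewrite !raddfD /= Hp Hq.
- by rewrite !linearZ /= Hp.
- by rewrite nord1 symb1.
- by have [[j ->]|[j ->]] := XlrP k; rewrite ?nordXl ?nordXr ?symb_xl ?symb_yr Hp.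
Qed.

Lemma symb_eq0 a : (symb a == 0) = (a == 0).
Proof.
by apply/eqP/eqP => [E|->]; rewrite ?raddf0 // -[a]symbK E raddf0.
Qed.

Let low k (q : P) := (msize q <= k)%N.

(** Moving a [y_i] past [b] costs a derivative of the symbol of [b], so symbols multiply up to terms
    of lower degree. *)
Let symb_mul_word (w : seq 'I_(n + n)) b l : low l (symb b) ->
  low (size w + l).-1 (symb (nord (\prod_(k <- w) 'X_k) * b) - \prod_(k <- w) 'X_k * symb b).
Proof.
have lowD k p q : low k p -> low k q -> low k (p + q).
  by move=> Hp Hq; apply: leq_trans (msizeD_le _ _) _; rewrite geq_max; apply/andP.
have lowX (k : 'I_(n + n)) e q : low e q -> low e.+1 ('X_k * q).
  have [->|q0] := eqVneq q 0; first by rewrite mulr0 /low msize0.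
  have X0 : ('X_k : P) != 0 by rewrite -msize_poly_eq0 msizeX.
  by rewrite /low msizeM // msizeX mdeg1 add2n.
have low0 e : low e 0 by rewrite /low msize0.
elim: w b l => [|k w IH] b l Hb.
  by rewrite !big_nil nord1 !mul1r subrr low0.
rewrite !big_cons; set W := \prod_(j <- w) 'X_j.
have lowW e q : low e q -> low (size w + e) (W * q).
  by rewrite /W; elim: w {IH W} => [|j w IHw] He; rewrite ?big_nil ?mul1r // big_cons -mulrA;
     apply: lowX; apply: IHw.
have [b0|b0] := eqVneq (symb b) 0.
  by have /eqP := b0; rewrite symb_eq0 => /eqP ->; rewrite !mulr0 raddf0 mulr0 subrr low0.
have l0 : (0 < l)%N.
  by apply: leq_trans Hb; rewrite lt0n msize_poly_eq0.
have [[j ->]|[j ->]] := XlrP k.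
  rewrite nordXl -mulrA symb_xl -[X in _ - X]mulrA -mulrBr /=.
  rewrite -[X in low X]prednK ?addSn ?addn_gt0 ?l0 ?orbT //=.
  have -> : (size w + l)%N = ((size w + l).-1).+1 by rewrite prednK // addn_gt0 l0 orbT.
  by apply: lowX; apply: IH.
rewrite nordXr -mulrA.
have -> : symb (nord W * (y j * b)) - Xr j * W * symb b =
   (symb (nord W * (y j * b)) - W * symb (y j * b)) + W * (symb b)^`M(lshift n j).
  rewrite symb_yl; ring.
have dlow : low l.-1 (symb b)^`M(lshift n j).
  by apply: leq_trans (msize_mderiv _ _) _; rewrite -!subn1 leq_sub2r.
rewrite /=; apply: (lowD _ _ _).
  (* The letter [y j] is absorbed into [b], whose symbol may grow by one degree. *)
  have := IH (y j * b) l.+1; rewrite addnS /=; apply.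
  rewrite symb_yl; apply: (lowD _ _ _); last exact: lowX.
  by apply: leq_trans dlow _; rewrite (leq_trans (leq_pred _)).
apply: leq_trans (lowW _ _ dlow) _.
by rewrite leq_add2l leq_pred.
Qed.

(** In top degree the symbol of a product is the product of the symbols, and polynomials over a
    field have no zero divisors. *)
Lemma weyl_domain (a b : A) : a * b = 0 -> a = 0 \/ b = 0.
Proof.
move=> ab; have [->|a0] := eqVneq a 0; first by left.
have [->|b0] := eqVneq b 0; first by right.
set q := symb a; set r := symb b.
have q0 : q != 0 by rewrite symb_eq0.
have r0 : r != 0 by rewrite symb_eq0.
have qs : (0 < msize q)%N by rewrite lt0n msize_poly_eq0.
have rs : (0 < msize r)%N by rewrite lt0n msize_poly_eq0.
(* [msize (q * r)] is [(msize q + msize r).-1], one above this bound; with [a * b = 0] the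
   difference reduces to [- (q * r)]. *)
have : low (msize q + msize r).-2 (symb (nord q * b) - q * r).
  rewrite {2 3}[q]mpolyE raddf_sum mulr_suml raddf_sum mulr_suml -sumrB.
  rewrite /low; apply: leq_trans (msize_sum _ _ _) _.
  apply/bigmax_leqP_seq => m mq _ /=.
  rewrite linearZ /= -!scalerAl linearZ /= -scalerBr.
  apply: leq_trans (msizeZ_le _ _) _.
  rewrite -(s2mK m) Xs2m; apply: leq_trans (symb_mul_word _ (leqnn _)) _.
  rewrite size_m2s -!subn1 leq_sub2r // leq_subRL ?addn_gt0 ?qs //.
  by rewrite addnA leq_add2r add1n msize_mdeg_lt.
rewrite symbK ab raddf0 sub0r /low msizeN msizeM //.
case: (msize q) qs => // a' _; case: (msize r) rs => // b' _.
by rewrite addSn addnS /= ltnn.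
Qed.

End Symbol.

(** * The Weyl algebra in positive characteristic *)

Definition central (A : nzRingType) (z : A) := forall a, z * a = a * z.

(* Cayley-Hamilton for the left multiplication by an element of an algebra that
   is a finite module over a central subring. *)
Section Integral.
Context (C : comNzRingType) (A : nzRingType) (c : {rmorphism C -> A}).
Hypothesis c_central : forall z, central (c z).
Context (k : nat) (e : 'I_k.+1 -> A).
Hypotheses (e0 : e ord0 = 1)
  (e_span : forall a, exists h : 'I_k.+1 -> C, a = \sum_i c (h i) * e i).
Hypothesis domA : forall a b : A, a * b = 0 -> a = 0 \/ b = 0.

(** [M] is the matrix of the left multiplication by [a] on the family [e]; since the scalars are
    central, powers of [a] act through powers of [M]. *)
Lemma integral_relation (a : A) : exists q : {poly C},
  q \is monic /\ \sum_(i < size q) c q`_i * a ^+ i = 0.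
Proof.
have /choice[M' M'P] i := e_span (a * e i).
pose M : 'M[C]_k.+1 := \matrix_(i, j) M' i j.
pose ap (B : 'M[C]_k.+1) i := \sum_j c (B i j) * e j.
have apM (B : 'M[C]_k.+1) i : a * ap B i = ap (B *m M) i.
  rewrite /ap mulr_sumr.
  under eq_bigr => j _ do rewrite mulrA -c_central -mulrA M'P mulr_sumr.
  rewrite exchange_big; apply: eq_bigr => l _ /=.
  rewrite mxE rmorph_sum mulr_suml; apply: eq_bigr => j _.
  by rewrite /= rmorphM mulrA mxE.
have aX m i : a ^+ m * e i = ap (M ^+ m) i.
  elim: m => [|m IH].
    rewrite !expr0 mul1r /ap (bigD1 i) //= mxE eqxx rmorph1 mul1r big1 ?addr0 //.
    by move=> j ji; rewrite mxE eq_sym (negPf ji) rmorph0 mul0r.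
  by rewrite exprS -mulrA IH apM exprSr.
exists (char_poly M); split; first exact: char_poly_monic.
have CH := Cayley_Hamilton M; set q := char_poly M in CH *.
(* As [e ord0 = 1], row 0 of [q(M) = 0] reads [q(a) = 0]. *)
transitivity (ap (horner_mx M q) ord0); last first.
  by rewrite CH /ap big1 // => j _; rewrite mxE rmorph0 mul0r.
have -> : horner_mx M q = \sum_(i < size q) q`_i *: M ^+ i.
  rewrite -{1}[q]coefK poly_def rmorph_sum; apply: eq_bigr => i _ /=.
  by rewrite horner_mxZ rmorphXn /= horner_mx_X.
rewrite /ap.
under [RHS]eq_bigr => j _ do rewrite summxE rmorph_sum mulr_suml.
rewrite exchange_big; apply: eq_bigr => i _ /=.
transitivity (c q`_i * ap (M ^+ i) ord0).
  by rewrite -aX e0 mulr1.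
rewrite /ap mulr_sumr; apply: eq_bigr => j _.
by rewrite [in RHS]mxE rmorphM mulrA.
Qed.

(** After cancelling the largest possible power of [a] in an integral relation, the lowest remaining
    coefficient is a central multiple of [a]. *)
Lemma central_multiple (a : A) : a != 0 ->
  exists a' z, [/\ central z, z != 0 & a * a' = z].
Proof.
move=> a0; have [q [qm q0]] := integral_relation a.
(* Nonvanishing is tested in [A], after applying [c]; the leading coefficient 1 is a candidate. *)
have ex : exists i, c q`_i != 0.
  exists (size q).-1; rewrite -/(lead_coef q) (monicP qm) rmorph1; exact: oner_neq0.
case: (ex_minnP ex) => m cm mmin.
have ltm : (m < size q)%N.
  by rewrite ltnNge; apply: contra cm => le; rewrite nth_default // rmorph0.
have e1 : \sum_(m <= i < size q) c q`_i * a ^+ i = 0.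
  rewrite -[RHS]q0 -[RHS](big_mkord xpredT (fun i => c q`_i * a ^+ i)).
  rewrite (big_cat_nat (leq0n m) (ltnW ltm)) /= [X in _ = X + _]big_nat [X in _ = X + _]big1 ?add0r //.
  move=> i /andP[_ im]; suff /eqP -> : c q`_i == 0 by rewrite mul0r.
  by apply: contraTT im => /mmin; rewrite -leqNgt.
pose b := \sum_(m.+1 <= i < size q) c q`_i * a ^+ (i - m).-1.
have : a ^+ m * (c q`_m + a * b) = 0.
  rewrite -e1 big_ltn // mulrDr c_central; congr (_ + _).
  rewrite /b mulr_sumr mulr_sumr !big_nat; apply: eq_bigr => i /andP[mi _].
  rewrite !mulrA -exprSr -c_central -mulrA -exprD; congr (_ * _ ^+ _).
  by rewrite addSnnS prednK ?subn_gt0 // subnKC // ltnW.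
move/domA => [am|E].
  exfalso; elim: m am {cm mmin ltm e1 b} => [|m IH].
    by move/eqP; rewrite expr0 oner_eq0.
  by rewrite exprS => /domA[/eqP|//]; rewrite (negPf a0).
exists (- b), (c q`_m); split=> //; rewrite mulrN.
by apply/eqP; rewrite eq_sym -subr_eq0 opprK E.
Qed.

End Integral.

Section Center.
Context (F : fieldType) (n : nat) (A : algType F) (x y : 'I_n -> A).
Context (HA : is_weyl_algebra x y) (p : nat) (pF : p \in [pchar F]).
Local Notation P := {mpoly F[n + n]}.
Local Notation wgen := (wgen x y).
Local Notation nord := (nord x y).

Let xx i j : x i * x j = x j * x i. Proof. by have [[]] := HA. Qed.
Let yy i j : y i * y j = y j * y i. Proof. by have [[]] := HA. Qed.

Let pA : p%:R = 0 :> A.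
Proof. by rewrite -scaler_nat (pcharf0 pF) scale0r. Qed.

Lemma weyl_central (z : A) : (forall i, z * x i = x i * z) ->
  (forall i, z * y i = y i * z) -> central z.
Proof.
move=> zx zy; apply: (weyl_ind HA) => [a b Ha Hb|c a Ha||i a Ha|i a Ha].
- by rewrite mulrDr mulrDl Ha Hb.
- by rewrite -scalerAr -scalerAl Ha.
- by rewrite mul1r mulr1.
- by rewrite mulrA zx -mulrA Ha mulrA.
- by rewrite mulrA zy -mulrA Ha mulrA.
Qed.

(** [[y, x^l] = l x^(l-1)] and [[y^l, x] = l y^(l-1)] both vanish for [l = p]. *)
Lemma wgenp_central k : central (wgen k ^+ p).
Proof.
have yX i j l : y i * x j ^+ l = x j ^+ l * y i + ((i == j)%:R * x j ^+ l.-1) *+ l.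
  elim: l => [|l IH]; first by rewrite !expr0 mul1r mulr1 mulr0n addr0.
  rewrite exprSr mulrA IH mulrDl -mulrA (weyl_yx HA) mulrDr mulrA -!addrA; congr (_ + _).
  case: (i == j) => /=; last by rewrite !mul0r mulr0 !mul0rn mul0r addr0.
  rewrite !mul1r mulr1 mulrnAl.
  by case: l {IH} => [|l]; rewrite ?mulr0n ?addr0 // -exprSr -mulrS.
have Yx i j l : y i ^+ l * x j = x j * y i ^+ l + ((i == j)%:R * y i ^+ l.-1) *+ l.
  elim: l => [|l IH]; first by rewrite !expr0 mul1r mulr1 mulr0n addr0.
  rewrite exprS -mulrA IH mulrDr mulrA (weyl_yx HA) mulrDl -!mulrA -!addrA; congr (_ + _).
  case: (i == j) => /=; last by rewrite !mul0r !mul0rn mulr0 addr0.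
  rewrite !mul1r mulrnAr.
  by case: l {IH} => [|l]; rewrite ?mulr0n ?addr0 // -exprS -mulrS.
have pn u : u *+ p = 0 :> A by rewrite -mulr_natr pA mulr0.
have [[i ->]|[i ->]] := XlrP k; rewrite ?wgenl ?wgenr; apply: weyl_central => j.
- exact/esym/commrX/xx.
- by rewrite yX pn addr0.
- by rewrite Yx pn addr0.
- exact/esym/commrX/yy.
Qed.

(** Its image is generated by the [p]-th powers of the generators; [A] is a finite module over
    it. *)
Definition czeta : P -> A := mmap (in_alg A) (fun k => wgen k ^+ p).

Lemma czeta_monoid : monoid_morphism czeta.
Proof.
have [|| M1 M2] := @commr_mmap_is_multiplicative (n + n) F A (fun k => wgen k ^+ p) (in_alg A).
- by move=> k a; apply/esym/wgenp_central.
- by move=> q m m'; apply/commr_sym; rewrite /GRing.comm /= mulr_algl mulr_algr.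
by split.
Qed.
HB.instance Definition _ := GRing.isZmodMorphism.Build P A czeta (@mmap_is_additive _ _ _ _ _).
HB.instance Definition _ := GRing.isMonoidMorphism.Build P A czeta czeta_monoid.

Lemma czeta_central q : central (czeta q).
Proof.
move=> a; rewrite /czeta /mmap mulr_suml mulr_sumr; apply: eq_bigr => m _.
rewrite -!mulrA /= !mulr_algl -scalerAr; congr (_ *: _).
rewrite /mmap1; apply/esym; apply: commr_prod => k _; apply: commrX.
exact/esym/wgenp_central.
Qed.

Lemma weyl_central_multiple (a : A) : a != 0 ->
  exists a' z, [/\ central z, z != 0 & a * a' = z].
Proof.
pose T := {ffun 'I_(n + n) -> 'I_p}.
(* Index 0 carries the generator 1 that [central_multiple] singles out; the others are the ordered
   monomials with exponents below [p]. *)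
pose e (i : 'I_#|{: T}|.+1) : A :=
  if unlift ord0 i is Some t then nord 'X_[[multinom (enum_val t : T) k : nat | k < n + n]] else 1.
apply: (@central_multiple P A czeta czeta_central #|{: T}| e).
- by rewrite /e unlift_none.
- move=> b; rewrite -(symbK HA b); elim/mpolyind: (symb HA b) => [|c m q _ _ [h IH]].
    by exists (fun=> 0); rewrite raddf0 big1 // => i _; rewrite rmorph0 mul0r.
  have p0 : (0 < p)%N := prime_gt0 (pcharf_prime pF).
  (* Euclidean division of the exponents by [p]: the remainders select a generator, the quotients a
     central monomial. *)
  pose t : T := [ffun k => Ordinal (ltn_pmod (m k) p0)].
  pose d : 'X_{1..(n + n)} := [multinom (m k %/ p)%N | k < n + n].
  pose j := lift ord0 (enum_rank t).
  exists (fun i => (i == j)%:R * (c *: 'X_[d]) + h i).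
  under eq_bigr => i _ do rewrite rmorphD /= mulrDl.
  rewrite raddfD big_split /= IH; congr (_ + _).
  rewrite (bigD1 j) //= eqxx mul1r big1 ?addr0; last first.
    by move=> i /negPf ->; rewrite mul0r rmorph0 mul0r.
  rewrite /e /j liftK enum_rankK linearZ /= /czeta mmapZ mmapX -mulrA /= mulr_algl.
  congr (_ *: _); rewrite /nord !mmapX /mmap1.
  rewrite -prodrM_comm; last first.
    by move=> i1 i2 _ _; apply/commr_sym/commrX/esym/wgenp_central.
  apply: eq_bigr => k _; rewrite !mnmE ffunE /= -exprM -exprD.
  by rewrite mulnC -divn_eq.
- exact: (weyl_domain HA).
Qed.

End Center.

(** * Central fractions *)

Section CentralFractions.
Local Open Scope quotient_scope.
Context (F : fieldType) (A : algType F).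
Hypothesis domA : forall a b : A, a * b = 0 -> a = 0 \/ b = 0.
Hypothesis divA : forall a : A, a != 0 ->
  exists a' z, [/\ central z, z != 0 & a * a' = z].

(** With central denominators, sums and products of fractions follow the commutative formulas;
    [divA] enters with the inverses. *)
Record cden := Cden { cden_val :> A; _ : `[< central cden_val /\ cden_val != 0 >] }.
HB.instance Definition _ := [isSub for cden_val].
Local Notation dn := cden_val.
HB.instance Definition _ := [Choice of cden by <:].

Lemma cdenC (z : cden) : central (dn z).
Proof. by case: z => z /= /asboolP[]. Qed.
Lemma cden_neq0 (z : cden) : dn z != 0.
Proof. by case: z => z /= /asboolP[]. Qed.

Lemma mulzI (z : cden) (a b : A) : a * dn z = b * dn z -> a = b.
Proof.
move=> /eqP; rewrite -subr_eq0 -mulrBl => /eqP /domA[/eqP|/eqP].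
  by rewrite subr_eq0 => /eqP.
by rewrite (negPf (cden_neq0 z)).
Qed.

Lemma cden1_subproof : `[< central (1 : A) /\ (1 : A) != 0 >].
Proof. by apply/asboolP; split; [move=> a; rewrite mul1r mulr1 | exact: oner_neq0]. Qed.
Definition cden1 := Cden cden1_subproof.

Lemma cdenM_subproof (z w : cden) : `[< central (dn z * dn w) /\ dn z * dn w != 0 >].
Proof.
apply/asboolP; split; first by move=> a; rewrite -mulrA (cdenC w) mulrA (cdenC z) mulrA.
apply/eqP => /domA[] /eqP; [rewrite (negPf (cden_neq0 z))|rewrite (negPf (cden_neq0 w))] => //.
Qed.
Definition cdenM z w := Cden (cdenM_subproof z w).

Local Notation cpair := (A * cden)%type.

Definition cequiv (u v : cpair) := u.1 * dn v.2 == v.1 * dn u.2.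

Lemma cequiv_refl : reflexive cequiv. Proof. by move=> u; apply: eqxx. Qed.
Lemma cequiv_sym : ssrbool.symmetric cequiv. Proof. by move=> u v; apply: eq_sym. Qed.
Lemma cdenAC (z : cden) (a b : A) : a * dn z * b = a * b * dn z.
Proof. by rewrite -mulrA cdenC mulrA. Qed.

Lemma cequiv_trans : transitive cequiv.
Proof.
move=> v u w /eqP uv /eqP vw; apply/eqP; apply: (@mulzI v.2).
by rewrite cdenAC uv cdenAC vw cdenAC.
Qed.
Canonical cequiv_equiv := EquivRel cequiv cequiv_refl cequiv_sym cequiv_trans.

Definition cfrac := {eq_quot cequiv}.
HB.instance Definition _ : EqQuotient _ cequiv cfrac := EqQuotient.on cfrac.
HB.instance Definition _ := Choice.on cfrac.

Lemma cfracP (u v : cpair) : u.1 * dn v.2 = v.1 * dn u.2 -> \pi_cfrac u = \pi_cfrac v.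
Proof. by move=> e; apply/eqmodP/eqP. Qed.

Lemma cfrac_eq (u v : cpair) : \pi_cfrac u = \pi_cfrac v -> u.1 * dn v.2 = v.1 * dn u.2.
Proof. by move=> /eqmodP/eqP. Qed.

Lemma cfrac_repr (u : cpair) :
  u.1 * dn (repr (\pi_cfrac u)).2 = (repr (\pi_cfrac u)).1 * dn u.2.
Proof. by apply: cfrac_eq; rewrite reprK. Qed.

Definition caddp (u v : cpair) : cpair := (u.1 * dn v.2 + v.1 * dn u.2, cdenM u.2 v.2).
Definition cmulp (u v : cpair) : cpair := (u.1 * v.1, cdenM u.2 v.2).
Definition coppp (u : cpair) : cpair := (- u.1, u.2).
Definition cscalep (c : F) (u : cpair) : cpair := (c *: u.1, u.2).

Definition cadd (d e : cfrac) : cfrac := \pi_cfrac (caddp (repr d) (repr e)).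
Definition cmul (d e : cfrac) : cfrac := \pi_cfrac (cmulp (repr d) (repr e)).
Definition copp (d : cfrac) : cfrac := \pi_cfrac (coppp (repr d)).
Definition cscale c (d : cfrac) : cfrac := \pi_cfrac (cscalep c (repr d)).
Definition cemb (a : A) : cfrac := \pi_cfrac (a, cden1).

Lemma caddE u v : cadd (\pi_cfrac u) (\pi_cfrac v) = \pi_cfrac (caddp u v).
Proof.
apply: cfracP => /=; set u' := repr _; set v' := repr _.
have eu : u.1 * dn u'.2 = u'.1 * dn u.2 := cfrac_repr u.
have ev : v.1 * dn v'.2 = v'.1 * dn v.2 := cfrac_repr v.
rewrite !mulrDl !mulrA; congr (_ + _).
  by rewrite (cdenAC v'.2 _ (dn u.2)) -eu (cdenAC v.2 _ (dn u'.2)) (cdenAC v.2 _ (dn v'.2)).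
rewrite (cdenAC u.2 _ (dn v.2)) (cdenAC u'.2 _ (dn v.2)) -ev (cdenAC u.2 _ (dn u'.2)).
by rewrite (cdenAC u.2 _ (dn v'.2)) (cdenAC u'.2 _ (dn v'.2)).
Qed.

Lemma cmulE u v : cmul (\pi_cfrac u) (\pi_cfrac v) = \pi_cfrac (cmulp u v).
Proof.
apply: cfracP => /=; set u' := repr _; set v' := repr _.
have eu : u.1 * dn u'.2 = u'.1 * dn u.2 := cfrac_repr u.
have ev : v.1 * dn v'.2 = v'.1 * dn v.2 := cfrac_repr v.
rewrite !mulrA -(cdenAC u.2 u'.1) -eu (cdenAC u'.2 u.1) (cdenAC u'.2 _ (dn v.2)).
by rewrite -(mulrA u.1) -ev mulrA (cdenAC u'.2 _ (dn v'.2)).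
Qed.

Lemma coppE u : copp (\pi_cfrac u) = \pi_cfrac (coppp u).
Proof. by apply: cfracP; rewrite /= !mulNr cfrac_repr. Qed.

Lemma cscaleE c u : cscale c (\pi_cfrac u) = \pi_cfrac (cscalep c u).
Proof. by apply: cfracP; rewrite /= -!scalerAl cfrac_repr. Qed.

Lemma caddzE a b (z : cden) : cadd (\pi_cfrac (a, z)) (\pi_cfrac (b, z)) = \pi_cfrac (a + b, z).
Proof. by rewrite caddE; apply: cfracP; rewrite /= -mulrDl mulrA. Qed.

(** Common denominators reduce the additive laws to those of [A]. *)
Lemma cfrac_common (d e : cfrac) :
  exists a b z, d = \pi_cfrac (a, z) /\ e = \pi_cfrac (b, z).
Proof.
elim/quotW: d => u; elim/quotW: e => v.
exists (u.1 * dn v.2), (v.1 * dn u.2), (cdenM u.2 v.2).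
by split; apply: cfracP; rewrite /= !mulrA // cdenAC.
Qed.

Lemma cfrac_common3 (d e f : cfrac) :
  exists a b c z, [/\ d = \pi_cfrac (a, z), e = \pi_cfrac (b, z) & f = \pi_cfrac (c, z)].
Proof.
have [a [b [z [-> ->]]]] := cfrac_common d e.
elim/quotW: f => w.
exists (a * dn w.2), (b * dn w.2), (w.1 * dn z), (cdenM z w.2).
by split; apply: cfracP; rewrite /= !mulrA // cdenAC.
Qed.

Lemma caddA : associative cadd.
Proof.
move=> d e f; have [a [b [c [z [-> -> ->]]]]] := cfrac_common3 d e f.
by rewrite !caddzE addrA.
Qed.

Lemma caddC : commutative cadd.
Proof.
move=> d e; have [a [b [z [-> ->]]]] := cfrac_common d e.
by rewrite !caddzE addrC.
Qed.

Lemma cfrac0 (z : cden) : \pi_cfrac (0, z) = cemb 0.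
Proof. by apply: cfracP; rewrite /= !mul0r. Qed.

Lemma cadd0 : left_id (cemb 0) cadd.
Proof. by elim/quotW=> -[a z]; rewrite -(cfrac0 z) caddzE add0r. Qed.

Lemma caddN : left_inverse (cemb 0) copp cadd.
Proof. by elim/quotW=> -[a z]; rewrite coppE caddzE addNr cfrac0. Qed.
HB.instance Definition _ := GRing.isZmodule.Build cfrac caddA caddC cadd0 caddN.

Lemma cmulA : associative cmul.
Proof.
elim/quotW=> u; elim/quotW=> v; elim/quotW=> w.
rewrite (cmulE v w) (cmulE u v) (cmulE u) (cmulE _ w); apply: cfracP.
by rewrite /cmulp /cdenM /= !mulrA.
Qed.

Lemma cmul1l : left_id (cemb 1) cmul.
Proof. by elim/quotW=> u; rewrite cmulE; apply: cfracP; rewrite /= !mul1r. Qed.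

Lemma cmul1r : right_id (cemb 1) cmul.
Proof. by elim/quotW=> u; rewrite cmulE; apply: cfracP; rewrite /= !mulr1. Qed.

Lemma cmulDl : left_distributive cmul cadd.
Proof.
move=> d e f; have [a [b [z [-> ->]]]] := cfrac_common d e; elim/quotW: f => w.
rewrite (caddzE a b z) (cmulE (a + b, z) w) (cmulE (a, z) w) (cmulE (b, z) w).
by rewrite /cmulp /= caddzE mulrDl.
Qed.

Lemma cmulDr : right_distributive cmul cadd.
Proof.
move=> f d e; have [a [b [z [-> ->]]]] := cfrac_common d e; elim/quotW: f => w.
rewrite (caddzE a b z) (cmulE w (a + b, z)) (cmulE w (a, z)) (cmulE w (b, z)).
by rewrite /cmulp /= caddzE mulrDr.
Qed.

Lemma cemb_inj : injective cemb.
Proof. by move=> a b /cfrac_eq; rewrite /= !mulr1. Qed.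

Lemma cone_neq0 : cemb 1 != cemb 0.
Proof. by apply/eqP => /cemb_inj/eqP; rewrite oner_eq0. Qed.
HB.instance Definition _ := GRing.Zmodule_isNzRing.Build cfrac
  cmulA cmul1l cmul1r cmulDl cmulDr cone_neq0.

Lemma cscaleA c d f : cscale c (cscale d f) = cscale (c * d) f.
Proof. by elim/quotW: f => u; rewrite (cscaleE d u) (cscaleE c) (cscaleE (c * d)) /cscalep scalerA. Qed.
Lemma cscale1 : left_id 1 cscale.
Proof. by elim/quotW=> -[a z]; rewrite cscaleE /cscalep scale1r. Qed.
Lemma cscaleDr : right_distributive cscale +%R.
Proof.
move=> c d e; have [a [b [z [-> ->]]]] := cfrac_common d e.
rewrite [X in cscale _ X](caddzE a b z) (cscaleE c (a, z)) (cscaleE c (b, z)) (cscaleE c (a + b, z)).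
by rewrite /cscalep /= scalerDr [RHS]caddzE.
Qed.
Lemma cscaleDl f : {morph cscale^~ f : c d / c + d}.
Proof.
move=> c d; elim/quotW: f => -[a z].
rewrite (cscaleE c) (cscaleE d) (cscaleE (c + d)) /cscalep /= scalerDl.
by rewrite [RHS]caddzE.
Qed.
HB.instance Definition _ := GRing.Zmodule_isLmodule.Build F cfrac
  cscaleA cscale1 cscaleDr cscaleDl.

Lemma cscaleAl (c : F) (d e : cfrac) : c *: (d * e) = c *: d * e.
Proof.
elim/quotW: d => u; elim/quotW: e => v.
rewrite [X in _ *: X](cmulE u v) [LHS](cscaleE c) [X in X * _](cscaleE c u).
by rewrite [RHS]cmulE /cscalep /cmulp /= scalerAl.
Qed.
HB.instance Definition _ := GRing.Lmodule_isLalgebra.Build F cfrac cscaleAl.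
Lemma cscaleAr (c : F) (d e : cfrac) : c *: (d * e) = d * (c *: e).
Proof.
elim/quotW: d => u; elim/quotW: e => v.
rewrite [X in _ *: X](cmulE u v) [LHS](cscaleE c) [X in _ * X](cscaleE c v).
by rewrite [RHS]cmulE /cscalep /cmulp /= scalerAr.
Qed.
HB.instance Definition _ := GRing.Lalgebra_isAlgebra.Build F cfrac cscaleAr.

Lemma cfrac_inv_exists (d : cfrac) : d != 0 -> exists e, e * d = 1 /\ d * e = 1.
Proof.
elim/quotW: d => -[a z] d0; have a0 : a != 0.
  by apply: contraNneq d0 => ->; rewrite cfrac0.
have [a' [w [wC w0 aa']]] := divA a0.
(* [a * (a' * a - w) = 0] because [w] is central, so [a'] is a left inverse up to [w] as well. *)
have a'a : a' * a = w.
  have : a * (a' * a - w) = 0 by rewrite mulrBr mulrA aa' wC subrr.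
  by case/domA => /eqP; rewrite ?(negPf a0) // subr_eq0 => /eqP.
have wP : `[< central w /\ w != 0 >] by apply/asboolP.
exists (\pi_cfrac (a' * dn z, Cden wP)); split.
  by rewrite [LHS]cmulE; apply: cfracP; rewrite /= mulr1 mul1r cdenAC a'a.
by rewrite [LHS]cmulE; apply: cfracP; rewrite /= mulr1 mul1r mulrA aa' wC.
Qed.

Definition cinv (d : cfrac) : cfrac :=
  if pselect (d != 0) is left d0 then sval (cid (cfrac_inv_exists d0)) else d.

Definition cunit : pred cfrac := fun d => d != 0.

Lemma cmulVr : {in cunit, left_inverse 1 cinv *%R}.
Proof. by move=> d d0; rewrite /cinv; case: pselect => // d1; case: cid => e []. Qed.
Lemma cmulrV : {in cunit, right_inverse 1 cinv *%R}.
Proof. by move=> d d0; rewrite /cinv; case: pselect => // d1; case: cid => e []. Qed.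
Lemma cunitP (d e : cfrac) : e * d = 1 /\ d * e = 1 -> cunit d.
Proof.
by case=> ed _; apply/eqP => d0; move/eqP: ed; rewrite d0 mulr0 eq_sym oner_eq0.
Qed.
Lemma cinv_out : {in [predC cunit], cinv =1 id}.
Proof.
by move=> d; rewrite inE => d0; rewrite /cinv; case: pselect => // d1; rewrite /in_mem /= /cunit d1 in d0.
Qed.
HB.instance Definition _ := GRing.NzRing_hasMulInverse.Build cfrac
  cmulVr cmulrV cunitP cinv_out.

Lemma cemb_hom : is_alg_hom cemb.
Proof.
split=> // [a b|a b|c a].
- by rewrite [RHS]caddzE.
- by rewrite [RHS]cmulE; apply: cfracP; rewrite /= !mulr1.
- by rewrite [RHS]cscaleE.
Qed.

Lemma cfracE (d : cfrac) : exists a z, [/\ central z, z != 0 & d = cemb a * (cemb z)^-1].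
Proof.
elim/quotW: d => -[a z]; exists a, (dn z); split; [exact: cdenC|exact: cden_neq0|].
have z0 : cemb (dn z) != 0.
  by apply/eqP => /cemb_inj /eqP; rewrite (negPf (cden_neq0 z)).
apply: (canRL (mulrK (z0 : cemb (dn z) \is a GRing.unit))).
rewrite [LHS]cmulE; apply: cfracP => /=; by rewrite !mulr1.
Qed.

(** These four properties are all that is used of the fractions from here on. *)
Lemma central_fractions : exists (D : unitAlgType F) (emb : A -> D),
  [/\ is_alg_hom emb, injective emb, forall d : D, d != 0 -> d \is a GRing.unit
    & forall d : D, exists a z, [/\ central z, z != 0 & d = emb a * (emb z)^-1]].
Proof.
exists cfrac, cemb; split=> //; [exact: cemb_hom|exact: cemb_inj|exact: cfracE].
Qed.

End CentralFractions.

(** * Algebra homomorphisms given as predicates *)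

Section AlgHom.
Context (F : fieldType).

Section Basics.
Context (A B : algType F) (f : A -> B) (Hf : is_alg_hom f).
Lemma homD : {morph f : u v / u + v}. Proof. by case: Hf. Qed.
Lemma homM : {morph f : u v / u * v}. Proof. by case: Hf. Qed.
Lemma hom1 : f 1 = 1. Proof. by case: Hf. Qed.
Lemma homZ c u : f (c *: u) = c *: f u. Proof. by case: Hf => _ _ _; apply. Qed.
Lemma hom0 : f 0 = 0. Proof. by rewrite -(scale0r 1) homZ scale0r. Qed.
Lemma homN u : f (- u) = - f u. Proof. by rewrite -scaleN1r homZ scaleN1r. Qed.
Lemma homB u v : f (u - v) = f u - f v. Proof. by rewrite homD homN. Qed.
Lemma hom_sum (I : Type) (r : seq I) (P : pred I) (h : I -> A) :
  f (\sum_(i <- r | P i) h i) = \sum_(i <- r | P i) f (h i).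
Proof. exact: (big_morph f homD hom0). Qed.
Lemma hom_prod (I : Type) (r : seq I) (P : pred I) (h : I -> A) :
  f (\prod_(i <- r | P i) h i) = \prod_(i <- r | P i) f (h i).
Proof. exact: (big_morph f homM hom1). Qed.
Lemma hom_nat k : f k%:R = k%:R.
Proof. by elim: k => [|k IH]; rewrite ?hom0 // mulrS homD hom1 IH -mulrS. Qed.
End Basics.

Lemma hom_id (A : algType F) : is_alg_hom (@id A). Proof. by []. Qed.

Lemma hom_comp (A B C : algType F) (g : B -> C) (f : A -> B) :
  is_alg_hom g -> is_alg_hom f -> is_alg_hom (fun a => g (f a)).
Proof.
move=> Hg Hf; split=> [u v|u v||c u].
- by rewrite (homD Hf) (homD Hg).
- by rewrite (homM Hf) (homM Hg).
- by rewrite (hom1 Hf) (hom1 Hg).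
- by rewrite (homZ Hf) (homZ Hg).
Qed.

Lemma homV (D E : unitAlgType F) (t : D -> E) (Ht : is_alg_hom t) (d : D) :
  d \is a GRing.unit -> t d \is a GRing.unit /\ t d^-1 = (t d)^-1.
Proof.
move=> du; have e1 : t d^-1 * t d = 1 by rewrite -(homM Ht) mulVr // (hom1 Ht).
have e2 : t d * t d^-1 = 1 by rewrite -(homM Ht) divrr // (hom1 Ht).
have u : t d \is a GRing.unit by apply/unitrP; exists (t d^-1).
by split=> //; apply: (mulrI u); rewrite e2 divrr.
Qed.

End AlgHom.

(** * Extending automorphisms to the fractions *)

Section FractionExtension.
Context (F : fieldType) (A : algType F) (D : unitAlgType F) (emb : A -> D).
Hypotheses (Hemb : is_alg_hom emb) (emb_inj : injective emb).
Hypothesis Ddiv : forall d : D, d != 0 -> d \is a GRing.unit.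
Hypothesis Dfrac : forall d : D,
  exists a z, [/\ central z, z != 0 & d = emb a * (emb z)^-1].

Lemma emb_unit a : a != 0 -> emb a \is a GRing.unit.
Proof.
move=> a0; apply: Ddiv; apply: contra a0 => /eqP e.
by apply/eqP/emb_inj; rewrite e (hom0 Hemb).
Qed.

Lemma frac_hom_ext (E : unitAlgType F) (t1 t2 : D -> E) :
  is_alg_hom t1 -> is_alg_hom t2 -> (forall a, t1 (emb a) = t2 (emb a)) -> t1 =1 t2.
Proof.
move=> H1 H2 e d; have [a [z [_ z0 ->]]] := Dfrac d.
have zu := emb_unit z0; rewrite (homM H1) (homM H2) (homV H1 zu).2 (homV H2 zu).2.
by rewrite !e.
Qed.

Lemma emb_central z (d : D) : central z -> emb z * d = d * emb z.
Proof.
move=> zC; have [a [w [wC w0 ->]]] := Dfrac d; have wu := emb_unit w0.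
have zw : GRing.comm (emb z) (emb w) by rewrite /GRing.comm -!(homM Hemb) zC.
by rewrite mulrA -(homM Hemb) zC (homM Hemb) -!mulrA [emb z * _]commrV.
Qed.

(** An automorphism preserves nonzero central elements, hence the admissible denominators. *)
Lemma hom_extend (s s' : A -> A) : is_alg_hom s -> is_alg_hom s' ->
  cancel s s' -> cancel s' s ->
  exists t : D -> D, is_alg_hom t /\ forall a, t (emb a) = emb (s a).
Proof.
move=> Hs Hs' ss' s's.
have sC z : central z -> central (s z).
  by move=> zC a; rewrite -[a]s's -!(homM Hs) zC.
have s0 z : z != 0 -> s z != 0.
  by apply: contra => /eqP e; rewrite -[z]ss' e (hom0 Hs').
(* The graph of the extension. It is shown to be total, single-valued and compatible with the
   operations, and a function is then chosen in it. *)
pose rel (d v : D) := exists a z,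
  [/\ central z, z != 0, d * emb z = emb a & v * emb (s z) = emb (s a)].
have ACl z u v : central z -> u * emb z * v = u * v * emb z.
  by move=> zC; rewrite -mulrA emb_central // mulrA.
have zM (z w : A) : central z -> central w -> central (z * w).
  by move=> zC wC a; rewrite -mulrA wC mulrA zC mulrA.
have z0M (z w : A) : z != 0 -> w != 0 -> z * w != 0.
  move=> z0 w0; apply/eqP => /(congr1 emb); rewrite (homM Hemb) (hom0 Hemb).
  rewrite -(mul0r (emb w)) => /(mulIr (emb_unit w0)) ez.
  by have := emb_unit z0; rewrite ez unitr0.
have rel_fun d v v' : rel d v -> rel d v' -> v = v'.
  move=> [a [z [zC z0 dz vz]]] [b [w [wC w0 dw vw]]].
  apply: (mulIr (emb_unit (s0 _ z0))); apply: (mulIr (emb_unit (s0 _ w0))).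
  rewrite vz (ACl (s z)) ?vw; last exact: sC.
  rewrite -!(homM Hemb) -!(homM Hs); congr (emb (s _)); apply: emb_inj.
  by rewrite !(homM Hemb) -dz -dw ACl.
have rel_ex d : exists v, rel d v.
  have [a [z [zC z0 ->]]] := Dfrac d; exists (emb (s a) * (emb (s z))^-1).
  by exists a, z; split=> //; rewrite mulrVK ?emb_unit ?s0.
have relD d e v w : rel d v -> rel e w -> rel (d + e) (v + w).
  move=> [a [z [zC z0 dz vz]]] [b [z' [zC' z0' ez wz]]].
  exists (a * z' + b * z), (z * z'); split; [exact: zM|exact: z0M| |].
    by rewrite (homD Hemb) !(homM Hemb) mulrDl !mulrA dz ACl // ez.
  rewrite (homD Hs) (homD Hemb) !(homM Hs) !(homM Hemb) mulrDl !mulrA vz.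
  by rewrite ACl ?wz //; exact: sC.
have relM d e v w : rel d v -> rel e w -> rel (d * e) (v * w).
  move=> [a [z [zC z0 dz vz]]] [b [z' [zC' z0' ez wz]]].
  exists (a * b), (z * z'); split; [exact: zM|exact: z0M| |].
    by rewrite !(homM Hemb) !mulrA -(ACl z) // dz -mulrA ez.
  rewrite !(homM Hs) !(homM Hemb) !mulrA -(ACl (s z)) ?vz; last exact: sC.
  by rewrite -mulrA wz.
have relZ c d v : rel d v -> rel (c *: d) (c *: v).
  move=> [a [z [zC z0 dz vz]]]; exists (c *: a), z.
  by rewrite (homZ Hs) !(homZ Hemb) -!scalerAl dz vz.
have rel_emb a : rel (emb a) (emb (s a)).
  exists a, 1; split; rewrite ?(hom1 Hs) ?(hom1 Hemb) ?mulr1 ?oner_neq0 //.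
  by move=> b; rewrite mul1r mulr1.
have /choice[t tP] := rel_ex.
exists t; split; last by move=> a; apply: (rel_fun _ _ _ (tP _)).
split=> [d e|d e||c d]; apply: (rel_fun _ _ _ (tP _)).
- exact: relD.
- exact: relM.
- by have := rel_emb 1; rewrite (hom1 Hs) (hom1 Hemb).
- exact: relZ.
Qed.

End FractionExtension.

(** * Automorphisms of the Weyl algebra *)

Section Shift.
Context (F : closedFieldType) (n : nat).
Local Notation S := {mpoly F[n]}.
Local Notation P := {mpoly F[n + n]}.
Local Notation Xl i := ('X_(lshift n i) : P).
Local Notation Xr i := ('X_(rshift n i) : P).

(* In [P = F[x, t]] the first [n] variables are the [x_i], the last [n] the [t_i]. *)
Definition rsub (u : 'I_n -> P) (q : P) : P :=
  q \mPo [tuple match split k with inl i => Xl i | inr i => u i end | k < n + n].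

Lemma rsubM u p q : rsub u (p * q) = rsub u p * rsub u q.
Proof. exact: rmorphM. Qed.
Lemma rsubD u p q : rsub u (p + q) = rsub u p + rsub u q.
Proof. exact: comp_mpolyD. Qed.
Lemma rsubZ u c q : rsub u (c *: q) = c *: rsub u q.
Proof. exact: comp_mpolyZ. Qed.
Lemma rsub1 u : rsub u 1 = 1. Proof. exact: comp_mpoly1. Qed.
Lemma rsubC u c : rsub u c%:MP = c%:MP. Proof. exact: comp_mpolyC. Qed.
Lemma rsubl u i : rsub u (Xl i) = Xl i.
Proof.
by rewrite /rsub comp_mpolyXU -tnth_nth tnth_mktuple -[lshift n i]/(unsplit (inl i)) unsplitK.
Qed.
Lemma rsubr u i : rsub u (Xr i) = u i.
Proof.
by rewrite /rsub comp_mpolyXU -tnth_nth tnth_mktuple -[rshift n i]/(unsplit (inr i)) unsplitK.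
Qed.

Lemma rsub_comp u v q : rsub u (rsub v q) = rsub (fun i => rsub u (v i)) q.
Proof.
elim/mpoly_ringind: q => [c|k|p q Hp Hq|p q Hp Hq].
- by rewrite !rsubC.
- by have [[i ->]|[i ->]] := XlrP k; rewrite ?rsubl ?rsubr ?rsubl.
- by rewrite !rsubD Hp Hq.
- by rewrite !rsubM Hp Hq.
Qed.

Lemma rsub_id q : rsub (fun i => Xr i) q = q.
Proof.
elim/mpoly_ringind: q => [c|k|p q Hp Hq|p q Hp Hq].
- by rewrite rsubC.
- by have [[i ->]|[i ->]] := XlrP k; rewrite ?rsubl ?rsubr.
- by rewrite rsubD Hp Hq.
- by rewrite rsubM Hp Hq.
Qed.

Definition shift (c : 'I_n -> F) := rsub (fun i => Xr i + (c i)%:MP).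

(** A translation leaves the part of top degree unchanged; this drives the descent on the degree in
    [j_inj]. *)
Lemma msize_shift c q : (msize (shift c q - q) <= (msize q).-1)%N.
Proof.
have lowD k (p r : P) : (msize p <= k -> msize r <= k -> msize (p + r) <= k)%N.
  by move=> Hp Hr; apply: leq_trans (msizeD_le _ _) _; rewrite geq_max Hp Hr.
have lowX (k : 'I_(n + n)) e (r : P) : (msize r <= e -> msize ('X_k * r) <= e.+1)%N.
  have [->|r0] := eqVneq r 0; first by rewrite mulr0 msize0.
  have X0 : ('X_k : P) != 0 by rewrite -msize_poly_eq0 msizeX.
  by rewrite msizeM // msizeX mdeg1 add2n.
have word (w : seq 'I_(n + n)) : (msize (shift c (\prod_(k <- w) 'X_k)
    - \prod_(k <- w) 'X_k) <= size w)%N.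
  elim: w => [|k w IH]; first by rewrite !big_nil /shift rsub1 subrr msize0.
  rewrite !big_cons; set W := \prod_(j <- w) 'X_j in IH *.
  rewrite [shift c (_ * _)]rsubM -/(shift c W).
  have lowW : (msize W <= (size w).+1)%N.
    rewrite /W; elim: w {IH W} => [|j w IHw]; first by rewrite big_nil msize1.
    by rewrite big_cons; apply: lowX.
  have lowS : (msize (shift c W) <= (size w).+1)%N.
    by rewrite -[shift c W](subrK W); apply: lowD => //; apply: leq_trans IH _.
  have [[i ->]|[i ->]] := XlrP k; first by rewrite rsubl -mulrBr; apply: lowX.
  rewrite rsubr mulrDl addrAC -mulrBr; apply: lowD; first exact: lowX.
  by rewrite mul_mpolyC; apply: leq_trans (msizeZ_le _ _) _.
rewrite {1 2}[q]mpolyE /shift /rsub raddf_sum -sumrB.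
apply: leq_trans (msize_sum _ _ _) _; apply/bigmax_leqP_seq => m mq _ /=.
rewrite comp_mpolyZ -scalerBr; apply: leq_trans (msizeZ_le _ _) _.
rewrite -{1 2}(s2mK m) Xs2m; apply: leq_trans (word _) _.
by rewrite size_m2s; move/msize_mdeg_lt: mq; case: (msize q).
Qed.

(** As [F] is infinite, a polynomial invariant under all constant translations of the [t_i] does not
    involve them. *)
Lemma shift_invariant q : (forall c, shift c q = q) -> rsub (fun=> 0) q = q.
Proof.
move=> inv.
have ev1 j : rsub (fun i => if i == j then 0 else Xr i) q = q.
  (* [Phi] substitutes [t_j + T] for [t_j], with a new variable [T]. The difference [Phi q - q]
     vanishes at every constant [T = a], so it is zero. *)
  pose h (k : 'I_(n + n)) : {poly P} :=
    match split k with inl i => (Xl i)%:P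
    | inr i => (Xr i)%:P + (if i == j then 'X else 0) end.
  pose Phi : P -> {poly P} := mmap (polyC \o @mpolyC (n + n) F) h.
  have hl i : h (lshift n i) = (Xl i)%:P.
    by rewrite /h -[lshift n i]/(unsplit (inl i)) unsplitK.
  have hr i : h (rshift n i) = (Xr i)%:P + (if i == j then 'X else 0).
    by rewrite /h -[rshift n i]/(unsplit (inr i)) unsplitK.
  have PhiD p r : Phi (p + r) = Phi p + Phi r by exact: mmapD.
  have PhiM p r : Phi (p * r) = Phi p * Phi r by exact: rmorphM.
  have PhiC a : Phi a%:MP = (a%:MP)%:P by exact: mmapC.
  have PhiX k : Phi 'X_k = h k by rewrite /Phi mmapX mmap1U.
  clearbody Phi.
  have PhiE (u r : P) : (Phi r).[u] = rsub (fun i => Xr i + (if i == j then u else 0)) r.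
    elim/mpoly_ringind: r => [a|k|p r Hp Hr|p r Hp Hr].
    - by rewrite PhiC rsubC hornerC.
    - rewrite PhiX.
      have [[i ->]|[i ->]] := XlrP k; rewrite ?hl ?hr ?rsubl ?rsubr ?hornerE //.
      by case: eqP; rewrite ?hornerE.
    - by rewrite PhiD hornerD Hp Hr rsubD.
    - by rewrite PhiM hornerM Hp Hr rsubM.
  have roots (a : F) : root (Phi q - q%:P) (a%:MP : P).
    rewrite /root hornerD hornerN hornerC PhiE subr_eq0 -[X in _ == X](inv (fun i => if i == j then a else 0)).
    apply/eqP; congr (rsub _ q); apply/funext => i; congr (_ + _).
    by case: eqP.
  have Phi0 : Phi q - q%:P = 0.
    apply/eqP/negP => /negP P0.
    have [s ss us] := closed_field_uniq_seq F (size (Phi q - q%:P)).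
    have := @max_poly_roots _ _ [seq (a%:MP : P) | a <- s] P0.
    rewrite size_map ss ltnn => H; suff : false by []; apply: H.
      by apply/allP => _ /mapP[a _ ->]; apply: roots.
    rewrite map_inj_uniq //; exact: (can_inj (@mpolyCK (n + n) F)).
  (* Evaluating at [T = - t_j] replaces [t_j] by 0. *)
  have /eqP := PhiE (- Xr j) q; move/eqP: Phi0; rewrite subr_eq0 => /eqP ->.
  rewrite hornerC => /eqP e; rewrite [RHS]e; congr (rsub _ q); apply/funext => i.
  by case: eqP => [->|_]; rewrite ?subrr ?addr0.
have evs (s : seq 'I_n) : rsub (fun i => if i \in s then 0 else Xr i) q = q.
  elim: s => [|j s IH]; first exact: rsub_id.
  rewrite -[RHS]IH -{2}(ev1 j) rsub_comp; congr (rsub _ q); apply/funext => i.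
  by rewrite inE; case: eqP => _ /=; rewrite ?rsubr // -(mpolyC0 (n + n) F) rsubC.
rewrite -{2}(evs (enum 'I_n)); congr (rsub _ q); apply/funext => i.
by rewrite mem_enum.
Qed.

Definition xlift (q : S) : P := q \mPo [tuple Xl i | i < n].
Definition xret (q : P) : S :=
  q \mPo [tuple match split k with inl i => 'X_i | inr i => 0 end | k < n + n].

Lemma xliftX i : xlift 'X_i = Xl i.
Proof. by rewrite /xlift comp_mpolyXU -tnth_nth tnth_mktuple. Qed.
Lemma xretl i : xret (Xl i) = 'X_i.
Proof.
by rewrite /xret comp_mpolyXU -tnth_nth tnth_mktuple -[lshift n i]/(unsplit (inl i)) unsplitK.
Qed.
Lemma xretr i : xret (Xr i) = 0.
Proof.
by rewrite /xret comp_mpolyXU -tnth_nth tnth_mktuple -[rshift n i]/(unsplit (inr i)) unsplitK.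
Qed.

Lemma xliftK : cancel xlift xret.
Proof.
move=> q; elim/mpoly_ringind: q => [c|k|p q Hp Hq|p q Hp Hq].
- by rewrite /xlift comp_mpolyC /xret comp_mpolyC.
- by rewrite xliftX xretl.
- by rewrite /xlift comp_mpolyD /xret comp_mpolyD; congr (_ + _).
- by rewrite /xlift rmorphM /xret rmorphM; congr (_ * _).
Qed.

Lemma xretK q : xlift (xret q) = rsub (fun=> 0) q.
Proof.
elim/mpoly_ringind: q => [c|k|p q Hp Hq|p q Hp Hq].
- by rewrite rsubC /xret comp_mpolyC /xlift comp_mpolyC.
- have [[i ->]|[i ->]] := XlrP k; first by rewrite xretl xliftX rsubl.
  by rewrite xretr rsubr /xlift comp_mpoly0.
- by rewrite rsubD -Hp -Hq /xret /xlift !comp_mpolyD.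
- by rewrite rsubM -Hp -Hq /xret /xlift !rmorphM.
Qed.

End Shift.

(** * Linear substitutions and translations of the Weyl algebra *)

Section WeylHoms.
Context (F : closedFieldType) (n : nat) (A : algType F) (x y : 'I_n -> A).
Context (HA : is_weyl_algebra x y).
Local Notation S := {mpoly F[n]}.

Let xx i j : x i * x j = x j * x i. Proof. by have [[]] := HA. Qed.
Let yy i j : y i * y j = y j * y i. Proof. by have [[]] := HA. Qed.

Lemma weyl_hom (B : algType F) (x' y' : 'I_n -> B) : weyl_relations x' y' ->
  exists f : A -> B, [/\ is_alg_hom f, forall i, f (x i) = x' i & forall i, f (y i) = y' i].
Proof.
have [_ univ] := HA; move=> /univ[[f [Hf fxy]] _].
by exists f; split=> // i; have [] := fxy i.
Qed.

Lemma weyl_hom_ext (B : algType F) (f g : A -> B) : is_alg_hom f -> is_alg_hom g ->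
  (forall i, f (x i) = g (x i)) -> (forall i, f (y i) = g (y i)) -> f =1 g.
Proof.
move=> Hf Hg fx fy; apply: (weyl_ind HA) => [a b Ha Hb|c a Ha||i a Ha|i a Ha].
- by rewrite (homD Hf) (homD Hg) Ha Hb.
- by rewrite (homZ Hf) (homZ Hg) Ha.
- by rewrite (hom1 Hf) (hom1 Hg).
- by rewrite (homM Hf) (homM Hg) Ha fx.
- by rewrite (homM Hf) (homM Hg) Ha fy.
Qed.

Local Notation kap := (kappa x).

Lemma kap_mul p q : kap (p * q) = kap p * kap q. Proof. exact: kappaM. Qed.

Lemma kap_ydiff i q : y i * kap q = kap q * y i + kap q^`M(i).
Proof.
elim/mpoly_genind: q => [p q Hp Hq|c p Hp||j p Hp].
- by rewrite !raddfD /= mulrDr mulrDl Hp Hq addrACA.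
- by rewrite !linearZ /= -scalerAr -scalerAl Hp scalerDr.
- by rewrite kappa1 mul1r mulr1 -mpolyC1 mderivC raddf0 addr0.
- rewrite mderivM mderivXU raddfD /= !kap_mul kappaX mulrA (weyl_yx HA) mulrDl.
  rewrite -[X in X + _]mulrA Hp mulrDr !mulrA -!addrA; congr (_ + _).
  rewrite addrC; congr (_ + _).
  by case: eqP => _; rewrite ?kappa1 ?raddf0.
Qed.

Lemma kap_nord q : kap q = nord x y (xlift q).
Proof.
elim/mpoly_genind: q => [p q Hp Hq|c p Hp||i p Hp].
- by rewrite /xlift comp_mpolyD !raddfD /= Hp Hq.
- by rewrite /xlift comp_mpolyZ !linearZ /= Hp.
- by rewrite kappa1 /xlift comp_mpoly1 nord1.
- have -> : xlift ('X_i * p) = xlift 'X_i * xlift p by exact: rmorphM.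
  by rewrite kap_mul kappaX Hp xliftX (nordXl HA).
Qed.

Lemma kap_inj : injective kap.
Proof.
move=> p q; rewrite !kap_nord => /(can_inj (nordK HA)) /(can_inj (@xliftK F n)).
by [].
Qed.

Lemma linear_comm (m : nat) (a b : 'I_m -> F) (u v : 'I_m -> A) :
  (forall i j, u i * v j = v j * u i) ->
  (\sum_i a i *: u i) * (\sum_j b j *: v j) = (\sum_j b j *: v j) * (\sum_i a i *: u i).
Proof.
move=> uv; rewrite mulr_suml mulr_sumr; apply: eq_bigr => i _.
rewrite mulr_sumr mulr_suml; apply: eq_bigr => j _.
by rewrite -!scalerAl -!scalerAr uv !scalerA mulrC.
Qed.

(** The counterpart of [weyl_alg_action] with entries already in [F]. *)
Definition matrix_hom (w v : 'M[F]_n) (s : A -> A) :=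
  [/\ is_alg_hom s, forall j, s (x j) = \sum_i w i j *: x i
    & forall j, s (y j) = \sum_k v j k *: y k].

(** The commutator of the images of [y_i] and [x_j] is the entry [(i, j)] of [v *m w]. *)
Lemma matrix_hom_exists (w v : 'M[F]_n) : v *m w = 1%:M -> exists s, matrix_hom w v s.
Proof.
move=> vw; apply: weyl_hom; split=> i j; try exact: linear_comm.
rewrite mulr_suml mulr_sumr -sumrB.
transitivity (\sum_k (v i k * w k j) *: (1 : A)).
  apply: eq_bigr => k _; rewrite mulr_sumr mulr_suml -sumrB (bigD1 k) //= big1 ?addr0.
    rewrite -!scalerAl -!scalerAr !scalerA [w k j * _]mulrC -scalerBr (weyl_yx HA) eqxx.
    by rewrite addrC addKr.
  move=> l lk; rewrite -!scalerAl -!scalerAr !scalerA [w l j * _]mulrC -scalerBr (weyl_yx HA).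
  by rewrite eq_sym (negPf lk) addr0 subrr scaler0.
rewrite -scaler_suml; have /matrixP/(_ i j) := vw; rewrite !mxE => ->.
by case: eqP => _; rewrite ?scale1r ?scale0r.
Qed.

Lemma matrix_homK (w v : 'M[F]_n) s s' : v *m w = 1%:M ->
  matrix_hom w v s -> matrix_hom v w s' -> cancel s s'.
Proof.
move=> vw [Hs sx sy] [Hs' s'x s'y]; have wv := mulmx1C vw.
have H := hom_comp Hs' Hs.
have e (u : 'I_n -> A) (a b : 'M[F]_n) : a *m b = 1%:M -> forall j,
    \sum_i b i j *: (\sum_k a k i *: u k) = u j.
  move=> ab j; under eq_bigr => i _ do rewrite scaler_sumr.
  rewrite exchange_big /=; under eq_bigr => k _.
    under eq_bigr => i _ do rewrite scalerA mulrC.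
    rewrite -scaler_suml; have /matrixP/(_ k j) := ab; rewrite !mxE => ->.
    over.
  rewrite (bigD1 j) //= eqxx scale1r big1 ?addr0 // => k kj.
  by rewrite (negPf kj) scale0r.
move=> a; apply: (weyl_hom_ext H (@hom_id _ A)) => j.
  rewrite sx (hom_sum Hs') -[RHS](e x v w vw j).
  by apply: eq_bigr => i _; rewrite (homZ Hs') s'x.
rewrite sy (hom_sum Hs').
transitivity (\sum_i v^T i j *: (\sum_k w^T k i *: y k)).
  apply: eq_bigr => i _; rewrite (homZ Hs') s'y mxE; congr (_ *: _).
  by apply: eq_bigr => k _; rewrite mxE.
by apply: e; rewrite -trmx_mul vw trmx1.
Qed.

Lemma matrix_hom_kap w v s q : matrix_hom w v s -> s (kap q) = kap (act w q).
Proof.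
move=> [Hs sx _]; elim/mpoly_genind: q => [p q Hp Hq|c p Hp||i p Hp].
- by rewrite !raddfD /= (homD Hs) Hp Hq.
- by rewrite !linearZ /= (homZ Hs) Hp.
- by rewrite rmorph1 kappa1 (hom1 Hs).
- rewrite rmorphM /= !kap_mul (homM Hs) Hp kappaX sx actX /linform.
  congr (_ * _); rewrite linear_sum; apply: eq_bigr => k _.
  by rewrite linearZ /= kappaX.
Qed.

Definition transl_hom (a : 'I_n -> S) (s : A -> A) :=
  [/\ is_alg_hom s, forall j, s (x j) = x j & forall j, s (y j) = y j + kap (a j)].

(** The commutator of the images of [y_i] and [y_j] is the difference of the two mixed derivatives:
    the [a i] must be the components of a closed form, such as a gradient. *)
Lemma transl_hom_exists (a : 'I_n -> S) :
  (forall i j, (a j)^`M(i) = (a i)^`M(j)) -> exists s, transl_hom a s.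
Proof.
move=> ac; apply: weyl_hom; split=> i j; first exact: xx.
  rewrite !mulrDl !mulrDr !kap_ydiff yy ac -!kap_mul [a j * _]mulrC -!addrA.
  by congr (_ + _); rewrite addrCA !addrA; congr (_ + _); rewrite addrC addrA.
have ax : kap (a i) * x j = x j * kap (a i) by rewrite -(kappaX x j) -!kap_mul mulrC.
by rewrite mulrDl mulrDr opprD addrACA ax subrr addr0 (weyl_yx HA) addrC addKr.
Qed.

Lemma transl_hom_kap a s q : transl_hom a s -> s (kap q) = kap q.
Proof.
move=> [Hs sx _]; elim/mpoly_genind: q => [p q Hp Hq|c p Hp||i p Hp].
- by rewrite !raddfD /= (homD Hs) Hp Hq.
- by rewrite !linearZ /= (homZ Hs) Hp.
- by rewrite kappa1 (hom1 Hs).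
- by rewrite !kap_mul (homM Hs) Hp kappaX sx.
Qed.

Lemma transl_homK a s s' :
  transl_hom a s -> transl_hom (fun i => - a i) s' -> cancel s s'.
Proof.
move=> Ts Ts'; have [Hs sx sy] := Ts; have [Hs' s'x s'y] := Ts'.
move=> b; apply: (weyl_hom_ext (hom_comp Hs' Hs) (@hom_id _ A)) => j.
  by rewrite sx s'x.
by rewrite sy (homD Hs') s'y (transl_hom_kap _ Ts') raddfN subrK.
Qed.

Lemma transl_nord (c : 'I_n -> F) s q : transl_hom (fun i => (c i)%:MP) s ->
  s (nord x y q) = nord x y (shift c q).
Proof.
move=> [Hs sx sy]; elim/mpoly_genind: q => [p q Hp Hq|a p Hp||k p Hp].
- by rewrite /shift rsubD !raddfD /= (homD Hs) Hp Hq.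
- by rewrite /shift rsubZ !linearZ /= (homZ Hs) Hp.
- by rewrite /shift rsub1 nord1 (hom1 Hs).
- have [[i ->]|[i ->]] := XlrP k; rewrite /shift rsubM ?rsubl ?rsubr.
    by rewrite !(nordXl HA) (homM Hs) sx Hp.
  rewrite mulrDl raddfD /= !(nordXr HA) (homM Hs) sy Hp mulrDr; congr (_ + _).
  by rewrite mul_mpolyC linearZ /= kappaC mulr_algr.
Qed.

End WeylHoms.

(** * The Weyl algebra inside the invariant fractions *)

Lemma mulr_commutator (R : pzRingType) (a b y z : R) :
  a * y * (b * z) = a * b * (y * z) + a * (y * b - b * y) * z.
Proof. by rewrite mulrBr mulrBl !mulrA addrC subrK. Qed.

Section Core.
Context (F : closedFieldType) (p : nat) (pF : p \in [pchar F]) (n : nat).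
Context (G : seq 'M[F]_n) (HG : reflection_group G).
Context (A : algType F) (x y : 'I_n -> A) (HA : is_weyl_algebra x y).
Context (D : unitAlgType F) (emb : A -> D).
Hypotheses (Hemb : is_alg_hom emb) (emb_inj : injective emb).
Hypothesis Ddiv : forall d : D, d != 0 -> d \is a GRing.unit.
Hypothesis Dfrac : forall d : D,
  exists a z, [/\ central z, z != 0 & d = emb a * (emb z)^-1].
Local Notation S := {mpoly F[n]}.
Local Notation kap := (kappa x).

Let e (q : S) : D := emb (kap q).
Let Y i : D := emb (y i).

Let eD q r : e (q + r) = e q + e r. Proof. by rewrite /e raddfD (homD Hemb). Qed.
Let eM q r : e (q * r) = e q * e r.
Proof. by rewrite /e (kap_mul HA) (homM Hemb). Qed.
Let eZ c q : e (c *: q) = c *: e q. Proof. by rewrite /e linearZ (homZ Hemb). Qed.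
Let e1 : e 1 = 1. Proof. by rewrite /e kappa1 (hom1 Hemb). Qed.
Let e0 : e 0 = 0. Proof. by rewrite /e raddf0 (hom0 Hemb). Qed.
Let e_sum (I : Type) (r : seq I) (h : I -> S) :
  e (\sum_(i <- r) h i) = \sum_(i <- r) e (h i).
Proof. exact: (big_morph e eD e0). Qed.
Let eC q r : e q * e r = e r * e q. Proof. by rewrite -!eM mulrC. Qed.
Let e_inj : injective e. Proof. by move=> q r /emb_inj/(kap_inj HA). Qed.
Let e_unit q : q != 0 -> e q \is a GRing.unit.
Proof.
by move=> q0; apply: Ddiv; apply: contra q0 => /eqP q0; apply/eqP/e_inj; rewrite q0 e0.
Qed.
Let Ye i q : Y i * e q = e q * Y i + e q^`M(i).
Proof. by rewrite /Y /e -!(homM Hemb) -(homD Hemb) (kap_ydiff HA). Qed.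
Let YC i j : Y i * Y j = Y j * Y i.
Proof. by have [[_ yy _] _] := HA; rewrite /Y -!(homM Hemb) yy. Qed.
Let eX i : e 'X_i = emb (x i). Proof. by rewrite /e kappaX. Qed.

Lemma D_hom_ext (t1 t2 : D -> D) : is_alg_hom t1 -> is_alg_hom t2 ->
  (forall i, t1 (emb (x i)) = t2 (emb (x i))) ->
  (forall i, t1 (emb (y i)) = t2 (emb (y i))) -> t1 =1 t2.
Proof.
move=> H1 H2 Hx Hy; apply: (frac_hom_ext Hemb emb_inj Ddiv Dfrac H1 H2).
exact: (weyl_hom_ext HA (hom_comp H1 Hemb) (hom_comp H2 Hemb)).
Qed.

(** The action of [G] on the fractions, from [hom_extend]. Since [w] determines [v] and [s], one map
    serves all of them; outside [G] its values are arbitrary. *)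
Lemma tau_exists : exists tau : 'M[F]_n -> D -> D, {in G, forall w,
  is_alg_hom (tau w) /\ forall s v, v *m w = 1%:M -> matrix_hom x y w v s ->
    forall a, tau w (emb a) = emb (s a)}.
Proof.
suff /choice[tau tauP] : forall w, exists t : D -> D, w \in G -> is_alg_hom t /\
    forall s v, v *m w = 1%:M -> matrix_hom x y w v s -> forall a, t (emb a) = emb (s a).
  by exists tau => w /tauP.
move=> w; have [wG|] := boolP (w \in G); last by exists id.
have [v _ wv] := rgV HG wG; have vw := mulmx1C wv.
have [s Ms] := matrix_hom_exists HA vw; have [s' Ms'] := matrix_hom_exists HA wv.
have [Hs sx sy] := Ms; have [Hs' _ _] := Ms'.
have [t [Ht tE]] := hom_extend Hemb emb_inj Ddiv Dfrac Hs Hs'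
  (matrix_homK HA vw Ms Ms') (matrix_homK HA wv Ms' Ms).
exists t => _; split=> // s1 v1 v1w [Hs1 s1x s1y] a; rewrite tE; congr emb.
have vv1 : v1 = v by rewrite -[v1]mulmx1 -wv mulmxA v1w mul1mx.
by apply: (weyl_hom_ext HA Hs Hs1) => j; rewrite ?sx ?s1x ?sy ?s1y ?vv1.
Qed.

Context (tau : 'M[F]_n -> D -> D).
Hypothesis tauP : {in G, forall w,
  is_alg_hom (tau w) /\ forall s v, v *m w = 1%:M -> matrix_hom x y w v s ->
    forall a, tau w (emb a) = emb (s a)}.

Let tauH w : w \in G -> is_alg_hom (tau w). Proof. by case/tauP. Qed.

Let tau_s w : w \in G -> exists s v,
  [/\ v *m w = 1%:M, matrix_hom x y w v s & forall a, tau w (emb a) = emb (s a)].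
Proof.
move=> wG; have [v _ /mulmx1C vw] := rgV HG wG.
have [s Ms] := matrix_hom_exists HA vw; exists s, v; split=> //.
by have [_ H] := tauP wG; exact: (H s v vw Ms).
Qed.

Let tau_e w q : w \in G -> tau w (e q) = e (act w q).
Proof.
move=> wG; have [s [v [_ Ms tE]]] := tau_s wG.
by rewrite /e tE (matrix_hom_kap HA _ Ms).
Qed.

Let tau_Y w v j : w \in G -> v *m w = 1%:M -> tau w (Y j) = \sum_k v j k *: Y k.
Proof.
move=> wG vw; have [s Ms] := matrix_hom_exists HA vw; have [Hs _ sy] := Ms.
have [_ tE] := tauP wG; rewrite /Y (tE _ _ vw Ms) sy (hom_sum Hemb).
by apply: eq_bigr => k _; rewrite (homZ Hemb).
Qed.

Lemma tauM w v : w \in G -> v \in G -> forall d, tau (w *m v) d = tau w (tau v d).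
Proof.
move=> wG vG; have wvG := rgM HG wG vG.
have [w' _ /mulmx1C w'w] := rgV HG wG; have [v' _ /mulmx1C v'v] := rgV HG vG.
have inv : (v' *m w') *m (w *m v) = 1%:M.
  by rewrite mulmxA -[v' *m w' *m w]mulmxA w'w mulmx1.
apply: D_hom_ext; [exact: tauH | exact: hom_comp (tauH wG) (tauH vG) | |] => j.
  by rewrite -eX (tau_e _ vG) (tau_e _ wG) (tau_e _ wvG) actM.
rewrite -/(Y j) (tau_Y _ wvG inv) (tau_Y _ vG v'v) (hom_sum (tauH wG)).
under [RHS]eq_bigr => k _.
  rewrite (homZ (tauH wG)) (tau_Y _ wG w'w) scaler_sumr.
  under eq_bigr => l _ do rewrite scalerA.
  over.
by rewrite exchange_big; apply: eq_bigr => l _; rewrite mxE scaler_suml.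
Qed.

Context (f : 'I_n -> S).
Hypotheses (finv : forall i, f i \in ginv G) (fdet : \det (jacobian f) != 0).
Hypothesis fgen : forall g, g \in ginv G ->
  exists q : S, g = q \mPo [tuple f i | i < n].

Let delta := \det (jacobian f).
(** Multiplying by the other conjugates of [delta] replaces the denominator of the inverse Jacobian
    by a norm, which is invariant. *)
Let cof := \prod_(w <- G | w != 1%:M) act w delta.
Let t := \prod_(w <- G) act w delta.
Let m k j := cof * (\adj (jacobian f)) k j.

Let tE : t = cof * delta.
Proof. by rewrite /t (bigD1_seq 1%:M) ?(rg1 HG) ?(rg_uniq HG) //= act1 mulrC. Qed.

Let t_inv : t \in ginv G.
Proof.
apply/ginvP => w wG; rewrite /t rmorph_prod -[RHS](big_mulG HG _ _ wG).
by apply: eq_bigr => v _; rewrite actM.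
Qed.

Let t_neq0 : t != 0.
Proof.
rewrite prodf_seq_neq0; apply/allP => w wG /=; apply: contra fdet => /eqP E.
have [v _ /mulmx1C vw] := rgV HG wG.
by rewrite -/delta -[delta]act1 -vw actM E rmorph0.
Qed.

Let JE i k : jacobian f i k = (f i)^`M(k). Proof. exact: mxE. Qed.

Let Jm i j : \sum_k m k j * (f i)^`M(k) = t *+ (i == j).
Proof.
have := congr1 (fun M : 'M_n => M i j) (mul_mx_adj (jacobian f)).
rewrite mxE [RHS]mxE => E; rewrite tE -mulrnAr -E mulr_sumr.
by apply: eq_bigr => k _; rewrite JE /m -mulrA [X in _ * X = _]mulrC.
Qed.

Let mJ l k : \sum_i m l i * (f i)^`M(k) = t *+ (l == k).
Proof.
have := congr1 (fun M : 'M_n => M l k) (mul_adj_mx (jacobian f)).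
rewrite mxE [RHS]mxE => E; rewrite tE -mulrnAr -E mulr_sumr.
by apply: eq_bigr => i _; rewrite JE /m -mulrA.
Qed.

Let u := e t.
Let u_unit : u \is a GRing.unit. Proof. exact: e_unit. Qed.
Let uV q : u^-1 * e q = e q * u^-1.
Proof. by apply/esym/commrV/eC. Qed.

(* The entries of the inverse Jacobian, over the invariant denominator [t]. *)
Let a k j := u^-1 * e (m k j).
Definition theta j := \sum_k a k j * Y k.

Let a_e k j q : a k j * e q = e q * a k j.
Proof. by rewrite /a -mulrA eC mulrA uV -!mulrA uV. Qed.

Let aC k j l i : a k j * a l i = a l i * a k j.
Proof.
have uVV : u^-1 * a l i = a l i * u^-1 by rewrite {2}/a -mulrA -uV.
by rewrite {1}/a -mulrA -a_e mulrA uVV -mulrA.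
Qed.

Lemma theta_e j q : theta j * e q = e q * theta j + u^-1 * e (\sum_k m k j * q^`M(k)).
Proof.
rewrite /theta mulr_suml mulr_sumr e_sum mulr_sumr -big_split; apply: eq_bigr => k _ /=.
by rewrite -mulrA Ye mulrDr mulrA a_e -mulrA eM [u^-1 * _]mulrA.
Qed.

Lemma theta_f j i : theta j * e (f i) = e (f i) * theta j + (j == i)%:R.
Proof.
rewrite theta_e Jm eq_sym; case: eqP => _; last by rewrite e0 mulr0.
by rewrite mulVr.
Qed.

Let cent (v : D) := forall i, v * e 'X_i = e 'X_i * v.

Let cent_e v q : cent v -> v * e q = e q * v.
Proof.
move=> vX; elim/mpoly_genind: q => [q r Hq Hr|c q Hq||i q Hq].
- by rewrite eD mulrDr mulrDl Hq Hr.
- by rewrite eZ -scalerAr -scalerAl Hq.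
- by rewrite e1 mul1r mulr1.
- by rewrite eM mulrA vX -mulrA Hq mulrA.
Qed.

Let centM v v' : cent v -> cent v' -> cent (v * v').
Proof. by move=> Hv Hv' i; rewrite -mulrA Hv' mulrA Hv mulrA. Qed.
Let centB v v' : cent v -> cent v' -> cent (v - v').
Proof. by move=> Hv Hv' i; rewrite mulrBl mulrBr Hv Hv'. Qed.
Let centZ c v : cent v -> cent (c *: v).
Proof. by move=> Hv i; rewrite -scalerAl -scalerAr Hv. Qed.
Let cent_sum (I : Type) (r : seq I) (h : I -> D) :
  (forall i, cent (h i)) -> cent (\sum_(i <- r) h i).
Proof. by move=> H i; rewrite mulr_suml mulr_sumr; apply: eq_bigr => k _; apply: H. Qed.

(* A first-order operator commuting with the [f i] vanishes, by the
   invertibility of the Jacobian. *)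
Let vanish (v : 'I_n -> D) : (forall k, cent (v k)) ->
  (forall i, (\sum_k v k * Y k) * e (f i) = e (f i) * (\sum_k v k * Y k)) ->
  \sum_k v k * Y k = 0.
Proof.
move=> vc vf.
have vJ i : \sum_k v k * e (f i)^`M(k) = 0.
  have /eqP := vf i; rewrite -subr_eq0 mulr_suml mulr_sumr -sumrB => /eqP E.
  rewrite -[RHS]E; apply: eq_bigr => k _.
  by rewrite -mulrA Ye mulrDr !mulrA (cent_e (f i) (vc k)) addrAC subrr add0r.
have v0 l : v l = 0.
  apply: (mulIr u_unit); rewrite mul0r.
  transitivity (\sum_i (\sum_k v k * e (f i)^`M(k)) * e (m l i)); last first.
    by rewrite big1 // => i _; rewrite vJ mul0r.
  under eq_bigr => i _ do rewrite mulr_suml.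
  rewrite exchange_big /=.
  transitivity (\sum_k v k * e (t *+ (l == k))).
    rewrite (bigD1 l) //= eqxx big1 ?addr0 // => k kl.
    by rewrite eq_sym (negPf kl) e0 mulr0.
  apply: eq_bigr => k _; rewrite -mJ e_sum mulr_sumr; apply: eq_bigr => i _.
  by rewrite -mulrA -eM [m l i * _]mulrC.
by rewrite big1 // => k _; rewrite v0 mul0r.
Qed.

Let Dd k d := Y k * d - d * Y k.

(** The commutator of [Y k] with each [x_i] is 0 or 1, so it commutes with [d]. *)
Let cent_Dd k d : cent d -> cent (Dd k d).
Proof.
move=> dX i; have YX : Y k * e 'X_i = e 'X_i * Y k + (k == i)%:R.
  rewrite Ye mderivXU; congr (_ + _); by case: eqP; rewrite ?e1 ?e0.
have dn : d * (k == i)%:R = (k == i)%:R * d by case: eqP; rewrite ?mul1r ?mulr1 ?mul0r ?mulr0.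
rewrite /Dd mulrBl mulrBr -mulrA dX mulrA YX mulrDl -[d * Y k * _]mulrA YX mulrDr.
by rewrite mulrA dX dn opprD addrACA subrr addr0 !mulrA.
Qed.

(** In the commutator the second-order terms cancel, because the [Y k] commute and so do the
    coefficients. What remains is a first-order operator commuting with every [f k], and [vanish]
    applies. *)
Lemma thetaC i j : theta i * theta j = theta j * theta i.
Proof.
pose v l := \sum_k (a k i * Dd k (a l j) - a k j * Dd k (a l i)).
have ac k l : cent (a k l) by move=> ?; apply: a_e.
have thth i' j' : theta i' * theta j' =
    \sum_k \sum_l a k i' * a l j' * (Y k * Y l) +
    \sum_l (\sum_k a k i' * Dd k (a l j')) * Y l.
  under [X in _ = _ + X]eq_bigr => l _ do rewrite mulr_suml.
  rewrite [X in _ = _ + X]exchange_big -big_split mulr_suml; apply: eq_bigr => k _ /=.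
  rewrite mulr_sumr -big_split; apply: eq_bigr => l _ /=.
  exact: mulr_commutator.
have E : theta i * theta j - theta j * theta i = \sum_l v l * Y l.
  rewrite !thth opprD addrACA [X in _ - X + _]exchange_big -sumrB big1 ?add0r.
    by rewrite -sumrB; apply: eq_bigr => l _; rewrite -mulrBl -sumrB.
  move=> k _; rewrite -sumrB big1 // => l _.
  by rewrite aC YC subrr.
apply/eqP; rewrite -subr_eq0 E; apply/eqP; apply: vanish => [l k|k].
  move: k; rewrite -/(cent _); apply: cent_sum => k.
  by apply: centB; apply: centM => //; apply: cent_Dd.
have th2 i' j' : theta i' * theta j' * e (f k) = e (f k) * (theta i' * theta j') +
    ((i' == k)%:R * theta j' + (j' == k)%:R * theta i').
  rewrite -mulrA theta_f mulrDr mulrA theta_f mulrDl !mulrA -addrA; congr (_ + (_ + _)).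
  by case: (j' == k); rewrite ?mul1r ?mulr1 ?mul0r ?mulr0.
by rewrite -E mulrBl mulrBr !th2 [_ * theta i + _]addrC opprD addrACA subrr addr0.
Qed.

(** [tau w (theta j)] is a first-order operator with the same commutators with the invariants [f i]
    as [theta j]; [vanish] applies to the difference. *)
Lemma tau_theta w j : w \in G -> tau w (theta j) = theta j.
Proof.
move=> wG; have [w' _ /mulmx1C w'w] := rgV HG wG; have H := tauH wG.
have tu : tau w u = u by rewrite /u tau_e // (ginvP _ _ t_inv).
have tuV : tau w u^-1 = u^-1 by rewrite (homV H u_unit).2 tu.
pose b l := \sum_k w' k l *: (u^-1 * e (act w (m k j))).
have E : tau w (theta j) = \sum_l b l * Y l.
  rewrite /theta (hom_sum H).
  under eq_bigr => k _ do
    rewrite !(homM H) tuV tau_e // (tau_Y _ wG w'w) mulr_sumr.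
  rewrite exchange_big; apply: eq_bigr => l _ /=; rewrite /b mulr_suml.
  by apply: eq_bigr => k _; rewrite -scalerAr scalerAl.
apply/eqP; rewrite -subr_eq0 E /theta -sumrB; apply/eqP.
under eq_bigr => l _ do rewrite -mulrBl.
apply: vanish => [l i|i].
  move: i; rewrite -/(cent _); apply: centB; last by move=> ?; apply: a_e.
  apply: cent_sum => k; apply: centZ; apply: centM => i; last exact: eC.
  exact: uV.
under eq_bigr => l _ do rewrite mulrBl.
rewrite sumrB -E -/(theta j) mulrBl mulrBr theta_f.
have -> : tau w (theta j) * e (f i) = e (f i) * tau w (theta j) + (j == i)%:R.
  have := congr1 (tau w) (theta_f j i).
  by rewrite (homD H) !(homM H) tau_e // (ginvP _ _ (finv i)) // (hom_nat H).
by rewrite opprD addrACA subrr addr0.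
Qed.

Lemma Y_theta k : Y k = \sum_i e (f i)^`M(k) * theta i.
Proof.
under eq_bigr => i _ do rewrite /theta mulr_sumr.
rewrite exchange_big /= (bigD1 k) //= [X in _ + X]big1 ?addr0 => [|l lk].
  under eq_bigr => i _ do rewrite mulrA -a_e /a -mulrA -eM.
  by rewrite -mulr_suml -mulr_sumr -e_sum mJ eqxx mulVr // mul1r.
under eq_bigr => i _ do rewrite mulrA -a_e /a -mulrA -eM.
by rewrite -mulr_suml -mulr_sumr -e_sum mJ (negPf lk) e0 mulr0 mul0r.
Qed.

Lemma j_exists : exists j : A -> D, [/\ is_alg_hom j,
  forall i, j (x i) = e (f i) & forall i, j (y i) = theta i].
Proof.
apply: (weyl_hom HA); split=> i k; [exact: eC | exact: thetaC |].
by rewrite theta_f addrC addKr.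
Qed.

Context (j : A -> D).
Hypotheses (Hj : is_alg_hom j) (jx : forall i, j (x i) = e (f i))
  (jy : forall i, j (y i) = theta i).

Lemma tau_j w b : w \in G -> tau w (j b) = j b.
Proof.
move=> wG; apply: (weyl_hom_ext HA (hom_comp (tauH wG) Hj) Hj) => i.
  by rewrite jx tau_e // (ginvP _ _ (finv i)).
by rewrite jy tau_theta.
Qed.

Lemma j_kap q : j (kap q) = e (q \mPo [tuple f i | i < n]).
Proof.
elim/mpoly_genind: q => [q r Hq Hr|c q Hq||i q Hq].
- by rewrite raddfD (homD Hj) Hq Hr comp_mpolyD eD.
- by rewrite linearZ (homZ Hj) Hq comp_mpolyZ eZ.
- by rewrite kappa1 (hom1 Hj) comp_mpoly1 e1.
- rewrite (kap_mul HA) (homM Hj) kappaX jx Hq rmorphM /= comp_mpolyXU eM.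
  by rewrite -tnth_nth tnth_mktuple.
Qed.

(* The kernel is stable under [y_i |-> y_i + c_i], which lifts to the automorphism
   [y_k |-> y_k + d(sum_i c_i f_i)/dx_k] of [D]; an element of the kernel of least
   degree is therefore a polynomial in the [x_i]. *)
Lemma j_inj b : j b = 0 -> b = 0.
Proof.
have transl (c : 'I_n -> F) q : j (nord x y q) = 0 -> j (nord x y (shift c q)) = 0.
  have [s Ts] : exists s, transl_hom x y (fun i => (c i)%:MP) s.
    by apply: (transl_hom_exists HA) => i k; rewrite !mderivC.
  (* The derivative of [g] along [theta i] is [c i], so adding the gradient of [g] to the [y_k]
     translates [theta i] by [c i]. *)
  pose g := \sum_i c i *: f i.
  have [s1 Ts1] : exists s, transl_hom x y (fun i => g^`M(i)) s.
    by apply: (transl_hom_exists HA) => i k; rewrite mderiv_comm.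
  have [s2 Ts2] : exists s, transl_hom x y (fun i => - g^`M(i)) s.
    by apply: (transl_hom_exists HA) => i k; rewrite !mderivN mderiv_comm.
  have Ts1' : transl_hom x y (fun i => - - g^`M(i)) s1.
    by have [? ? H] := Ts1; split=> // i; rewrite opprK.
  have [Hs sx sy] := Ts; have [Hs1 s1x s1y] := Ts1; have [Hs2 _ _] := Ts2.
  have [T [HT TE]] := hom_extend Hemb emb_inj Ddiv Dfrac Hs1 Hs2
    (transl_homK HA Ts1 Ts2) (transl_homK HA Ts2 Ts1').
  have Te r : T (e r) = e r by rewrite /e TE (transl_hom_kap HA _ Ts1).
  have TuV : T u^-1 = u^-1 by rewrite (homV HT u_unit).2 Te.
  have Tth i : T (theta i) = theta i + (c i)%:A.
    rewrite /theta (hom_sum HT).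
    under eq_bigr => k _ do
      rewrite !(homM HT) TuV Te /Y TE s1y (homD Hemb) -/(e _) mulrDr.
    rewrite big_split /=; congr (_ + _); under eq_bigr => k _ do rewrite -mulrA -eM.
    rewrite -mulr_sumr -e_sum.
    have -> : \sum_k m k i * g^`M(k) = c i *: t.
      under eq_bigr => k _ do rewrite /g raddf_sum mulr_sumr.
      rewrite exchange_big /= (bigD1 i) //= [X in _ + X]big1 ?addr0 => [|l li].
        under eq_bigr => k _ do rewrite linearZ /= -scalerAr.
        by rewrite -scaler_sumr Jm eqxx.
      under eq_bigr => k _ do rewrite linearZ /= -scalerAr.
      by rewrite -scaler_sumr Jm (negPf li) scaler0.
    by rewrite eZ -scalerAr mulVr.
  move=> jq; rewrite -(transl_nord HA _ Ts).
  have -> : j (s (nord x y q)) = T (j (nord x y q)).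
    apply: (weyl_hom_ext HA (hom_comp Hj Hs) (hom_comp HT Hj)) => i.
      by rewrite sx jx Te.
    by rewrite sy (homD Hj) kappaC (homZ Hj) (hom1 Hj) jy Tth.
  by rewrite jq (hom0 HT).
suff H q : j (nord x y q) = 0 -> q = 0.
  by rewrite -(symbK HA b) => /H ->; rewrite raddf0.
have [k] := ubnP (msize q); elim: k q => // k IH q; rewrite ltnS => qk jq.
have [//|q0] := eqVneq q 0.
have q1 : (0 < msize q)%N by rewrite lt0n msize_poly_eq0.
(* The difference lies in the kernel and has smaller degree, so it is zero by induction. *)
have inv c : shift c q = q.
  apply/eqP; rewrite -subr_eq0; apply/eqP; apply: IH.
    by apply: leq_ltn_trans (msize_shift _ _) _; rewrite prednK.
  by rewrite raddfB /= (homB Hj) jq transl // subrr.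
have qE : q = xlift (xret q) by rewrite xretK (shift_invariant inv).
move: jq; rewrite qE -(kap_nord HA) j_kap -e0 => /e_inj.
move/(jacobian_alg_indep pF fdet) => ->; exact: comp_mpoly0.
Qed.

Let j_unit b : b != 0 -> j b \is a GRing.unit.
Proof. by move=> b0; apply: Ddiv; apply: contra b0 => /eqP/j_inj ->. Qed.

(** [z] is central in [A], so [j z] commutes with the image of [j]; this is what sums and products
    of such fractions rely on. *)
Definition jfrac (d : D) := exists b z, [/\ central z, z != 0 & d * j z = j b].

Let jC z b : central z -> j z * j b = j b * j z.
Proof. by move=> zC; rewrite -!(homM Hj) zC. Qed.

Let centralM (z w : A) : central z -> central w -> central (z * w).
Proof. by move=> zC wC b; rewrite -mulrA wC mulrA zC mulrA. Qed.

Let mul_neq0 (z w : A) : z != 0 -> w != 0 -> z * w != 0.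
Proof.
by move=> z0 w0; apply/eqP => /(weyl_domain HA)[/eqP|/eqP]; apply/negP.
Qed.

Lemma jfrac_j b : jfrac (j b).
Proof.
exists b, 1; split; [by move=> c; rewrite mul1r mulr1 | exact: oner_neq0 |].
by rewrite (hom1 Hj) mulr1.
Qed.

Lemma jfracD d d' : jfrac d -> jfrac d' -> jfrac (d + d').
Proof.
move=> [b [z [zC z0 dz]]] [b' [z' [zC' z0' dz']]].
exists (b * z' + b' * z), (z * z'); split; [exact: centralM | exact: mul_neq0 |].
rewrite (homD Hj) !(homM Hj) -dz -dz' mulrDl !mulrA; congr (_ + _).
by rewrite -!mulrA (jC _ zC).
Qed.

Lemma jfracM d d' : jfrac d -> jfrac d' -> jfrac (d * d').
Proof.
move=> [b [z [zC z0 dz]]] [b' [z' [zC' z0' dz']]].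
exists (b * b'), (z' * z); split; [exact: centralM | exact: mul_neq0 |].
rewrite !(homM Hj) mulrA -[d * d' * _]mulrA dz' -mulrA -(jC _ zC) mulrA dz.
by [].
Qed.

(** Inverting the fraction turns the numerator [b] into a denominator, which [weyl_central_multiple]
    makes central again. *)
Lemma jfracV d : jfrac d -> d != 0 -> jfrac d^-1.
Proof.
move=> [b [z [zC z0 dz]]] d0; have du := Ddiv d0.
have b0 : b != 0.
  apply: contra d0 => /eqP b0; apply/eqP; apply: (mulIr (j_unit z0)).
  by rewrite dz b0 (hom0 Hj) mul0r.
have [b' [w [wC w0 bb']]] := weyl_central_multiple HA pF b0.
exists (z * b'), w; split=> //.
by apply: (mulrI du); rewrite mulVKr // (homM Hj) mulrA dz -(homM Hj) bb'.
Qed.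

Let jfrac_e g : g \in ginv G -> jfrac (e g).
Proof. by move=> /fgen[q ->]; rewrite -j_kap; apply: jfrac_j. Qed.

(** Letting [q] vary makes the property stable under left multiplication by polynomials. *)
Let jfracT d := forall q, jfrac (\sum_(w <- G) tau w (e q * d)).

Lemma jfracT_emb b : jfracT (emb b).
Proof.
have TD d d' : jfracT d -> jfracT d' -> jfracT (d + d').
  move=> Td Td' q; rewrite (_ : \sum_(w <- G) _ =
    \sum_(w <- G) tau w (e q * d) + \sum_(w <- G) tau w (e q * d')).
    exact: jfracD.
  rewrite -big_split; apply: eq_big_seq => w wG /=.
  by rewrite mulrDr (homD (tauH wG)).
have TZ c d : jfracT d -> jfracT (c *: d).
  move=> Td q; have := Td (c *: q); congr jfrac; apply: eq_bigr => w _.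
  by rewrite eZ -scalerAl -scalerAr.
have Te r d : jfracT d -> jfracT (e r * d).
  move=> Td q; have := Td (q * r); congr jfrac; apply: eq_bigr => w _.
  by rewrite eM mulrA.
have TuV d : jfracT d -> jfracT (u^-1 * d).
  move=> Td q; rewrite (_ : \sum_(w <- G) _ =
    u^-1 * \sum_(w <- G) tau w (e q * d)).
    apply: jfracM (Td q); apply: jfracV (jfrac_e t_inv) _.
    by rewrite -e0 (inj_eq e_inj).
  rewrite mulr_sumr; apply: eq_big_seq => w wG; have H := tauH wG.
  rewrite mulrA -uV -mulrA (homM H) (homV H u_unit).2 tau_e //.
  by rewrite (ginvP _ _ t_inv).
(* [e q * theta i] is [theta i * e q] minus a term of order zero. The invariant [theta i] leaves the
   sum over [G], and the correction is covered by [Te] and [TuV]. *)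
have Tth i d : jfracT d -> jfracT (theta i * d).
  move=> Td q; rewrite (_ : \sum_(w <- G) _ =
    theta i * \sum_(w <- G) tau w (e q * d) +
    (-1) *: \sum_(w <- G) tau w (e 1 * (u^-1 * (e (\sum_k m k i * q^`M(k)) * d)))).
    apply: jfracD; first by apply: jfracM (Td q); rewrite -jy; apply: jfrac_j.
    have := TZ (-1) _ (TuV _ (Te (\sum_k m k i * q^`M(k)) _ Td)) 1.
    congr jfrac; rewrite scaler_sumr; apply: eq_big_seq => w wG.
    by rewrite -scalerAr (homZ (tauH wG)).
  rewrite scaleN1r mulr_sumr -sumrB; apply: eq_big_seq => w wG; have H := tauH wG.
  rewrite -[X in X * _ - _](tau_theta i wG) -(homM H) -(homB H) e1 mul1r; congr (tau w _).
  by rewrite !mulrA -mulrBl theta_e addrK.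
have TY k d : jfracT d -> jfracT (Y k * d).
  move=> Td; rewrite Y_theta mulr_suml.
  apply: (big_ind jfracT) => [q|d1 d2|i _].
  - rewrite big_seq big1 => [|w wG]; last by rewrite mulr0 (hom0 (tauH wG)).
    by rewrite -(hom0 Hj); apply: jfrac_j.
  - exact: TD.
  - by rewrite -mulrA; apply: Te; apply: Tth.
elim/(weyl_ind HA): b => [b c Hb Hc|c b Hb||i b Hb|i b Hb].
- by rewrite (homD Hemb); apply: TD.
- by rewrite (homZ Hemb); apply: TZ.
- move=> q; rewrite (hom1 Hemb) (_ : \sum_(w <- G) _ = e (avg G q)).
    exact/jfrac_e/(avg_inv HG).
  by rewrite /avg e_sum; apply: eq_big_seq => w wG; rewrite mulr1 tau_e.
- by rewrite (homM Hemb) -eX; apply: Te.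
- by rewrite (homM Hemb); apply: TY.
Qed.

Definition tfix (d : D) := forall w, w \in G -> tau w d = d.

Lemma jfrac_emb_fix b : tfix (emb b) -> jfrac (emb b).
Proof.
move=> bfix; have := jfracT_emb b 1.
rewrite (_ : \sum_(w <- G) _ = (size G)%:R * emb b); last first.
  rewrite mulr_natl -sumr_const_seq; apply: eq_big_seq => w wG.
  by rewrite e1 mul1r bfix.
move=> H; have N0 := sizeG_neq0 HG.
have -> : emb b = e ((size G)%:R^-1)%:MP * ((size G)%:R * emb b).
  rewrite mulrA /e kappaC (homZ Hemb) (hom1 Hemb) mulr_algl -scaler_nat scalerA.
  by rewrite mulVf // scale1r mul1r.
by apply: jfracM H; rewrite -(comp_mpolyC _ [tuple f i | i < n]) -j_kap; apply: jfrac_j.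
Qed.

(* Denominators can be made invariant by taking norms. *)
Lemma tfix_frac d : tfix d ->
  exists b z, [/\ tfix (emb b), tfix (emb z), z != 0 & d = emb b * (emb z)^-1].
Proof.
move=> dfix; have [b [z [zC z0 dE]]] := Dfrac d.
(* Automorphisms of [A] that induce the [tau w], with their inverses, so that they preserve central
   elements. *)
have /choice[s sP] w : exists s : A -> A, w \in G -> exists s',
    [/\ is_alg_hom s, cancel s s', cancel s' s, is_alg_hom s'
      & forall a, tau w (emb a) = emb (s a)].
  have [wG|] := boolP (w \in G); last by exists id.
  have [s [v [vw Ms sE]]] := tau_s wG; exists s => _.
  have wv := mulmx1C vw; have [s' Ms'] := matrix_hom_exists HA wv.
  exists s'; have [? _ _] := Ms; have [? _ _] := Ms'; split=> //.
    exact: (matrix_homK HA vw Ms Ms').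
  exact: (matrix_homK HA wv Ms' Ms).
have szC w : w \in G -> central (s w z).
  move=> wG; have [s' [Hs ss' s's _ _]] := sP w wG.
  by move=> c; rewrite -[c]s's -!(homM Hs) zC.
have sz0 w : w \in G -> s w z != 0.
  move=> wG; have [s' [Hs ss' _ Hs' _]] := sP w wG.
  by apply: contra z0 => /eqP E; rewrite -[z]ss' E (hom0 Hs').
pose zz := \prod_(w <- G) s w z; pose cz := \prod_(w <- rem 1%:M G) s w z.
(* In the noncommutative ring [A], reordering the norm relies on its factors being central. *)
have permP (g : 'M[F]_n -> A) r1 r2 : {in r1, forall w, central (g w)} ->
    perm_eq r1 r2 -> \prod_(w <- r1) g w = \prod_(w <- r2) g w.
  elim: r1 r2 => [|w r1 IH] r2 gC.
    by rewrite perm_sym => /perm_nilP ->.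
  move=> pe; have wr2 : w \in r2 by rewrite -(perm_mem pe) mem_head.
  case/splitPr: wr2 pe => r3 r4; rewrite perm_sym -[w :: r4]cat1s perm_catCA /= perm_cons.
  rewrite perm_sym => pe; rewrite big_cons big_cat big_cons /= mulrA -(gC w (mem_head _ _)) -mulrA.
  by rewrite -big_cat /=; congr (_ * _); apply: IH => // v vr; apply: gC; rewrite inE vr orbT.
have s1 c : s 1%:M c = c.
  have [s' [_ _ _ _ E]] := sP _ (rg1 HG); apply: emb_inj; rewrite -E.
  have /= := frac_hom_ext Hemb emb_inj Ddiv Dfrac (tauH (rg1 HG)) (@hom_id _ D).
  apply; move=> c'.
  apply: (weyl_hom_ext HA (hom_comp (tauH (rg1 HG)) Hemb) Hemb) => i.
    by rewrite -eX tau_e ?(rg1 HG) // act1.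
  rewrite -/(Y i) (tau_Y (v := 1%:M)) ?(rg1 HG) ?mulmx1 // (bigD1 i) //= mxE eqxx scale1r.
  by rewrite big1 ?addr0 // => k ki; rewrite mxE eq_sym (negPf ki) scale0r.
have zzE : zz = z * cz.
  rewrite /zz (permP (fun w => s w z) G (1%:M :: rem 1%:M G)).
  - by rewrite big_cons s1.
  - by move=> w /szC.
  - exact: perm_to_rem (rg1 HG).
have zzfix : tfix (emb zz).
  move=> w wG; rewrite /zz (hom_prod Hemb) (hom_prod (tauH wG)) -(hom_prod Hemb).
  transitivity (\prod_(v <- [seq w *m v | v <- G]) emb (s v z)).
    rewrite big_map; apply: eq_big_seq => v vG.
    have [_ [_ _ _ _ E]] := sP v vG.
    have [_ [_ _ _ _ E']] := sP _ (rgM HG wG vG).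
    by rewrite -E -E' tauM.
  rewrite -(hom_prod Hemb); congr emb; apply: permP (perm_mulG HG wG) => v.
  by rewrite (perm_mem (perm_mulG HG wG)) => /szC.
have zz0 : zz != 0.
  rewrite /zz big_seq; apply: (big_ind (fun c : A => c != 0)) => [||w wG].
  - exact: oner_neq0.
  - exact: mul_neq0.
  - exact: sz0.
have zu := emb_unit Hemb emb_inj Ddiv z0; have zzu := emb_unit Hemb emb_inj Ddiv zz0.
have dzz : d * emb zz = emb (b * cz).
  by rewrite dE zzE !(homM Hemb) mulrA mulrVK.
exists (b * cz), zz; split=> //.
  by move=> w wG; rewrite -dzz (homM (tauH wG)) dfix // zzfix.
by rewrite -dzz mulrK.
Qed.

Lemma tfix_jfrac d : tfix d -> exists b s, s != 0 /\ d = j b * (j s)^-1.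
Proof.
move=> dfix; have [b [z [bf zf z0 ->]]] := tfix_frac dfix.
have zu := emb_unit Hemb emb_inj Ddiv z0.
have [c [w [_ w0 E]]] : jfrac (emb b * (emb z)^-1).
  apply: jfracM (jfrac_emb_fix bf) (jfracV (jfrac_emb_fix zf) _).
  by apply: contraTneq zu => ->; rewrite unitr0.
exists c, w; split=> //; rewrite -E mulrK //; exact: j_unit.
Qed.

End Core.

(** * Division subrings as types, for the ring fixed by the group *)

Section DivisionSubring.
Context (D : unitRingType) (Q : D -> Prop).
Hypothesis Q1 : Q 1.
Hypothesis QB : forall u v, Q u -> Q v -> Q (u - v).
Hypothesis QM : forall u v, Q u -> Q v -> Q (u * v).
Hypothesis QV : forall u, Q u -> Q u^-1.

Definition dsub : {pred D} := fun d => `[< Q d >].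

Lemma dsub_in d : Q d -> d \in dsub.
Proof. by move=> Qd; apply/asboolP. Qed.

Lemma dsub_out d : d \in dsub -> Q d.
Proof. by move/asboolP. Qed.

Lemma dsub_closed : divring_closed dsub.
Proof.
split=> [|u v /asboolP Qu /asboolP Qv|u v /asboolP Qu /asboolP Qv]; apply/asboolP.
- exact: Q1.
- exact: QB.
- by apply: QM => //; apply: QV.
Qed.
HB.instance Definition _ := GRing.isDivringClosed.Build D dsub dsub_closed.

Record dsubT := DsubT { dsub_val :> D; _ : dsub_val \in dsub }.
HB.instance Definition _ := [isSub for dsub_val].
HB.instance Definition _ := [Choice of dsubT by <:].
HB.instance Definition _ := [SubChoice_isSubUnitRing of dsubT by <:].

Lemma dsubT_exists : (forall d : D, d != 0 -> d \is a GRing.unit) ->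
  exists (D1 : unitRingType) (v : D1 -> D),
  [/\ is_division_ring D1, injective v, forall d, Q (v d),
      forall d, Q d -> exists d1, v d1 = d
    & [/\ {morph v : a b / a + b}, {morph v : a b / a * b}, v 1 = 1
        & forall a, a != 0 -> v a^-1 = (v a)^-1]].
Proof.
move=> Ddiv.
have unit1 (d : dsubT) : d != 0 -> d \is a GRing.unit.
  move=> d0; have du : val d \is a GRing.unit.
    by apply: Ddiv; apply: contra d0 => /eqP E; apply/eqP/val_inj; rewrite E rmorph0.
  have Qd : Q (val d)^-1 by apply: QV; apply: dsub_out; exact: valP.
  apply/unitrP; exists (DsubT (dsub_in Qd)).
  by split; apply: val_inj; rewrite [LHS]rmorphM [RHS]rmorph1 /= ?mulVr ?divrr.
exists dsubT, val; split.
- by split; [exact: oner_neq0 | exact: unit1].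
- exact: val_inj.
- by move=> d; apply: dsub_out; exact: valP.
- by move=> d Qd; exists (DsubT (dsub_in Qd)).
- split=> [a b|a b||a a0]; [exact: rmorphD | exact: rmorphM | exact: rmorph1 |].
  by apply: rmorphV; apply: unit1.
Qed.

End DivisionSubring.

(** [D1] is the fixed ring of [G] in the fractions of [A]: [tfix_frac] presents it by fractions of
    invariants, [tfix_jfrac] by fractions of the image of [j]. *)
Theorem reflection_weyl_fractions (F : closedFieldType) (p : nat)
    (pF : p \in [pchar F]) (n : nat) (G : seq 'M[F]_n) (HG : reflection_group G)
    (A : algType F) (x y : 'I_n -> A) (HA : is_weyl_algebra x y) :
  exists (D1 : unitRingType) (iota j : A -> D1),
  [/\ is_skew_fraction_field (fun b => forall w v s, w \in G -> v *m w = 1%:M ->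
        matrix_hom x y w v s -> s b = b) iota,
      is_skew_fraction_field (fun _ => True) j
    & forall k : F, iota k%:A = j k%:A].
Proof.
have [D [emb [Hemb emb_inj Ddiv Dfrac]]] :=
  central_fractions (weyl_domain HA) (weyl_central_multiple HA pF).
have [tau tauP] := tau_exists HG HA Hemb emb_inj Ddiv Dfrac.
have [f [finv fgen fdet]] := Chevalley HG.
have [j [Hj jx jy]] := j_exists HG HA Hemb emb_inj Ddiv fdet.
have tauH w : w \in G -> is_alg_hom (tau w) by case/tauP.
have jfix b : tfix G tau (j b).
  by move=> w wG; apply: (tau_j HG HA Hemb emb_inj Ddiv tauP finv fdet Hj jx jy).
have jinj : injective j.
  move=> b c bc; apply/eqP; rewrite -subr_eq0; apply/eqP.
  apply: (j_inj pF HG HA Hemb emb_inj Ddiv Dfrac fdet Hj jx jy).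
  by rewrite (homB Hj) bc subrr.
have [] := @dsubT_exists D (tfix G tau) _ _ _ _ Ddiv.
- by move=> w /tauH H; exact: hom1 H.
- by move=> u v Hu Hv w wG; rewrite (homB (tauH _ wG)) Hu ?Hv.
- by move=> u v Hu Hv w wG; rewrite (homM (tauH _ wG)) Hu ?Hv.
- move=> u Hu w wG; have [->|u0] := eqVneq u 0.
    by rewrite invr0 (hom0 (tauH _ wG)).
  by rewrite (homV (tauH _ wG) (Ddiv _ u0)).2 Hu.
move=> D1 [v [D1div v_inj vfix vsurj [vD vM v1 vV]]].
have v0 : v 0 = 0.
  by have /eqP := vD 0 0; rewrite addr0 -subr_eq0 opprD addNKr oppr_eq0 => /eqP.
(* [iota] must be total on [A]; its values outside the invariants carry no information. *)
have /choice[iota iotaP] b : exists d1 : D1, tfix G tau (emb b) -> v d1 = emb b.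
  have [/vsurj[d1 E]|H] := pselect (tfix G tau (emb b)); first by exists d1.
  by exists 0.
have /choice[j1 j1P] b : exists d1 : D1, v d1 = j b by apply: vsurj.
pose inv b := forall w v s, w \in G -> v *m w = 1%:M -> matrix_hom x y w v s -> s b = b.
have inv_fix b : inv b <-> tfix G tau (emb b).
  split=> [ib w wG|fb w w' s wG w'w Ms].
    have [w' _ /mulmx1C w'w] := rgV HG wG.
    have [s Ms] := matrix_hom_exists HA w'w.
    by rewrite ((tauP w wG).2 s w' w'w Ms) (ib w w' s).
  by apply: emb_inj; rewrite -((tauP w wG).2 s w' w'w Ms) fb.
have iotaE b : inv b -> v (iota b) = emb b by move/inv_fix/iotaP.
have invD b c : inv b -> inv c -> inv (b + c).
  move=> ib ic w w' s wG w'w Ms; have [Hs _ _] := Ms.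
  by rewrite (homD Hs) (ib w w' s wG w'w Ms) (ic w w' s wG w'w Ms).
have invM b c : inv b -> inv c -> inv (b * c).
  move=> ib ic w w' s wG w'w Ms; have [Hs _ _] := Ms.
  by rewrite (homM Hs) (ib w w' s wG w'w Ms) (ic w w' s wG w'w Ms).
have invZ (k : F) : inv k%:A.
  by move=> w w' s wG w'w [Hs _ _]; rewrite (homZ Hs) (hom1 Hs).
have inv1 : inv 1 by rewrite -(scale1r 1).
exists D1, iota, j1; split.
- split=> //; split=> [b c ib ic|b c ib ic||b c ib ic|d].
  + by apply: v_inj; rewrite vD !iotaE //; [exact: homD | exact: invD].
  + by apply: v_inj; rewrite vM !iotaE //; [exact: homM | exact: invM].
  + by apply: v_inj; rewrite v1 iotaE // (hom1 Hemb).
  + by move=> E; apply: emb_inj; rewrite -!iotaE // E.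
  + have [b [z [bf zf z0 E]]] :=
      tfix_frac HG HA Hemb emb_inj Ddiv Dfrac tauP (vfix d).
    have ib := (inv_fix b).2 bf; have iz := (inv_fix z).2 zf.
    exists b, z; split=> //; apply: v_inj; rewrite vM vV ?iotaE //.
    apply: contra z0 => /eqP E0; apply/eqP/emb_inj.
    by rewrite -iotaE // E0 v0 (hom0 Hemb).
- split=> //; split=> [b c _ _|b c _ _||b c _ _|d].
  + by apply: v_inj; rewrite vD !j1P; exact: homD.
  + by apply: v_inj; rewrite vM !j1P; exact: homM.
  + by apply: v_inj; rewrite v1 j1P (hom1 Hj).
  + by move=> E; apply: jinj; rewrite -!j1P E.
  + have [b [z [z0 E]]] := tfix_jfrac pF HG HA Hemb emb_inj Ddiv Dfrac tauP
      finv fdet fgen Hj jx jy (vfix d).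
    exists b, z; split=> //; apply: v_inj; rewrite vM vV ?j1P //.
    apply: contra z0 => /eqP E0; apply/eqP/jinj.
    by rewrite -j1P E0 v0 (hom0 Hj).
- move=> k; apply: v_inj; rewrite iotaE // j1P (homZ Hemb) (homZ Hj).
  by rewrite (hom1 Hemb) (hom1 Hj).
Qed.

(** * Root systems *)

Section RootSystem.
Context (R : realType) (n : nat) (Phi : seq 'rV[R]_n) (b : 'I_n -> 'rV[R]_n).
Hypotheses (HPhi : is_root_system Phi) (Hb : is_root_lattice_basis Phi b).
Local Notation V := 'rV[R]_n.
Local Notation roots := (all (fun a => a \in Phi)).

Lemma edot_gt0 (a : V) : a != 0 -> edot a a != 0.
Proof.
apply: contra => /eqP; rewrite /edot mxE => E; apply/eqP/rowP => k; rewrite [RHS]mxE.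
have sq i : true -> 0 <= a 0 i * a^T i 0 by rewrite mxE -expr2 sqr_ge0.
have /eqP := psumr_eq0P sq E (i := k) isT.
by rewrite mxE mulf_eq0 orbb => /eqP.
Qed.

Lemma cartanD (u v a : V) : cartan (u + v) a = cartan u a + cartan v a.
Proof. by rewrite /cartan /edot mulmxDl mxE mulrDr mulrDl. Qed.

Lemma cartanZ c (u a : V) : cartan (c *: u) a = c * cartan u a.
Proof. by rewrite /cartan /edot -scalemxAl mxE; ring. Qed.

Lemma refl_is_linear (a : V) : linear (refl a).
Proof.
move=> c u v; rewrite /refl cartanD cartanZ scalerDl scalerBr scalerA opprD.
by rewrite addrACA.
Qed.
HB.instance Definition _ a := GRing.isLinear.Build R V V _ (refl a) (refl_is_linear a).

Lemma weyl_act_is_linear ws : linear (@weyl_act R n ws).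
Proof.
move=> c u v; elim: ws => //= a ws IH.
by rewrite /weyl_act /= -!/(weyl_act _ _) IH linearP.
Qed.
HB.instance Definition _ ws :=
  GRing.isLinear.Build R V V _ (@weyl_act R n ws) (weyl_act_is_linear ws).

Lemma reflK (a v : V) : a \in Phi -> refl a (refl a v) = v.
Proof.
move=> aP; have a0 : edot a a != 0.
  by apply: edot_gt0; apply: contraTneq aP => ->; have [_ []] := HPhi.
rewrite {1}/refl.
have -> : cartan (refl a v) a = - cartan v a.
  have ca : cartan a a = 2 by rewrite /cartan mulfK.
  rewrite /refl cartanD -scaleNr cartanZ ca; ring.
by rewrite scaleNr opprK /refl subrK.
Qed.

Lemma weyl_act_cat ws1 ws2 (v : V) :
  weyl_act (ws1 ++ ws2) v = weyl_act ws1 (weyl_act ws2 v).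
Proof. by rewrite /weyl_act foldr_cat. Qed.

Lemma weyl_actK ws (v : V) : roots ws -> weyl_act (rev ws) (weyl_act ws v) = v.
Proof.
elim: ws => //= a ws IH /andP[aP wsP]; rewrite rev_cons -cats1 weyl_act_cat.
have -> : weyl_act [:: a] (weyl_act (a :: ws) v) = weyl_act ws v by exact: reflK.
exact: IH.
Qed.

Lemma weyl_act_roots ws (v : V) : roots ws -> v \in Phi -> weyl_act ws v \in Phi.
Proof.
have [_ [_ [_ PP _ _]]] := HPhi.
by move=> + vP; elim: ws => //= a ws IH /andP[aP /IH]; apply: PP.
Qed.

Definition lattice (v : V) := exists c : 'I_n -> int, v = \sum_i b i *~ c i.

Lemma lattice_sum (I : Type) (r : seq I) (h : I -> V) (z : I -> int) :
  (forall i, lattice (h i)) -> lattice (\sum_(i <- r) h i *~ z i).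
Proof.
move=> H; apply: big_ind => [|_ _ [c ->] [d ->]|i _].
- by exists (fun=> 0); rewrite big1 // => i _; rewrite mulr0z.
- exists (fun i => c i + d i); rewrite -big_split; apply: eq_bigr => i _.
  by rewrite mulrzDr.
- have [c ->] := H i; exists (fun k => c k * z i).
  by rewrite mulrz_suml; apply: eq_bigr => k _; rewrite mulrzA.
Qed.

Lemma lattice_nth ws (k : 'I_(size Phi)) : roots ws -> lattice (weyl_act ws Phi`_k).
Proof.
move=> wsP; have [_ rootL _] := Hb.
by apply: rootL; apply: weyl_act_roots => //; apply: mem_nth.
Qed.

Lemma weyl_matrix_exists ws : roots ws -> exists C, weyl_matrix b ws C.
Proof.
move=> wsP; have [bL rootL _] := Hb.
have /choice[c cP] j : lattice (weyl_act ws (b j)).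
  have [d ->] := bL j; rewrite raddf_sum /=.
  under eq_bigr => k _ do rewrite raddfMz.
  by apply: lattice_sum => k; apply: lattice_nth.
exists (\matrix_(i, j) c j i) => j; rewrite cP.
by apply: eq_bigr => i _; rewrite mxE.
Qed.

Lemma basis_inj (c d : 'I_n -> int) :
  \sum_i b i *~ c i = \sum_i b i *~ d i -> c =1 d.
Proof.
have [_ _ indep] := Hb; move=> E i; apply/eqP; rewrite -subr_eq0; apply/eqP.
apply: (indep (fun i => c i - d i)); apply/eqP.
rewrite (eq_bigr (fun i => b i *~ c i - b i *~ d i)) ?sumrB ?E ?subrr //.
by move=> k _; rewrite mulrzBr.
Qed.

Lemma weyl_matrix_uniq ws ws' C C' : weyl_matrix b ws C -> weyl_matrix b ws' C' ->
  (forall j, weyl_act ws (b j) = weyl_act ws' (b j)) -> C = C'.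
Proof.
move=> HC HC' E; apply/matrixP => i j.
by apply: (@basis_inj (fun i => C i j) (fun i => C' i j)); rewrite -HC -HC' E.
Qed.

Lemma weyl_matrix_cat ws1 ws2 C1 C2 : weyl_matrix b ws1 C1 -> weyl_matrix b ws2 C2 ->
  weyl_matrix b (ws1 ++ ws2) (C1 *m C2).
Proof.
move=> H1 H2 j; rewrite weyl_act_cat H2 raddf_sum /=.
under eq_bigr => i _ do rewrite raddfMz /= H1 mulrz_suml.
rewrite exchange_big; apply: eq_bigr => k _ /=; rewrite mxE mulrz_sumr.
by apply: eq_bigr => i _; rewrite mulrzA.
Qed.

Lemma weyl_matrix_nil : weyl_matrix b [::] 1%:M.
Proof.
move=> j; rewrite /weyl_act /= (bigD1 j) //= mxE eqxx mulr1z big1 ?addr0 // => i ij.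
by rewrite mxE (negPf ij) mulr0z.
Qed.

Lemma weyl_matrix_rev ws C C' : roots ws -> weyl_matrix b ws C ->
  weyl_matrix b (rev ws) C' -> C' *m C = 1%:M.
Proof.
move=> wsP HC HC'.
apply: (weyl_matrix_uniq (weyl_matrix_cat HC' HC) weyl_matrix_nil) => j.
by rewrite weyl_act_cat weyl_actK.
Qed.

(** The column holds the coordinates of the root, the row the opposites of the integers
    [cartan (b j) a]. All entries are integers, so this shape survives reduction modulo [p]. *)
Lemma weyl_matrix_refl a : a \in Phi ->
  exists (u : 'cV[int]_n) (r : 'rV[int]_n), weyl_matrix b [:: a] (1%:M + u *m r).
Proof.
move=> aP; have [bL rootL _] := Hb; have [_ [_ [_ _ cint _]]] := HPhi.
have [c cE] := rootL a aP.
have /choice[z zP] j : exists z : int, cartan (b j) a = z%:~R.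
  have [d ->] := bL j.
  apply: (big_ind (fun v => exists z : int, cartan v a = z%:~R)).
  - by exists 0; rewrite -(scale0r 0) cartanZ mul0r.
  - by move=> u v [z1 E1] [z2 E2]; exists (z1 + z2); rewrite cartanD E1 E2 intrD.
  - move=> k _; have [z E] := cint a Phi`_k aP (mem_nth 0 (ltn_ord k)).
    by exists (d k * z); rewrite -scaler_int cartanZ E intrM.
exists (\col_i c i), (\row_j - z j) => j.
rewrite /weyl_act /= /refl zP scaler_int cE mulrz_suml -sumrN.
have bE : b j = \sum_i b i *~ (1%:M : 'M[int]_n) i j := weyl_matrix_nil j.
rewrite {1}bE -big_split; apply: eq_bigr => i _ /=.
rewrite !mxE big_ord1 !mxE mulrzDr; congr (_ + _).
by rewrite mulrN mulrNz mulrzA.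
Qed.

(** A Weyl group element is determined by its permutation of the roots, so counting all self-maps of
    the indices bounds the order of the group. *)
Definition root_maps := {ffun 'I_(size Phi) -> 'I_(size Phi)}.

(** Each [b j] is a combination of roots, so words acting alike on the roots have the same matrix:
    one matrix per map is enough. *)
Lemma weyl_matrices_finite : exists Ws : seq 'M[int]_n,
  [/\ (size Ws <= #|{: root_maps}|)%N,
      forall C, C \in Ws -> exists2 ws, roots ws & weyl_matrix b ws C
    & forall ws C, roots ws -> weyl_matrix b ws C -> C \in Ws].
Proof.
pose P (phi : root_maps) C := exists ws, [/\ roots ws, weyl_matrix b ws C
  & forall k : 'I_(size Phi), weyl_act ws Phi`_k = Phi`_(phi k)].
have /choice[g gP] (phi : root_maps) : exists o : option 'M[int]_n,
    if o is Some C then P phi C else forall C, ~ P phi C.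
  have [[C PC]|nP] := pselect (exists C, P phi C); first by exists (Some C).
  by exists None => C PC; apply: nP; exists C.
exists (pmap g (enum {: root_maps})); split.
- by rewrite size_pmap (leq_trans (count_size _ _)) // cardE.
- move=> C; rewrite mem_pmap => /mapP[phi _ E].
  by have := gP phi; rewrite -E => -[ws [? ? _]]; exists ws.
- move=> ws C wsP HC.
  have lt (k : 'I_(size Phi)) : (index (weyl_act ws Phi`_k) Phi < size Phi)%N.
    by rewrite index_mem weyl_act_roots // mem_nth.
  pose phi : root_maps := [ffun k => Ordinal (lt k)].
  have PC : P phi C.
    exists ws; split=> // k; rewrite ffunE /= nth_index //.
    by rewrite weyl_act_roots // mem_nth.
  rewrite mem_pmap; apply/mapP; exists phi; first by rewrite mem_enum.
  have := gP phi; case: (g phi) => [C'|/(_ C)//] [ws' [wsP' HC' E']].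
  congr Some; apply: (weyl_matrix_uniq HC HC') => j.
  have [bL _ _] := Hb; have [d ->] := bL j.
  rewrite !raddf_sum; apply: eq_bigr => k _ /=; rewrite !raddfMz /= E'.
  by rewrite ffunE /= nth_index // weyl_act_roots // mem_nth.
Qed.

End RootSystem.

Theorem mainTheorem3 (R : realType) (n : nat) (Phi : seq 'rV[R]_n)
    (b : 'I_n -> 'rV[R]_n) :
  is_root_system Phi -> is_root_lattice_basis Phi b ->
  exists p0 : nat,
    forall (F : closedFieldType) (p : nat),
      prime p -> p \in [pchar F] -> (p0 < p)%N ->
      forall (A : algType F) (x y : 'I_n -> A), is_weyl_algebra x y ->
      exists (D1 : unitRingType) (iota : A -> D1),
        is_skew_fraction_field (weyl_invariant Phi b x y) iota /\
        exists (m l : nat) (B : algType (ratfun F l)) (x' y' : 'I_m -> B)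
               (D2 : unitRingType) (j : B -> D2) (phi : D1 -> D2),
          is_weyl_algebra x' y' /\
          is_skew_fraction_field (fun _ : B => True) j /\
          [/\ (forall u v, phi (u + v) = phi u + phi v),
              (forall u v, phi (u * v) = phi u * phi v),
              phi 1 = 1 & bijective phi] /\
          (forall k : F, phi (iota (k%:A)) = j ((ratfun_const l k)%:A)).
Proof.
move=> HPhi Hb; have [Ws [Wsize Wex Wall]] := weyl_matrices_finite HPhi Hb.
(* This number is at least the number of matrices in [Ws], hence at least the order of [G]. *)
exists #|{: root_maps Phi}| => F p pr pF p0 A x y HA.
pose red : 'M[int]_n -> 'M[F]_n := map_mx intr.
have redM C C' : red (C *m C') = red C *m red C' by exact: map_mxM.
have red1 : red 1%:M = 1%:M by exact: map_mx1.
(* Distinct integer matrices may coincide modulo [p]. *)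
pose G := undup (map red Ws).
have GP w : reflect (exists2 C, C \in Ws & w = red C) (w \in G).
  by rewrite mem_undup; apply: mapP.
have HG : reflection_group G.
  split.
  - exact: undup_uniq.
  - by apply/GP; exists 1%:M; rewrite ?red1 // (Wall [::]) //; exact: weyl_matrix_nil.
  - move=> u v /GP[C CW ->] /GP[C' CW' ->]; apply/GP; exists (C *m C') => //.
    have [ws wsP HC] := Wex C CW; have [ws' wsP' HC'] := Wex C' CW'.
    by apply: (Wall (ws ++ ws')); rewrite ?all_cat ?wsP //; exact: weyl_matrix_cat.
  - move=> w /GP[C CW ->]; have [ws wsP HC] := Wex C CW.
    have rwsP : all (fun a => a \in Phi) (rev ws) by rewrite all_rev.
    have [C' HC'] := weyl_matrix_exists HPhi Hb rwsP.
    exists (red C'); first by apply/GP; exists C' => //; apply: Wall HC'.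
    by rewrite -redM (mulmx1C (weyl_matrix_rev HPhi Hb wsP HC HC')).
  (* [0 < d <= |G| <= p0 < p], so [p] does not divide [d]. *)
  - move=> d /andP[d0 dG]; rewrite -(dvdn_pcharf pF); apply/negP => /(dvdn_leq d0).
    rewrite leqNgt => /negP; apply; apply: leq_ltn_trans p0.
    by apply: leq_trans dG (leq_trans (size_undup _) _); rewrite size_map.
  - move=> w /GP[C CW ->]; have [ws wsP HC] := Wex C CW.
    elim: ws wsP C HC {CW} => [|a ws IH] /= wsP C HC.
      exists [::] => //=; rewrite -red1; congr red.
      by apply: (weyl_matrix_uniq Hb HC (weyl_matrix_nil b)).
    case/andP: wsP => aP wsP.
    have [C' HC'] := weyl_matrix_exists HPhi Hb wsP.
    have [u [r Hr]] := weyl_matrix_refl HPhi Hb aP.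
    have [ss E ssP] := IH wsP C' HC'.
    exists (red (1%:M + u *m r) :: ss) => /=.
      rewrite -E -redM; congr red.
      by apply: (weyl_matrix_uniq Hb HC (weyl_matrix_cat Hr HC')).
    move=> s; rewrite inE => /orP[/eqP ->|]; last exact: ssP.
    split; first by apply/GP; exists (1%:M + u *m r) => //; apply: (Wall [:: a]) => //=; rewrite aP.
    by exists (map_mx intr u), (map_mx intr r); rewrite /red map_mxD map_mx1 map_mxM.
have castE (z : int) (c : A) : z%:~R * c = (z%:~R : F) *: c.
  by rewrite scaler_int mulrzl.
have actE C C' s : weyl_alg_action x y C C' s <-> matrix_hom x y (red C) (red C') s.
  split=> [[Hs sxy]|[Hs sx sy]]; split=> // j.
  - by rewrite (sxy j).1; apply: eq_bigr => i _; rewrite castE mxE.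
  - by rewrite (sxy j).2; apply: eq_bigr => i _; rewrite castE mxE.
  - by split; rewrite ?sx ?sy; apply: eq_bigr => i _; rewrite castE mxE.
(* Invariance under words of reflections with integer matrices becomes invariance under [G]: a left
   inverse [v] over [F] is forced to be the reduction of the matrix of the reversed word. *)
have -> : weyl_invariant Phi b x y = (fun c => forall w v s, w \in G ->
    v *m w = 1%:M -> matrix_hom x y w v s -> s c = c).
  apply/funext => c; apply/propext; split=> [inv w v s|inv ws C C' s wsP HC CC' /actE Ms].
    move=> /GP[C CW ->] vC Ms; have [ws wsP HC] := Wex C CW.
    have rwsP : all (fun a => a \in Phi) (rev ws) by rewrite all_rev.
    have [C' HC'] := weyl_matrix_exists HPhi Hb rwsP.
    have CC' := weyl_matrix_rev HPhi Hb wsP HC HC'.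
    have vE : v = red C'.
      by rewrite -[v]mulmx1 -red1 -(mulmx1C CC') redM mulmxA vC mul1mx.
    by apply: (inv ws C C' s) => //; apply/actE; rewrite -vE.
  by apply: (inv (red C) (red C') s) => //; [apply/GP; exists C => //; apply: Wall HC
    | rewrite -redM CC' red1].
have [D1 [iota [j [iotaP jP ij]]]] := reflection_weyl_fractions pF HG HA.
exists D1, iota; split=> //.
(* For [l = 0] the base field [ratfun F 0] is [F] itself, so [A] can be taken for [B], and the same
   [D1] for both skew fields. *)
exists n, 0%N, A, x, y, D1, j, id; split=> //; split=> //; split=> //.
by split=> //; exists id.
Qed.
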